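(* Let $d\ge 2$ and $b>0$. Let $(t(v), v\in\mathbb{Z}^d)$ be a family of random variables taking values in $[0,b]$ which has a representation satisfying conditions (i$'$), (ii), (iii) and (iv) defined in the context. Let $T(0,v)$ denote the (site version) passage time from $0$ to $v$. Then there is a constant $C>0$ such that for all $v\in\mathbb{Z}^d$ with $|v|\ge 2$, $$\operatorname{Var}(T(0,v))\le \frac{C\,|v|}{\log|v|}.$$ The analogous result for the bond version also holds: if $(t(e), e\in E)$ is a family of $[0,b]$-valued random variables indexed by the edges of $\mathbb{Z}^d$ which has a representation satisfying the edge analogs of conditions (i$'$), (ii), (iii), (iv), then the same conclusion holds for the bond-version passage times.
   Context: For $v=(v_1,\dots,v_d)\in\mathbb{Z}^d$ put $|v|=\sum_{i=1}^d|v_i|$. $\mathbb{Z}^d$ is regarded as the cubic lattice graph (vertices at $|\cdot|$-distance $1$ are joined by an edge) and $E$ is its edge set. A path from $v$ to $w$ is a finite alternating sequence $v_0=v,e_1,v_1,\dots,e_n,v_n=w$ with $e_i$ an edge between $v_{i-1}$ and $v_i$; $|\pi|$ denotes the number of vertices of a path $\pi$. Passage times. Site version: given nonnegative values $t(v)$, $v\in\mathbb{Z}^d$, the passage time of a path $\pi$ is $T(\pi)=\sum_{v\in\pi}t(v)$ (sum over the vertices of $\pi$). Bond version: given nonnegative values $t(e)$, $e\in E$, $T(\pi)=\sum_{e\in\pi}t(e)$ (sum over the edges of $\pi$). In both cases $T(v,w)=\inf_{\pi:v\to w}T(\pi)$, the infimum over all paths $\pi$ from $v$ to $w$. An optimal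 path from $v$ to $w$ is a path $\pi$ from $v$ to $w$ with $T(\pi)\le T(\pi')$ for all paths $\pi'$ from $v$ to $w$. Representation. Let $S$ be a finite set and $I$ a countably infinite set. For a finite $W\subset I$ and $x\in S^I$ write $x_W=(x_i,i\in W)$. For a function $h:S^I\to\mathbb{R}$ and $y\in S^W$, say that $y$ determines the value of $h$ if $h(x)=h(x')$ for all $x,x'\in S^I$ with $x_W=x'_W=y$. Let $X_i$, $i\in I$, be i.i.d. $S$-valued random variables. The random variables $t(v)$, $v\in\mathbb{Z}^d$, are represented by $(X_i,i\in I)$ if each $t(v)$ is a (measurable) function of $(X_i,i\in I)$. The family $(t(v),v\in\mathbb{Z}^d)$ has a representation satisfying (i$'$), (ii), (iii), (iv) if there are such $S$, $I$, $(X_i)_{i\in I}$ representing it with: (i$'$) There exist $c_0>0$, $\varepsilon_0>0$ and $\varepsilon_1>0$ such that for each $v\in\mathbb{Z}^d$ there is a sequence $i_1(v),i_2(v),\dots$ of elements of $I$ such that for all $k=1,2,\dots$, $$P\big((X_{i_1(v)},\dots,X_{i_k(v)})\text{ does not determine }t(v)\big)\le c_0\exp(-\varepsilon_0k^{\varepsilon_1}).$$ (ii) For the sequences in (i$'$): there exists $\alpha>0$ such that for all $v,w\in\mathbb{Z}^d$ and all positive integers $k<\alpha|v-w|$, $$\{i_1(v),\dots,i_k(v)\}\cap\{i_1(w),\dots,i_k(w)\}=\varnothing.$$ (iii) The distribution of the family $(t(v),v\in\mathbb{Z}^d)$ is invariant under translations of $\mathbb{Z}^d$. (iv) There exist $c_1,c_2,c_3>0$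 such that for all vertices $v,w$ the probability that there is no optimal path $\pi$ from $v$ to $w$ with $|\pi|\le c_1|v-w|$ is at most $c_2\exp(-c_3|v-w|)$. The edge analogs of (i$'$), (ii), (iii) are obtained by replacing vertices $v,w$ by edges $e,f\in E$ throughout, with $|v-w|$ in (ii) replaced by the distance between $e$ and $f$, i.e. the minimum of $|x-y|$ over endpoints $x$ of $e$ and $y$ of $f$; the edge analog of (iv) is (iv) verbatim (for pairs of vertices $v,w$) with the bond-version passage times. *)

(* Defs.v *)
From HB Require Import structures.
From mathcomp Require Import all_boot all_order all_algebra.
From mathcomp Require Import finmap.
From mathcomp Require Import all_classical all_reals all_analysis.
Set Implicit Arguments.
Unset Strict Implicit.
Unset Printing Implicit Defensive.
Import Order.TTheory GRing.Theory Num.Theory.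
Local Open Scope classical_set_scope.
Local Open Scope ring_scope.

Notation site d := 'rV[int]_d (only parsing).

Definition l1norm (d : nat) (v : site d) : nat :=
  (\sum_(i < d) `|v ord0 i|)%N.

Definition lattice_adj (d : nat) (x y : site d) : bool := l1norm (x - y) == 1%N.

(* Edges are undirected: an edge is the unordered pair of its endpoints. *)
Definition is_edge (d : nat) (A : {fset site d}) : bool :=
  `[< exists x y : site d, lattice_adj x y /\ A = [fset x; y]%fset >].

Record edge (d : nat) := Edge {
  endpoints : {fset site d};
  endpointsP : is_edge endpoints }.

HB.instance Definition _ (d : nat) := [isSub for @endpoints d].
HB.instance Definition _ (d : nat) := [Choice of edge d by <:].

Lemma is_edge_shift (d : nat) (z : site d) (e : edge d) :
  is_edge [fset (x + z)%R | x in endpoints e]%fset.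
Proof.
case: e => A /= /asboolP[x [y [xy ->]]]; apply/asboolP.
exists (x + z), (y + z); split.
  by rewrite /lattice_adj opprD addrACA subrr addr0.
exact: imfset_fset2.
Qed.

Definition shift_site (d : nat) (z v : site d) : site d := v + z.

Definition shift_edge (d : nat) (z : site d) (e : edge d) : edge d :=
  Edge (is_edge_shift z e).

Definition site_dist (R : realType) (d : nat) (v w : site d) : R :=
  (l1norm (v - w))%:R.

(* The infimum of a finite nonempty set, hence a minimum. *)
Definition edge_dist (R : realType) (d : nat) (e f : edge d) : R :=
  inf [set site_dist R x y | x in [set` endpoints e] & y in [set` endpoints f]].

(* The path v_0, e_1, v_1, ..., e_n, v_n is given by its starting point v_0
   and the sequence [:: (e_1, v_1); ...; (e_n, v_n)]. Vertices and edges may be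
   repeated, and are then counted with multiplicity. *)
Definition steps (d : nat) := seq (edge d * site d).

Fixpoint is_path (d : nat) (v : site d) (p : steps d) (w : site d) : bool :=
  if p is (e, u) :: q then
    (endpoints e == [fset v; u]%fset) && is_path u q w
  else v == w.

Definition nb_vertices (d : nat) (p : steps d) : nat := (size p).+1.

Definition site_time (R : realType) (d : nat) (t : site d -> R)
    (v : site d) (p : steps d) : R :=
  t v + \sum_(s <- p) t s.2.

Definition bond_time (R : realType) (d : nat) (t : edge d -> R)
    (v : site d) (p : steps d) : R :=
  \sum_(s <- p) t s.1.

(* [time v p] is the passage time of the path starting at [v] with steps [p]:
   [site_time t] or [bond_time t]. *)
Definition passage_time (R : realType) (d : nat)
    (time : site d -> steps d -> R) (v w : site d) : R :=
  inf [set time v p | p in [set p | is_path v p w]].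

Definition optimal_path (R : realType) (d : nat)
    (time : site d -> steps d -> R) (v : site d) (p : steps d) (w : site d) :
    Prop :=
  is_path v p w /\ forall q, is_path v q w -> time v p <= time v q.

(* The product sigma-algebra on M^K, where M carries the sigma-algebra
   generated by G. *)
Definition product_sigma (K M : Type) (G : set (set M)) : set (set (K -> M)) :=
  <<s [set A | exists k B, G B /\ A = [set x | B (x k)]] >>.

(* S is finite, so every subset of S is an event. *)
Definition iid (R : realType) (disp : measure_display)
    (T : measurableType disp) (P : probability T R)
    (S : finType) (I : countType) (X : I -> T -> S) : Prop :=
  [/\ forall i (B : set S), measurable (X i @^-1` B),
      forall i j (B : set S), P (X i @^-1` B) = P (X j @^-1` B)
    & forall (J : {fset I}) (B : I -> set S),
        P (\bigcap_(i in [set` J]) (X i @^-1` B i)) =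
        (\prod_(i <- J) P (X i @^-1` B i))%E].

Definition restr (S : finType) (I : countType) (W : {fset I}) (x : I -> S) :
    {ffun W -> S} :=
  [ffun i => x (val i)].

Definition determines (R : realType) (S : finType) (I : countType)
    (W : {fset I}) (y : {ffun W -> S}) (h : (I -> S) -> R) : Prop :=
  forall x x' : I -> S, restr W x = y -> restr W x' = y -> h x = h x'.

(* {i_1, ..., i_k}; the sequence is indexed from 0, i.e. [i j] is i_(j+1). *)
Definition first_indices (I : countType) (i : nat -> I) (k : nat) : {fset I} :=
  [fset i j | j in iota 0 k]%fset.

Definition represented (R : realType) (T : Type) (K : Type)
    (S : finType) (I : countType) (X : I -> T -> S)
    (g : K -> (I -> S) -> R) (t : K -> T -> R) : Prop :=
  forall k,
    (forall B : set R, measurable B ->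
      product_sigma setT (g k @^-1` B)) /\
    (forall omega, t k omega = g k (fun i => X i omega)).

Definition cond_i' (R : realType) (disp : measure_display)
    (T : measurableType disp) (P : probability T R) (K : Type)
    (S : finType) (I : countType) (X : I -> T -> S)
    (g : K -> (I -> S) -> R) (i : K -> nat -> I) : Prop :=
  exists c0 eps0 eps1 : R, [/\ 0 < c0, 0 < eps0, 0 < eps1 &
    forall (v : K) (k : nat), (0 < k)%N ->
      (P [set omega | ~ determines
            (restr (first_indices (i v) k) (fun j => X j omega)) (g v)]
       <= (c0 * expR (- eps0 * k%:R `^ eps1))%:E)%E].

Definition cond_ii (R : realType) (K : Type) (dist : K -> K -> R)
    (I : countType) (i : K -> nat -> I) : Prop :=
  exists2 alpha : R, 0 < alpha &
    forall (v w : K) (k : nat), (0 < k)%N -> k%:R < alpha * dist v w ->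
      [disjoint first_indices (i v) k & first_indices (i w) k]%fset.

Definition cond_iii (R : realType) (disp : measure_display)
    (T : measurableType disp) (P : probability T R) (d : nat) (K : Type)
    (shift : site d -> K -> K) (t : K -> T -> R) : Prop :=
  forall (z : site d) (A : set (K -> R)), product_sigma measurable A ->
    P [set omega | A (fun k => t (shift z k) omega)] =
    P [set omega | A (fun k => t k omega)].

Definition cond_iv (R : realType) (disp : measure_display)
    (T : measurableType disp) (P : probability T R) (d : nat)
    (time : T -> site d -> steps d -> R) : Prop :=
  exists c1 c2 c3 : R, [/\ 0 < c1, 0 < c2, 0 < c3 &
    forall v w : site d,
      (P [set omega | ~ exists2 p : steps d,
            optimal_path (time omega) v p w &
            ((nb_vertices p)%:R <= c1 * (l1norm (v - w))%:R)%R]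
       <= (c2 * expR (- c3 * (l1norm (v - w))%:R))%:E)%E].

(* K is the index set of the passage times: the sites or the edges. *)
Definition has_representation (R : realType) (disp : measure_display)
    (T : measurableType disp) (P : probability T R) (d : nat) (K : Type)
    (dist : K -> K -> R) (shift : site d -> K -> K)
    (time : (K -> R) -> site d -> steps d -> R) (t : K -> T -> R) : Prop :=
  exists (S : finType) (I : countType) (X : I -> T -> S)
    (g : K -> (I -> S) -> R),
    [/\ infinite_set [set: I], iid P X, represented X g t &
      [/\ exists2 i : K -> nat -> I, cond_i' P X g i & cond_ii dist i,
          cond_iii P shift t &
          cond_iv P (fun omega => time (fun k => t k omega))]].

Definition site_representation (R : realType) (disp : measure_display)
    (T : measurableType disp) (P : probability T R) (d : nat)
    (t : site d -> T -> R) : Prop :=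
  has_representation P (@site_dist R d) (@shift_site d) (@site_time R d) t.

Definition bond_representation (R : realType) (disp : measure_display)
    (T : measurableType disp) (P : probability T R) (d : nat)
    (t : edge d -> T -> R) : Prop :=
  has_representation P (@edge_dist R d) (@shift_edge d) (@bond_time R d) t.

(* Main.v *)
Require Import Defs.
From HB Require Import structures.
From mathcomp Require Import all_boot all_order all_algebra.
From mathcomp Require Import finmap.
From mathcomp Require Import all_classical all_reals all_analysis.
From mathcomp Require Import measurable_realfun.
From mathcomp Require Import zify ring lra.
Set Implicit Arguments.
Unset Strict Implicit.
Unset Printing Implicit Defensive.
Import Order.TTheory GRing.Theory Num.Theory.
Import numFieldNormedType.Exports.
Local Open Scope classical_set_scope.
Local Open Scope ring_scope.

(** The passage time between [0] and [v] is replaced by its average [F] over the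
translates of the two end points by the vectors of a cube of side [m], a small
power of [|v|]; this changes it by [O (m)] only. Truncating the lengths of paths
([ltime]) and the determination of the passage times ([tau]) turns [F] into a
function on a finite product space.

On such a space, applying a logarithmic Sobolev inequality to each increment of
the martingale of [F] gives the inequality of Falik and Samorodnitsky
([falik_samorodnitsky]): up to constants, [Var F * ln lam] is at most the sum of
the mean squared deviations of [F] under resampling of single coordinates, plus
[lam] times the sum of the squares of the mean absolute deviations. It remains to
see that the first sum is [O (|v|)] and that every mean absolute deviation is at
most a negative power of [|v|], for then [lam] can be a power of [|v|].

Resampling a coordinate increases the passage time only through the vertices of
the selected optimal path whose passage times depend on that coordinate. Let the
radius of a vertex be the number of coordinates that must be revealed to
determine the passage times there. A vertex is reached by few coordinates, and
shares them with few others, in terms of its radius; so the first sum is at most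
the sum over the path of a polynomial in the radii ([sum_hits_sqr]). The path
depends on everything, but no path of [L] steps can have many vertices of large
radius: vertices of radius larger than [k] are extremely rare and independent at
distances of order [k], and a union bound over coarse skeletons of paths, taken
at a scale that is a large power of [k], is affordable ([greedy_level]). Summing
over [k] gives a bound linear in [L] ([influence_sum]).

For the mean absolute deviations, a coordinate matters only for the vertices of
a small ball. By stationarity, averaging over the translations in the cube turns
the probability that a given vertex is on the path into the mean number of
visits of a single path to a translated cube, divided by [m ^ d]
([sum_visits]). A path that has the fewest steps among the optimal ones makes at
most [O (m)] visits, since with high probability any two vertices at distance of
order [m] near the cube are joined by an optimal path with [O (m)] steps
([local_visits]). As [d >= 2], this is a gain of a power of [m]. *)

(** * Finite product spaces *)

Section FiniteProduct.
Context {R : realType} {J S : finType} (p : S -> R).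
Hypothesis p_ge0 : forall s, 0 <= p s.
Hypothesis p_sum1 : \sum_s p s = 1.
Local Notation Om := {ffun J -> S}.
Implicit Types (f g : Om -> R) (x y : Om) (i j : J) (l : seq J).

Definition upd x j (s : S) : Om := [ffun i => if i == j then s else x i].
Definition mu x : R := \prod_j p (x j).
Definition Ex f : R := \sum_x mu x * f x.
Definition Ec j f x : R := \sum_s p s * f (upd x j s).
Definition Ecs l f := foldr Ec f l.
Definition indep j f := forall x s, f (upd x j s) = f x.

Lemma updE x j s i : upd x j s i = if i == j then s else x i.
Proof. by rewrite ffunE. Qed.

Lemma updK x j s s' : upd (upd x j s) j s' = upd x j s'.
Proof. by apply/ffunP => i; rewrite !ffunE; case: eqP. Qed.

Lemma upd_id x j : upd x j (x j) = x.
Proof. by apply/ffunP => i; rewrite !ffunE; case: eqP => [->|]. Qed.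

Lemma updC x i j s s' : i != j -> upd (upd x i s) j s' = upd (upd x j s') i s.
Proof.
move=> ij; apply/ffunP => k; rewrite !ffunE.
by case: eqP => // ->; case: eqP => // ji; rewrite ji eqxx in ij.
Qed.

Lemma mu_ge0 x : 0 <= mu x.
Proof. exact: prodr_ge0. Qed.

Lemma mu_upd x j s : mu x * p s = mu (upd x j s) * p (x j).
Proof.
rewrite /mu (bigD1 j) //= [in RHS](bigD1 j) //= updE eqxx.
rewrite mulrAC [in RHS]mulrAC (mulrC (p s)); congr (_ * _).
by apply: eq_bigr => i ij; rewrite updE (negbTE ij).
Qed.

(** Resampling one coordinate is reversible: [x] and its resampled copy form an
exchangeable pair. *)
Lemma Ex_exchange j (h : Om -> Om -> R) :
  Ex (fun x => \sum_s p s * h x (upd x j s)) =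
  Ex (fun x => \sum_s p s * h (upd x j s) x).
Proof.
rewrite /Ex; under eq_bigr do rewrite mulr_sumr.
under [RHS]eq_bigr do rewrite mulr_sumr.
rewrite !pair_big /=.
pose sw (u : Om * S) := (upd u.1 j u.2, u.1 j).
have swK : involutive sw.
  by move=> [x s]; rewrite /sw /= updK upd_id updE eqxx.
rewrite (reindex_inj (inv_inj swK)) /=.
apply: eq_bigr => -[x s] _ /=.
by rewrite updK upd_id !mulrA -mu_upd.
Qed.

Lemma Ex_Ec j f : Ex (Ec j f) = Ex f.
Proof.
rewrite /Ec (Ex_exchange j (fun _ y => f y)); apply: eq_bigr => x _.
by rewrite -mulr_suml p_sum1 mul1r.
Qed.

Lemma mu_sum1 : \sum_x mu x = 1.
Proof.
rewrite /mu -(bigA_distr_bigA (fun _ : J => p)) /=.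
by rewrite big1 // => j _; rewrite p_sum1.
Qed.

Lemma eq_Ex f g : f =1 g -> Ex f = Ex g.
Proof. by move=> fg; apply: eq_bigr => x _; rewrite fg. Qed.

Lemma ExD f g : Ex (fun x => f x + g x) = Ex f + Ex g.
Proof. by rewrite /Ex -big_split /=; apply: eq_bigr => x _; rewrite mulrDr. Qed.

Lemma ExZ c f : Ex (fun x => c * f x) = c * Ex f.
Proof. by rewrite /Ex mulr_sumr; apply: eq_bigr => x _; rewrite mulrCA. Qed.

Lemma ExB f g : Ex (fun x => f x - g x) = Ex f - Ex g.
Proof.
by rewrite /Ex -sumrB; apply: eq_bigr => x _; rewrite mulrBr.
Qed.

Lemma Ex_cst c : Ex (fun=> c) = c.
Proof. by rewrite /Ex -mulr_suml mu_sum1 mul1r. Qed.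

Lemma Ex_sum (I : Type) (r : seq I) (P : pred I) (F : I -> Om -> R) :
  Ex (fun x => \sum_(i <- r | P i) F i x) = \sum_(i <- r | P i) Ex (F i).
Proof.
rewrite /Ex exchange_big /=; apply: eq_bigr => x _; by rewrite mulr_sumr.
Qed.

Lemma ler_Ex f g : (forall x, f x <= g x) -> Ex f <= Ex g.
Proof. by move=> fg; apply: ler_sum => x _; rewrite ler_wpM2l ?mu_ge0. Qed.

Lemma Ex_ge0 f : (forall x, 0 <= f x) -> 0 <= Ex f.
Proof. by move=> f0; apply: sumr_ge0 => x _; rewrite mulr_ge0 ?mu_ge0. Qed.

Lemma eq_Ec j f g : f =1 g -> Ec j f =1 Ec j g.
Proof. by move=> fg x; apply: eq_bigr => s _; rewrite fg. Qed.

Lemma EcD j f g : Ec j (fun x => f x + g x) =1 (fun x => Ec j f x + Ec j g x).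
Proof. by move=> x; rewrite /Ec -big_split /=; apply: eq_bigr => s _; rewrite mulrDr. Qed.

Lemma EcB j f g : Ec j (fun x => f x - g x) =1 (fun x => Ec j f x - Ec j g x).
Proof. by move=> x; rewrite /Ec -sumrB; apply: eq_bigr => s _; rewrite mulrBr. Qed.

Lemma ler_Ec j f g : (forall x, f x <= g x) -> forall x, Ec j f x <= Ec j g x.
Proof. by move=> fg x; apply: ler_sum => s _; rewrite ler_wpM2l. Qed.

Lemma indep_Ec j f : indep j (Ec j f).
Proof. by move=> x s; apply: eq_bigr => s' _; rewrite updK. Qed.

Lemma EcM j f g : indep j f -> Ec j (fun x => f x * g x) =1 (fun x => f x * Ec j g x).
Proof.
move=> jf x; rewrite /Ec mulr_sumr; apply: eq_bigr => s _.
by rewrite jf mulrCA.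
Qed.

Lemma EcC i j f : Ec i (Ec j f) =1 Ec j (Ec i f).
Proof.
move=> x; case: (eqVneq i j) => [->//|ij]; rewrite /Ec.
under eq_bigr do rewrite mulr_sumr.
rewrite exchange_big /=; apply: eq_bigr => s _.
rewrite mulr_sumr; apply: eq_bigr => s' _.
by rewrite mulrCA updC.
Qed.

Lemma indep_EcC i j f : indep i f -> indep i (Ec j f).
Proof.
move=> fi x s; case: (eqVneq i j) => [->|ij]; first exact: indep_Ec.
by apply: eq_bigr => s' _; rewrite updC // fi.
Qed.

Lemma Ec_abs j f x : `|Ec j f x| <= Ec j (fun y => `|f y|) x.
Proof.
apply: le_trans (ler_norm_sum _ _ _) _; apply: ler_sum => s _.
by rewrite normrM ger0_norm.
Qed.

Lemma EcsB l f g : Ecs l (fun x => f x - g x) =1 (fun x => Ecs l f x - Ecs l g x).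
Proof.
elim: l => //= j l IH x; rewrite (eq_Ec j IH); exact: EcB.
Qed.

Lemma eq_Ecs l f g : f =1 g -> Ecs l f =1 Ecs l g.
Proof. by move=> fg; elim: l => //= j l IH; apply: eq_Ec. Qed.

Lemma Ecs_EcC l j f : Ecs l (Ec j f) =1 Ec j (Ecs l f).
Proof.
elim: l => //= i l IH x; rewrite (eq_Ec i IH); exact: EcC.
Qed.

Lemma Ex_Ecs l f : Ex (Ecs l f) = Ex f.
Proof. by elim: l => //= j l IH; rewrite Ex_Ec. Qed.

Lemma ler_Ecs l f g : (forall x, f x <= g x) -> forall x, Ecs l f x <= Ecs l g x.
Proof. by move=> fg; elim: l => //= j l IH; exact: ler_Ec. Qed.

Lemma Ecs_abs l f x : `|Ecs l f x| <= Ecs l (fun y => `|f y|) x.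
Proof.
elim: l x => //= j l IH x; apply: le_trans (Ec_abs _ _ _) _.
exact: ler_Ec.
Qed.

Lemma indep_Ecs_in l j f : j \in l -> indep j (Ecs l f).
Proof.
elim: l => //= i l IH; rewrite inE => /orP[/eqP->|jl]; first exact: indep_Ec.
exact/indep_EcC/IH.
Qed.

Lemma indep_Ecs l j f : indep j f -> indep j (Ecs l f).
Proof. by move=> jf; elim: l => //= i l IH; exact: indep_EcC. Qed.

Lemma Ecs_upd l j f x s : j \notin l ->
  Ecs l f (upd x j s) = Ecs l (fun y => f (upd y j s)) x.
Proof.
elim: l x => //= i l IH x; rewrite inE negb_or => /andP[ji jl].
by apply: eq_bigr => s' _; rewrite updC // IH.
Qed.

Lemma EcsM l f g : (forall j, j \in l -> indep j f) ->
  Ecs l (fun x => f x * g x) =1 (fun x => f x * Ecs l g x).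
Proof.
elim: l => //= i l IH fl x.
rewrite (eq_Ec i (IH _)); last by move=> j jl; apply: fl; rewrite inE jl orbT.
by rewrite EcM //; apply: fl; rewrite inE eqxx.
Qed.

Lemma indep_cst f : (forall j, indep j f) -> forall x y, f x = f y.
Proof.
move=> fi x y.
pose mix l := [ffun i => if i \in l then y i else x i] : Om.
have mixE l : f (mix l) = f x.
  elim: l => [|j l IH]; first by congr f; apply/ffunP => i; rewrite ffunE in_nil.
  rewrite -IH -(fi j (mix l) (y j)); congr f; apply/ffunP => i.
  by rewrite !ffunE inE; case: eqP => // ->.
rewrite -(mixE (enum J)); congr f; apply/ffunP => i.
by rewrite ffunE mem_enum.
Qed.

Lemma Ex_const f x : (forall j, indep j f) -> f x = Ex f.
Proof.
move=> fi; rewrite -[LHS]Ex_cst; apply: eq_Ex => y; exact: indep_cst.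
Qed.

Lemma Ecs_full f x : Ecs (enum J) f x = Ex f.
Proof.
rewrite (@Ex_const (Ecs (enum J) f)); first exact: Ex_Ecs.
by move=> j; apply: indep_Ecs_in; rewrite mem_enum.
Qed.

(** Averaging over [D] first leaves [f] untouched and turns [g] into its mean. *)
Lemma Ex_indepM (D : {set J}) f g :
  (forall j, j \in D -> indep j f) -> (forall j, j \notin D -> indep j g) ->
  Ex (fun x => f x * g x) = Ex f * Ex g.
Proof.
move=> fD gD; rewrite -(Ex_Ecs (enum D)).
rewrite (@eq_Ex _ (fun x => f x * Ex g)); last first.
  move=> x; rewrite EcsM; last by move=> j; rewrite mem_enum => /fD.
  congr (_ * _); rewrite (@Ex_const (Ecs (enum D) g)) ?Ex_Ecs // => j.
  have [jD|jD] := boolP (j \in D); first by apply: indep_Ecs_in; rewrite mem_enum.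
  exact/indep_Ecs/gD.
by rewrite mulrC -ExZ; apply: eq_Ex => x; rewrite mulrC.
Qed.

Lemma Ex_prod_indep (I : eqType) (r : seq I) (D : I -> {set J}) (h : I -> Om -> R) :
  uniq r ->
  (forall (a : I) j, a \in r -> j \notin D a -> indep j (h a)) ->
  (forall a a' : I, a \in r -> a' \in r -> a != a' ->
    forall j, j \in D a -> j \notin D a') ->
  Ex (fun x => \prod_(a <- r) h a x) = \prod_(a <- r) Ex (h a).
Proof.
elim: r => [|b r IH] /=.
  move=> _ _ _; rewrite big_nil -[RHS]Ex_cst.
  by apply: eq_Ex => x; rewrite big_nil.
move=> /andP[br ur] hD dD; rewrite big_cons -IH //; first last.
- by move=> a a' ar ar'; apply: dD; rewrite inE ?ar ?ar' orbT.
- by move=> a j ar; apply: hD; rewrite inE ar orbT.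
rewrite mulrC -(@Ex_indepM (D b)); first last.
- by move=> j; apply: hD; rewrite inE eqxx.
- move=> j jD x s; apply: eq_big_seq => a ar; apply: hD.
    by rewrite inE ar orbT.
  have := dD b a; rewrite !inE eqxx ar orbT => /(_ isT isT).
  have ba : b != a by apply: contraNneq br => ->.
  by move=> /(_ ba j jD).
by apply: eq_Ex => x; rewrite big_cons mulrC.
Qed.

End FiniteProduct.

(** * Entropy and the inequality of Falik and Samorodnitsky *)

Section EntropyInequality.
Context {R : realType}.

Lemma ln_tangent (u c : R) : 0 < u -> 0 < c -> ln u <= ln c + (u / c - 1).
Proof.
move=> u0 c0; have uc : 0 < u / c by rewrite divr_gt0.
rewrite -lerBlDl -ln_div ?posrE //.
by rewrite -[X in ln X](subrKC 1); apply: le_ln1Dx; rewrite ltrBrDl subrr.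
Qed.

Lemma discriminant_bound (A B C : R) : 0 <= A ->
  (forall t, 0 <= A * t ^+ 2 - 2 * B * t + C) -> B ^+ 2 <= A * C.
Proof.
rewrite le_eqVlt => /predU1P[<- h|A0 h]; last first.
  have := h (B / A); have -> : A * (B / A) ^+ 2 - 2 * B * (B / A) + C =
    (A * C - B ^+ 2) / A by field; rewrite gt_eqF.
  by rewrite pmulr_lge0 ?invr_gt0 // subr_ge0.
have [->|B0] := eqVneq B 0; first by rewrite expr0n mul0r.
have := h ((C + 1) / (2 * B)).
rewrite mul0r sub0r mulrC divfK ?mulf_neq0 //; lra.
Qed.

Context {J S : finType} (p : S -> R) (p0 : R).
Hypothesis p_ge0 : forall s, 0 <= p s.
Hypothesis p_sum1 : \sum_s p s = 1.
Hypothesis p0_gt0 : 0 < p0.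
Hypothesis p0_le : forall s, p s = 0 \/ p0 <= p s.

(** The tangent line of the logarithm at the mean bounds the entropy of [G] by its
chi-square distance to the mean. No value of [G] exceeds [1 / p0] times the mean,
so that the weights [G s + G s'] of the hypothesis cancel its denominator. *)
Lemma entropy_atom (G : S -> R) (D : S -> S -> R) :
  (forall s, 0 <= G s) -> (forall s s', 0 <= D s s') ->
  (forall s s', (G s - G s') ^+ 2 <= D s s' * (2 * (G s + G s'))) ->
  \sum_s p s * (G s * ln (G s)) - (\sum_s p s * G s) * ln (\sum_s p s * G s) <=
  2 / p0 * \sum_s \sum_s' p s * p s' * D s s'.
Proof.
move=> G0 D0 GD; set c := \sum_s p s * G s.
have pG0 s : 0 <= p s * G s by rewrite mulr_ge0.
have c_ge0 : 0 <= c by apply: sumr_ge0.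
have R0 : 0 <= 2 / p0 * \sum_s \sum_s' p s * p s' * D s s'.
  rewrite mulr_ge0 ?divr_ge0 ?(ltW p0_gt0) //; apply: sumr_ge0 => s _.
  by apply: sumr_ge0 => s' _; rewrite !mulr_ge0.
have pGc s : p s * G s <= c.
  by rewrite /c (bigD1 s) //= lerDl; apply: sumr_ge0.
move: c_ge0; rewrite le_eqVlt => /predU1P[c0|c_gt0].
  rewrite -c0 mul0r subr0 big1 // => s _.
  have : p s * G s = 0 by apply/eqP; rewrite eq_le pG0 andbT c0.
  by rewrite mulrA => ->; rewrite mul0r.
have Gc s : p s * G s ^+ 2 <= c * c / p0 /\ (p s = 0 \/ G s <= c / p0).
  have [ps0|ps] := p0_le s.
    by rewrite ps0 mul0r; split; [rewrite !mulr_ge0 ?invr_ge0 ?(ltW p0_gt0) ?(ltW c_gt0)|left].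
  have Gs : G s <= c / p0.
    rewrite ler_pdivlMr // mulrC (le_trans _ (pGc s)) //.
    by rewrite ler_wpM2r.
  split; last by right.
  by rewrite expr2 mulrA -[leRHS]mulrA ler_pM.
apply: (@le_trans _ _ ((\sum_s p s * G s ^+ 2 - c ^+ 2) / c)).
  have -> : (\sum_s p s * G s ^+ 2 - c ^+ 2) / c =
    \sum_s (p s * G s * (ln c + (G s / c - 1))) - c * ln c.
    rewrite [X in _ = X - _](eq_bigr (fun s =>
      p s * G s ^+ 2 / c + p s * G s * (ln c - 1))); last by move=> s _; ring.
    rewrite big_split /= -!mulr_suml -/c; field; by rewrite gt_eqF.
  apply: lerB => //; apply: ler_sum => s _.
  rewrite mulrA; have [Gs0|Gs0] := eqVneq (G s) 0; first by rewrite Gs0 !mulr0 !mul0r.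
  by rewrite ler_wpM2l // ln_tangent // lt_neqAle eq_sym Gs0 G0.
have dbl : \sum_s \sum_s' p s * p s' * (G s - G s') ^+ 2 =
    2 * (\sum_s p s * G s ^+ 2 - c ^+ 2).
  have -> : 2 * (\sum_s p s * G s ^+ 2 - c ^+ 2) =
    \sum_s (p s * G s ^+ 2 * 1 + p s * (\sum_s' p s' * G s' ^+ 2) -
       2 * (p s * G s * c)).
    by rewrite sumrB big_split /= -mulr_sumr -!mulr_suml p_sum1 -/c; ring.
  apply: eq_bigr => s _; rewrite -{1}p_sum1 /c !mulr_sumr -big_split -sumrB /=.
  by apply: eq_bigr => s' _; ring.
have le1 : \sum_s \sum_s' p s * p s' * (G s - G s') ^+ 2 <=
    4 * c / p0 * \sum_s \sum_s' p s * p s' * D s s'.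
  rewrite mulr_sumr; apply: ler_sum => s _; rewrite mulr_sumr.
  apply: ler_sum => s' _.
  rewrite [leRHS]mulrCA; have [_ [->|Gs]] := Gc s; first by rewrite !mul0r.
  have [_ [->|Gs']] := Gc s'; first by rewrite mulr0 !mul0r.
  apply: ler_wpM2l; first by rewrite mulr_ge0.
  apply: le_trans (GD s s') _; rewrite mulrC ler_wpM2r //; lra.
rewrite ler_pdivrMr //.
have -> : \sum_s p s * G s ^+ 2 - c ^+ 2 =
   2^-1 * \sum_s \sum_s' p s * p s' * (G s - G s') ^+ 2 by rewrite dbl mulrA mulVf ?mul1r.
apply: le_trans (ler_wpM2l _ le1) _; first by rewrite invr_ge0.
rewrite le_eqVlt; apply/orP; left; apply/eqP; field; by rewrite gt_eqF.
Qed.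

Local Notation Om := {ffun J -> S}.
Local Notation Ex := (@Ex R J S p).
Local Notation Ec := (@Ec R J S p).
Local Notation Ecs := (@Ecs R J S p).
Implicit Types (f g : Om -> R) (x y : Om) (i j : J) (l : seq J).

Lemma EcsZ l (c : R) f : Ecs l (fun x => c * f x) =1 (fun x => c * Ecs l f x).
Proof. exact: (@EcsM R J S p l (fun=> c) f). Qed.

Lemma EcsD l f g : Ecs l (fun x => f x + g x) =1 (fun x => Ecs l f x + Ecs l g x).
Proof.
by elim: l => //= j l IH x; rewrite (eq_Ec p j IH) EcD.
Qed.

Lemma Ecs_ge0 l f : (forall x, 0 <= f x) -> forall x, 0 <= Ecs l f x.
Proof.
move=> f0 x; rewrite -[leLHS](mul0r (Ecs l f x)) -EcsZ.
by apply: (ler_Ecs p_ge0) => y; rewrite mul0r.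
Qed.

Lemma Ecs_CauchySchwarz l f g x :
  Ecs l (fun y => f y * g y) x ^+ 2 <=
  Ecs l (fun y => f y ^+ 2) x * Ecs l (fun y => g y ^+ 2) x.
Proof.
apply: discriminant_bound => [|t].
  by apply: Ecs_ge0 => y; exact: sqr_ge0.
have : 0 <= Ecs l (fun y => (t * f y - g y) ^+ 2) x.
  by apply: Ecs_ge0 => y; exact: sqr_ge0.
have -> : Ecs l (fun y => (t * f y - g y) ^+ 2) x =
  Ecs l (fun y => (t ^+ 2 * f y ^+ 2 - 2 * t * (f y * g y)) + g y ^+ 2) x.
  by apply: eq_Ecs => y; ring.
by rewrite EcsD EcsB !EcsZ; congr (0 <= _); ring.
Qed.

Lemma Ex_var j g : Ex (fun x => (g x - Ec j g x) ^+ 2) =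
  Ex (fun x => g x ^+ 2) - Ex (fun x => Ec j g x ^+ 2).
Proof.
have e : Ex (fun x => Ec j g x * g x) = Ex (fun x => Ec j g x ^+ 2).
  rewrite -(Ex_Ec p_sum1 j); apply: eq_Ex => x.
  by rewrite EcM //; exact: indep_Ec.
transitivity (Ex (fun x => g x ^+ 2 - (2 * (Ec j g x * g x) - Ec j g x ^+ 2))).
  by apply: eq_Ex => x; ring.
by rewrite !ExB ExZ e; ring.
Qed.

Lemma Ex_var_pairs j g :
  Ex (fun x => \sum_s \sum_s' p s * p s' * (g (upd x j s) - g (upd x j s')) ^+ 2)
  = 2 * Ex (fun x => (g x - Ec j g x) ^+ 2).
Proof.
rewrite Ex_var -(Ex_Ec p_sum1 j (fun x => g x ^+ 2)) -ExB -ExZ.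
apply: eq_Ex => x.
transitivity (\sum_s (p s * g (upd x j s) ^+ 2 +
    p s * (Ec j (fun y => g y ^+ 2) x) - 2 * (p s * g (upd x j s) * Ec j g x))).
  apply: eq_bigr => s _.
  rewrite -[p s * g (upd x j s) ^+ 2]mulr1 -{1}p_sum1 /Ec !mulr_sumr.
  by rewrite -big_split -sumrB /=; apply: eq_bigr => s' _; ring.
rewrite sumrB big_split /= -mulr_sumr -!mulr_suml p_sum1.
by rewrite /Ec; ring.
Qed.

(** Entropy is telescoped along the successive averages of [g ^ 2], and each
increment is the entropy of one coordinate. There, the Cauchy-Schwarz inequality
provides the hypothesis of [entropy_atom]. The outcome is a logarithmic Sobolev
inequality with a poor constant, which depends on [p0] only. *)
Lemma log_sobolev_aux l g : uniq l ->
  Ex (fun x => g x ^+ 2 * ln (g x ^+ 2)) -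
  Ex (fun x => Ecs l (fun y => g y ^+ 2) x * ln (Ecs l (fun y => g y ^+ 2) x)) <=
  4 / p0 * \sum_(j <- l) Ex (fun x => (g x - Ec j g x) ^+ 2).
Proof.
elim: l => [_|j l IH /= /andP[jl /IH{}IH]].
  by rewrite /= subrr big_nil mulr0.
rewrite big_cons mulrDr.
set G := Ecs l (fun y => g y ^+ 2) in IH *.
have step : Ex (fun x => G x * ln (G x)) - Ex (fun x => Ec j G x * ln (Ec j G x))
    <= 4 / p0 * Ex (fun x => (g x - Ec j g x) ^+ 2).
  rewrite -(Ex_Ec p_sum1 j (fun x => G x * ln (G x))) -ExB.
  pose D x s s' := Ecs l (fun y => (g (upd y j s) - g (upd y j s')) ^+ 2) x.
  apply: (@le_trans _ _ (Ex (fun x => 2 / p0 * \sum_s \sum_s' p s * p s' * D x s s'))).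
    apply: (ler_Ex p_ge0) => x; apply: (entropy_atom (G := fun s => G (upd x j s))).
    - by move=> s; apply: Ecs_ge0 => y; exact: sqr_ge0.
    - by move=> s s'; apply: Ecs_ge0 => y; exact: sqr_ge0.
    move=> s s'; rewrite /G !Ecs_upd // -EcsB.
    pose a y := g (upd y j s); pose b y := g (upd y j s').
    have -> : Ecs l (fun y => g (upd y j s) ^+ 2 - g (upd y j s') ^+ 2) x =
      Ecs l (fun y => (a y - b y) * (a y + b y)) x.
      by apply: eq_Ecs => y; rewrite /a /b; ring.
    apply: le_trans (Ecs_CauchySchwarz _ _ _ _) _.
    apply: ler_wpM2l; first by apply: Ecs_ge0 => y; exact: sqr_ge0.
    rewrite -EcsD -EcsZ; apply: (ler_Ecs p_ge0) => y; rewrite -/(a y) -/(b y).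
    by rewrite -subr_ge0 (_ : _ - _ = (a y - b y) ^+ 2) ?sqr_ge0 //; ring.
  rewrite ExZ le_eqVlt; apply/orP; left; apply/eqP.
  rewrite (_ : 4 / p0 = 2 / p0 * 2); last by ring.
  rewrite -[RHS]mulrA -Ex_var_pairs; congr (_ * _).
  rewrite !Ex_sum; apply: eq_bigr => s _; rewrite !Ex_sum; apply: eq_bigr => s' _.
  by rewrite !ExZ Ex_Ecs.
by move: IH step; lra.
Qed.

Lemma log_sobolev g :
  Ex (fun x => g x ^+ 2 * ln (g x ^+ 2)) -
  Ex (fun x => g x ^+ 2) * ln (Ex (fun x => g x ^+ 2)) <=
  4 / p0 * \sum_j Ex (fun x => (g x - Ec j g x) ^+ 2).
Proof.
have := log_sobolev_aux g (enum_uniq J); rewrite big_enum /=.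
rewrite [X in _ - X](_ : _ = Ex (fun x => g x ^+ 2) * ln (Ex (fun x => g x ^+ 2))) //.
rewrite -[RHS](Ex_cst p_sum1 (J := J)); apply: eq_Ex => x.
by rewrite Ecs_full.
Qed.

(** A function whose first moment is small compared with its second lives on a
small set, and has a large entropy. The constant [c] below, at which the tangent
to the logarithm is taken, is the value that such a function has on its set. *)
Lemma entropy_lower_bound g (lam : R) : 0 < lam ->
  Ex (fun x => g x ^+ 2) * ln lam - lam * Ex (fun x => `|g x|) ^+ 2 <=
  Ex (fun x => g x ^+ 2 * ln (g x ^+ 2)) -
  Ex (fun x => g x ^+ 2) * ln (Ex (fun x => g x ^+ 2)).
Proof.
move=> lam0; set v := Ex (fun x => g x ^+ 2); set a := Ex _.
have v_ge0 : 0 <= v by apply: (Ex_ge0 p_ge0) => x; exact: sqr_ge0.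
have a_ge0 : 0 <= a by apply: (Ex_ge0 p_ge0).
have la : 0 <= lam * a ^+ 2 by rewrite mulr_ge0 ?sqr_ge0 // ltW.
have mu0 x : v = 0 -> mu p x * g x ^+ 2 = 0.
  move=> /eqP; rewrite psumr_eq0 => [/allP/(_ x)|y _]; last first.
    by rewrite mulr_ge0 ?mu_ge0 ?sqr_ge0.
  by rewrite mem_index_enum => /(_ isT) /eqP.
have [v0|v0] := eqVneq v 0.
  rewrite v0 !mul0r sub0r subr0.
  rewrite [X in _ <= X](_ : _ = 0) ?oppr_le0 //.
  by apply: big1 => x _; rewrite mulrA mu0 // mul0r.
have v_gt0 : 0 < v by rewrite lt_neqAle eq_sym v0.
have a_gt0 : 0 < a.
  rewrite lt_neqAle a_ge0 andbT eq_sym; apply: contraNneq v0 => a0.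
  apply/eqP; apply: big1 => x _.
  move: a0 => /eqP; rewrite psumr_eq0 => [/allP/(_ x)|y _]; last first.
    by rewrite mulr_ge0 ?mu_ge0.
  rewrite mem_index_enum => /(_ isT) /eqP mg.
  by rewrite -[g x ^+ 2]real_normK ?num_real // expr2 mulrA mg mul0r.
pose c := v / a; have c_gt0 : 0 < c by rewrite divr_gt0.
have low : 2 * v * ln c <= Ex (fun x => g x ^+ 2 * ln (g x ^+ 2)).
  have -> : 2 * v * ln c =
      Ex (fun x => 2 * (g x ^+ 2 * ln c + (g x ^+ 2 - c * `|g x|))).
    rewrite ExZ ExD ExB ExZ -/a -/v (_ : Ex _ = v * ln c); last first.
      by rewrite [RHS]mulrC -ExZ; apply: eq_Ex => x; rewrite mulrC.
    by rewrite /c; field; rewrite gt_eqF.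
  apply: (ler_Ex p_ge0) => x.
  have [->|g0] := eqVneq (g x) 0.
    by rewrite expr0n /= normr0 !mul0r mulr0 subr0 addr0 mulr0.
  have u0 : 0 < `|g x| by rewrite normr_gt0.
  rewrite -[g x ^+ 2]real_normK ?num_real //; set u := `|g x| in u0 *.
  rewrite lnXn // mulr2n.
  have := ln_tangent c_gt0 u0 => /(ler_wpM2l (sqr_ge0 u)).
  rewrite (_ : u ^+ 2 * (ln u + (c / u - 1)) = u ^+ 2 * ln u + (c * u - u ^+ 2)); last by field; rewrite gt_eqF.
  by move=> h; lra.
have lav : 0 < lam * a ^+ 2 by rewrite mulr_gt0 // exprn_gt0.
have := ln_tangent lav v_gt0 => /(ler_wpM2l v_ge0).
rewrite lnM ?posrE ?exprn_gt0 // lnXn // mulr2n.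
rewrite (_ : v * (ln v + (lam * a ^+ 2 / v - 1)) = v * ln v + lam * a ^+ 2 - v); last by field; rewrite gt_eqF.
move: low; rewrite /c ln_div ?posrE // => low h; lra.
Qed.

Definition deviation i f x := f x - Ec i f x.

(** The inequality of Falik and Samorodnitsky. The variance is the sum of the
second moments of the martingale increments [V]; the logarithmic Sobolev
inequality is applied to each of them, and averaging does not increase the
deviations. *)
Lemma falik_samorodnitsky f (lam : R) : 0 < lam ->
  (Ex (fun x => f x ^+ 2) - Ex f ^+ 2) * ln lam <=
  4 / p0 * \sum_i Ex (fun x => deviation i f x ^+ 2) +
  lam * \sum_i Ex (fun x => `|deviation i f x|) ^+ 2.
Proof.
move=> lam0.
suff main l : (Ex (fun x => f x ^+ 2) - Ex (fun x => Ecs l f x ^+ 2)) * ln lam <=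
    4 / p0 * \sum_i (Ex (fun x => deviation i f x ^+ 2) -
                     Ex (fun x => Ecs l (deviation i f) x ^+ 2)) +
    lam * \sum_(i <- l) Ex (fun x => `|deviation i f x|) ^+ 2.
  have := main (enum J); rewrite big_enum /=.
  rewrite (_ : Ex (fun x => Ecs _ f x ^+ 2) = Ex f ^+ 2); last first.
    by rewrite -[RHS](Ex_cst p_sum1 (J := J)); apply: eq_Ex => x; rewrite Ecs_full.
  move=> h; apply: le_trans h _; rewrite lerD2r ler_wpM2l ?divr_ge0 ?(ltW p0_gt0) //.
  apply: ler_sum => i _; rewrite gerBl.
  by apply: (Ex_ge0 p_ge0) => x; exact: sqr_ge0.
elim: l => [|j l IH].
  rewrite /= subrr mul0r big_nil mulr0 addr0 big1 ?mulr0 // => i _.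
  by rewrite subrr.
rewrite /= big_cons.
pose V x := Ecs l f x - Ec j (Ecs l f) x.
have VE x : V x = Ecs l (deviation j f) x.
  by rewrite /V /deviation EcsB Ecs_EcC.
have := le_trans (entropy_lower_bound V lam0) (log_sobolev V).
have -> : Ex (fun x => V x ^+ 2) =
    Ex (fun x => Ecs l f x ^+ 2) - Ex (fun x => Ec j (Ecs l f) x ^+ 2).
  exact: Ex_var.
have -> : \sum_i Ex (fun x => (V x - Ec i V x) ^+ 2) =
    \sum_i (Ex (fun x => Ecs l (deviation i f) x ^+ 2) -
            Ex (fun x => Ec j (Ecs l (deviation i f)) x ^+ 2)).
  apply: eq_bigr => i _; rewrite -Ex_var; apply: eq_Ex => x; congr (_ ^+ 2).
  have e y : Ecs l (deviation i f) y = Ecs l f y - Ec i (Ecs l f) y.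
    by rewrite /deviation EcsB Ecs_EcC.
  rewrite e (eq_Ec p j e) EcB /V (EcB p i) (EcC p i j); ring.
have aV : Ex (fun x => `|V x|) <= Ex (fun x => `|deviation j f x|).
  rewrite -[leRHS](Ex_Ecs p_sum1 l); apply: (ler_Ex p_ge0) => x.
  by rewrite VE; exact: Ecs_abs.
have : Ex (fun x => `|V x|) ^+ 2 <= Ex (fun x => `|deviation j f x|) ^+ 2.
  by rewrite ler_sqr // nnegrE; apply: (Ex_ge0 p_ge0).
move=> /(ler_wpM2l (ltW lam0)).
move: IH; rewrite !sumrB; set A := \sum_i _; set B := \sum_i _.
set C := \sum_i _; set E := \sum_(i <- l) _.
move: (ln lam) (4 / p0) => u w; lra.
Qed.

End EntropyInequality.

(** * The cubic lattice and codes of paths *)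

Section Lattice.
Context {d : nat}.
Implicit Types (u v w y z : site d).

(** A coordinate and an orientation. Sequences of directions encode paths
independently of their starting points. *)
Definition dir : Type := ('I_d * bool)%type.
Implicit Types (a : dir) (c : seq dir).

Definition dvec a : site d := (if a.2 then 1 else -1) *: delta_mx 0 a.1.
Definition vend z c : site d := foldl (fun u a => u + dvec a) z c.
Definition trail z c : seq (site d) := scanl (fun u a => u + dvec a) z c.
Definition verts z c : seq (site d) := z :: trail z c.

Lemma vend_cat z c1 c2 : vend z (c1 ++ c2) = vend (vend z c1) c2.
Proof. exact: foldl_cat. Qed.

Lemma trail_cat z c1 c2 : trail z (c1 ++ c2) = trail z c1 ++ trail (vend z c1) c2.
Proof. exact: scanl_cat. Qed.

Lemma size_trail z c : size (trail z c) = size c.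
Proof. exact: size_scanl. Qed.

Lemma size_verts z c : size (verts z c) = (size c).+1.
Proof. by rewrite /= size_trail. Qed.

Lemma vendD z w c : vend (z + w) c = vend z c + w.
Proof. by elim: c z => //= a c IH z; rewrite -IH addrAC. Qed.

Lemma vendE z c : vend z c = z + vend 0 c.
Proof. by rewrite -{1}[z]add0r vendD addrC. Qed.

Lemma trailD z w c : trail (z + w) c = [seq u + w | u <- trail z c].
Proof. by elim: c z => //= a c IH z; rewrite -IH addrAC. Qed.

Lemma vertsD z w c : verts (z + w) c = [seq u + w | u <- verts z c].
Proof. by rewrite /verts /= trailD. Qed.

Lemma mem_vertsP z c y :
  y \in verts z c -> exists c1 c2, c = c1 ++ c2 /\ vend z c1 = y.
Proof.
elim: c z => [|a c IH] z; first by rewrite inE => /eqP ->; exists [::], [::].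
rewrite inE => /predU1P[->|/IH[c1 [c2 [-> <-]]]]; first by exists [::], (a :: c).
by exists (a :: c1), c2.
Qed.

Lemma l1normN v : l1norm (- v) = l1norm v.
Proof. by apply: eq_bigr => i _; rewrite mxE abszN. Qed.

Lemma l1normB v w : l1norm (v - w) = l1norm (w - v).
Proof. by rewrite -l1normN opprB. Qed.

Lemma l1norm0 : l1norm (0 : site d) = 0%N.
Proof. by apply: big1 => i _; rewrite mxE. Qed.

Lemma l1normD v w : (l1norm (v + w) <= l1norm v + l1norm w)%N.
Proof.
rewrite /l1norm -big_split /=; apply: leq_sum => i _; rewrite mxE; move: (v ord0 i) (w ord0 i) => a b; lia.
Qed.

Lemma l1norm_triangle u v w : (l1norm (v - w) <= l1norm (v - u) + l1norm (u - w))%N.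
Proof. by apply: leq_trans (l1normD _ _); rewrite addrA subrK. Qed.

Lemma leq_coord_l1norm v i : (`|v ord0 i| <= l1norm v)%N.
Proof. by rewrite /l1norm (bigD1 i) //= leq_addr. Qed.

Lemma l1norm_eq0 v : (l1norm v == 0%N) = (v == 0).
Proof.
apply/eqP/eqP => [v0|->]; last exact: l1norm0.
apply/rowP => i; rewrite mxE; apply/eqP; rewrite -absz_eq0.
by have := leq_coord_l1norm v i; rewrite v0 leqn0.
Qed.

Lemma dvecE a i : dvec a ord0 i =
  if i == a.1 then (if a.2 then 1 else -1) else 0.
Proof. by rewrite !mxE eqxx /=; case: eqP => _; rewrite ?mulr1 ?mulr0. Qed.

Lemma l1norm_dvec a : l1norm (dvec a) = 1%N.
Proof.
rewrite /l1norm (bigD1 a.1) //= big1 => [|i ia]; last by rewrite dvecE (negbTE ia).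
by rewrite dvecE eqxx; case: (a.2).
Qed.

Lemma l1norm_vend z c : (l1norm (vend z c - z) <= size c)%N.
Proof.
elim: c z => [|a c IH] z /=; first by rewrite subrr l1norm0.
apply: leq_trans (l1norm_triangle (z + dvec a) _ _) _.
by rewrite addrAC subrr add0r l1norm_dvec addn1 ltnS.
Qed.

Lemma unit_step v : v != 0 -> exists a, (l1norm (v - dvec a)).+1 = l1norm v.
Proof.
move=> v0; have [i vi] : exists i, v ord0 i != 0.
  apply/existsP; apply: contraNT v0; rewrite negb_exists => /forallP h.
  by apply/eqP/rowP => i; rewrite mxE; apply/eqP; have := h i; rewrite negbK.
exists (i, 0 < v ord0 i).
rewrite /l1norm (bigD1 i) //= [RHS](bigD1 i) //= -addSn; congr (_ + _)%N.
  rewrite mxE [in X in _ + X]mxE dvecE eqxx /=.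
  by move: (v ord0 i) vi => n n0; case: ltrP; lia.
by apply: eq_bigr => j ji; rewrite mxE [in X in _ + X]mxE dvecE (negbTE ji) subr0.
Qed.

Lemma straight_code z w : exists c, vend z c = w /\ size c = l1norm (w - z).
Proof.
move: {2}(l1norm (w - z)) (erefl (l1norm (w - z))) => n.
elim: n z => [|n IH] z wz.
  by exists [::]; split => //=; apply/esym/eqP; rewrite -subr_eq0 -l1norm_eq0 wz.
have [|a wa] := @unit_step (w - z); first by rewrite -l1norm_eq0 wz.
have /IH[c [cw sc]] : l1norm (w - (z + dvec a)) = n.
  by apply: succn_inj; rewrite -wz -wa opprD addrA.
exists (a :: c); split => //=; rewrite sc -wa; congr (_.+1).
by rewrite opprD addrA.
Qed.

Lemma lattice_ivt z c y R : (l1norm (z - y) <= R <= l1norm (vend z c - y))%N ->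
  exists c1 c2, c = c1 ++ c2 /\ l1norm (vend z c1 - y) = R.
Proof.
elim: c z => [|a c IH] z /=.
  by move=> h; exists [::], [::]; split => //; apply/eqP; rewrite eqn_leq.
case/andP; rewrite leq_eqVlt => /predU1P[zR _|zR Rc].
  by exists [::], (a :: c).
have [|c1 [c2 [-> h]]] := IH (z + dvec a); last by exists (a :: c1), c2.
rewrite Rc andbT; apply: leq_trans zR; rewrite addrAC.
by apply: leq_trans (l1normD _ _) _; rewrite l1norm_dvec addn1.
Qed.

Definition box z r : seq (site d) :=
  [seq z + \row_i ((f i : nat)%:Z - r%:Z) | f : {ffun 'I_d -> 'I_(2 * r).+1}].

Lemma size_box z r : size (box z r) = ((2 * r).+1 ^ d)%N.
Proof. by rewrite size_map -cardE card_ffun !card_ord. Qed.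

Lemma mem_box z r y : (l1norm (y - z) <= r)%N -> y \in box z r.
Proof.
move=> yr; have h i : (`|((y - z) ord0 i + r%:Z)%R| < (2 * r).+1)%N.
  by have := leq_trans (leq_coord_l1norm (y - z) i) yr; move: ((y - z) _ _) => n; lia.
apply/mapP; exists [ffun i => Ordinal (h i)]; first by rewrite mem_enum.
rewrite -[LHS](subrKC z); congr (_ + _).
apply/rowP => i; rewrite [RHS]mxE ffunE /=.
by have := leq_trans (leq_coord_l1norm (y - z) i) yr; move: ((y - z) _ _) => n; lia.
Qed.

Lemma box_uniq z r : uniq (box z r).
Proof.
rewrite map_inj_uniq ?enum_uniq // => f g /addrI /rowP fg.
by apply/ffunP => i; apply/val_inj; have := fg i; rewrite !mxE /=; lia.
Qed.

Lemma size_in_ball (s : seq (site d)) z r : uniq s ->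
  (forall y, y \in s -> (l1norm (y - z) <= r)%N) -> (size s <= (2 * r).+1 ^ d)%N.
Proof.
move=> us hs; rewrite -(size_box z); apply: uniq_leq_size => // y /hs.
exact: mem_box.
Qed.

Definition cube m : seq (site d) :=
  [seq \row_i (f i : nat)%:Z | f : {ffun 'I_d -> 'I_m}].

Lemma size_cube m : size (cube m) = (m ^ d)%N.
Proof. by rewrite size_map -cardE card_ffun !card_ord. Qed.

Lemma cube_uniq m : uniq (cube m).
Proof.
rewrite map_inj_uniq ?enum_uniq // => f g /rowP fg.
by apply/ffunP => i; apply/val_inj; have := fg i; rewrite !mxE /=; lia.
Qed.

Lemma cube_l1norm m z : z \in cube m -> (l1norm z <= d * m)%N.
Proof.
move=> /mapP[f _ ->]; rewrite /l1norm.
apply: leq_trans (_ : \sum_(i < d) m <= _)%N; last by rewrite sum_nat_const card_ord.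
by apply: leq_sum => i _; rewrite mxE; have := ltn_ord (f i); move: (nat_of_ord (f i)) => n; lia.
Qed.

Lemma cube_diff m z z' : z \in cube m -> z' \in cube m -> (l1norm (z - z') <= d * m)%N.
Proof.
move=> /mapP[f _ ->] /mapP[g _ ->]; rewrite /l1norm.
apply: leq_trans (_ : \sum_(i < d) m <= _)%N; last by rewrite sum_nat_const card_ord.
apply: leq_sum => i _; rewrite !mxE; have := ltn_ord (f i); have := ltn_ord (g i);
by move: (nat_of_ord (f i)) (nat_of_ord (g i)) => n n'; lia.
Qed.

End Lattice.
Arguments dir : clear implicits.

(** * Selecting an optimal path *)

(** What the two versions of the model have in common. A path that starts at [z]
collects the passage times of [ini z], and its step in the direction [a] from a
vertex [z] collects that of [key z a]. Geometry is expressed through vertices: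
[near y] lists the indices that can be collected on arriving at [y]. The constant
in [near_dist] is there for edges, whose end points are at distance at most 1
from the vertex that they are near. *)
Record keying (R : realType) (d : nat) (K : eqType) (dist : K -> K -> R)
    (shift : site d -> K -> K) := Keying {
  ini : site d -> seq K;
  key : site d -> dir d -> K;
  near : site d -> seq K;
  size_ini : forall z, (size (ini z) <= 1)%N;
  ini_near : forall z, {subset ini z <= near z};
  key_near : forall z a, key z a \in near (z + dvec a);
  size_near : forall z, (size (near z) <= 2 * d + 1)%N;
  near_dist : forall y y' k k', k \in near y -> k' \in near y' ->
    (l1norm (y - y'))%:R <= dist k k' + 2;
  shift_ini : forall z w, ini (z + w) = map (shift w) (ini z);
  shift_key : forall z w a, key (z + w) a = shift w (key z a) }.

Section Geodesics.
Context {R : realType} {d : nat} {K : eqType} {dist : K -> K -> R}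
  {shift : site d -> K -> K} (G : keying dist shift).
Implicit Types (tau : K -> R) (z v w y : site d) (c : seq (dir d)) (L : nat).

Fixpoint stime tau z c : R :=
  if c is a :: c' then tau (key G z a) + stime tau (z + dvec a) c' else 0.

Definition time tau z c : R := \sum_(k <- ini G z) tau k + stime tau z c.

Lemma stime_cat tau z c1 c2 :
  stime tau z (c1 ++ c2) = stime tau z c1 + stime tau (vend z c1) c2.
Proof.
by elim: c1 z => [|a c1 IH] z /=; rewrite ?add0r // IH addrA.
Qed.

Lemma stime_shift tau w z c :
  stime (tau \o shift w) z c = stime tau (z + w) c.
Proof.
elim: c z => //= a c IH z; by rewrite IH shift_key addrAC.
Qed.

Lemma time_shift tau w z c : time (tau \o shift w) z c = time tau (z + w) c.
Proof. by rewrite /time stime_shift shift_ini big_map. Qed.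

Lemma stime_ge0 tau z c : (forall k, 0 <= tau k) -> 0 <= stime tau z c.
Proof. by move=> t0; elim: c z => //= a c IH z; rewrite addr_ge0. Qed.

Lemma time_ge0 tau z c : (forall k, 0 <= tau k) -> 0 <= time tau z c.
Proof. by move=> t0; rewrite addr_ge0 ?stime_ge0 ?sumr_ge0. Qed.

Lemma stime_le tau b z c : (forall k, tau k <= b) ->
  stime tau z c <= b * (size c)%:R.
Proof.
move=> tb; elim: c z => [|a c IH] z /=; first by rewrite mulr0.
by rewrite -natr1 mulrDr mulr1 addrC lerD.
Qed.

Lemma sum_ini_le tau b z : 0 <= b -> (forall k, tau k <= b) ->
  \sum_(k <- ini G z) tau k <= b.
Proof.
move=> b0 tb; case: (ini G z) (size_ini G z) => [|k [|]] // _.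
  by rewrite big_nil.
by rewrite big_seq1.
Qed.

Lemma time_le tau b z c : 0 <= b -> (forall k, tau k <= b) ->
  time tau z c <= b * (size c).+1%:R.
Proof.
move=> b0 tb; rewrite -natr1 mulrDr mulr1 addrC lerD ?stime_le //.
exact: sum_ini_le.
Qed.

Lemma stime_perturb tau tau' b (bad : pred (site d)) z c : 0 <= b ->
  (forall k, 0 <= tau k) -> (forall k, tau' k <= b) ->
  (forall y k, y \in trail z c -> k \in near G y -> ~~ bad y -> tau' k = tau k) ->
  stime tau' z c <= stime tau z c + b * (count bad (trail z c))%:R.
Proof.
move=> b0 t0 tb; elim: c z => [|a c IH] z /= h; first by rewrite mulr0 addr0.
rewrite natrD mulrDr addrACA; apply: lerD; last first.
  by apply: IH => y k yc; apply: h; rewrite inE yc orbT.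
have [bz|bz] := boolP (bad (z + dvec a)).
  by rewrite mulr1 (le_trans (tb _)) // lerDr.
by rewrite mulr0 addr0 (h (z + dvec a)) // ?key_near ?mem_head.
Qed.

(** A path collects at most one passage time at each of its vertices. *)
Lemma time_perturb tau tau' b (bad : pred (site d)) z c : 0 <= b ->
  (forall k, 0 <= tau k) -> (forall k, tau' k <= b) ->
  (forall y k, y \in verts z c -> k \in near G y -> ~~ bad y -> tau' k = tau k) ->
  time tau' z c <= time tau z c + b * (count bad (verts z c))%:R.
Proof.
move=> b0 t0 tb h; rewrite /time /= natrD mulrDr addrACA; apply: lerD; last first.
  by apply: stime_perturb => // y k yc; apply: h; rewrite inE yc orbT.
have [bz|bz] := boolP (bad z).
  by rewrite mulr1 (le_trans (sum_ini_le _ b0 tb)) // lerDr sumr_ge0.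
rewrite mulr0 addr0 le_eqVlt; apply/orP; left; apply/eqP.
by apply: eq_big_seq => k kz; apply: h bz; rewrite ?mem_head ?ini_near.
Qed.

Lemma eq_time tau tau' z c :
  (forall y k, y \in verts z c -> k \in near G y -> tau' k = tau k) ->
  time tau' z c = time tau z c.
Proof.
move=> h; congr (_ + _).
  by apply: eq_big_seq => k kz; apply: (h z); rewrite ?mem_head ?ini_near.
have {h} : forall y k, y \in trail z c -> k \in near G y -> tau' k = tau k.
  by move=> y k yc; apply: h; rewrite inE yc orbT.
elim: c z => //= a c IH z h; congr (_ + _).
  by apply: (h (z + dvec a)); rewrite ?mem_head ?key_near.
by apply: IH => y k yc; apply: h; rewrite inE yc orbT.
Qed.

Definition codes L : seq (seq (dir d)) :=
  flatten [seq [seq tval t | t : r.-tuple (dir d)] | r <- iota 0 L.+1].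

Lemma mem_codes L c : (c \in codes L) = (size c <= L)%N.
Proof.
apply/flatten_mapP/idP => [[r]|cL].
  by rewrite mem_iota => /andP[_ rL] /mapP[t _ ->]; rewrite size_tuple.
exists (size c); first by rewrite mem_iota.
by apply/mapP; exists (in_tuple c); rewrite ?mem_enum.
Qed.

Definition cand L v := [seq c <- codes L | vend 0 c == v].

Lemma mem_cand L v c : (c \in cand L v) = (vend 0 c == v) && (size c <= L)%N.
Proof. by rewrite mem_filter mem_codes. Qed.

Lemma cand_vend L v z c : c \in cand L v -> vend z c = z + v.
Proof. by rewrite mem_cand => /andP[/eqP <- _]; rewrite -vendE. Qed.

(** Ties are broken by the number of steps: the selected path has to be short
wherever some optimal path is. *)
Definition better tau z c c' :=
  (time tau z c < time tau z c') ||
  (time tau z c == time tau z c') && (size c <= size c')%N.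

Definition best tau L z v c := all (better tau z c) (cand L v).

Definition geo tau L z v := nth [::] (cand L v) (find (best tau L z v) (cand L v)).

Definition ltime tau L z v := time tau z (geo tau L z v).

Lemma better_total tau z c c' : better tau z c c' || better tau z c' c.
Proof. by rewrite /better; case: (ltgtP (time tau z c)) => //= _; exact: leq_total. Qed.

Lemma better_trans tau z : transitive (better tau z).
Proof.
move=> c2 c1 c3; rewrite /better.
case: (ltgtP (time tau z c1) (time tau z c2)) => //= [h12 _|->].
  case/orP => [h23|/andP[/eqP <- _]]; last by rewrite h12.
  by rewrite (lt_trans h12 h23).
by move=> h; case/orP => [->//|/andP[-> h']]; rewrite (leq_trans h h') orbT.
Qed.

Lemma exists_best (T : eqType) (r : rel T) (s : seq T) :
  (forall x x' : T, r x x' || r x' x) -> transitive r -> s != [::] ->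
  has (fun x => all (r x) s) s.
Proof.
move=> rt rtr; have rr x : r x x by have := rt x x; rewrite orbb.
elim: s => // x s IH _; have [->|/IH/hasP[x2 x2s /allP yb]] := eqVneq s [::].
  by rewrite /= rr.
have [xy|yx] := orP (rt x x2); apply/hasP.
  exists x; first exact: mem_head.
  by rewrite /= rr; apply/allP => u /yb; exact: rtr.
exists x2; first by rewrite inE x2s orbT.
by rewrite /= yx; apply/allP.
Qed.

Lemma geo_best tau L z v : (l1norm v <= L)%N ->
  geo tau L z v \in cand L v /\ best tau L z v (geo tau L z v).
Proof.
move=> vL; have [c [cv cs]] := straight_code 0 v.
have cc : c \in cand L v by rewrite mem_cand cv eqxx cs subr0.
have hb : has (best tau L z v) (cand L v).
  apply: exists_best.
  - exact: better_total.
  - exact: better_trans.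
  - by apply: contraTneq cc => ->.
by split; [rewrite mem_nth // -has_find|exact: nth_find].
Qed.

Lemma ltime_le tau L z v c : c \in cand L v -> ltime tau L z v <= time tau z c.
Proof.
move=> cc; rewrite /ltime /geo.
have hb : has (best tau L z v) (cand L v).
  apply: exists_best; [exact: better_total|exact: better_trans|].
  by apply: contraTneq cc => ->.
have /allP/(_ _ cc)/orP[/ltW//|/andP[/eqP -> //]] := nth_find [::] hb.
Qed.

Lemma size_geo tau L z v : (l1norm v <= L)%N -> (size (geo tau L z v) <= L)%N.
Proof. by move=> /(geo_best tau z)[]; rewrite mem_cand => /andP[]. Qed.

Lemma vend_geo tau L z v w : (l1norm v <= L)%N -> vend w (geo tau L z v) = w + v.
Proof. by move=> /(geo_best tau z)[/cand_vend ->]. Qed.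

Lemma geo_shift tau L w z v : geo (tau \o shift w) L z v = geo tau L (z + w) v.
Proof.
rewrite /geo; congr nth; apply: eq_find => c; apply: eq_all => c'.
by rewrite /better !time_shift.
Qed.

Lemma eq_geo tau tau' L z v :
  (forall y k, (l1norm (y - z) <= L)%N -> k \in near G y -> tau' k = tau k) ->
  geo tau' L z v = geo tau L z v.
Proof.
move=> h; have e c : c \in cand L v -> time tau' z c = time tau z c.
  rewrite mem_cand => /andP[_ cL]; apply: eq_time => y k /mem_vertsP[c1 [c2 [cE <-]]].
  apply: h; apply: leq_trans (l1norm_vend _ _) _.
  by apply: leq_trans cL; rewrite cE size_cat leq_addr.
rewrite /geo; congr nth; apply: eq_in_find => c cc; apply: eq_in_all => c' cc'.
by rewrite /better !e.
Qed.

Lemma eq_ltime tau tau' L z v : (l1norm v <= L)%N ->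
  (forall y k, (l1norm (y - z) <= L)%N -> k \in near G y -> tau' k = tau k) ->
  ltime tau' L z v = ltime tau L z v.
Proof.
move=> vL h; rewrite /ltime (eq_geo v h); apply: eq_time => y k /mem_vertsP[c1 [c2 [cE <-]]].
apply: h; apply: leq_trans (l1norm_vend _ _) _.
by apply: leq_trans (size_geo tau z vL); rewrite cE size_cat leq_addr.
Qed.

(** Otherwise the segment could be replaced, giving a path that is as fast and has
fewer steps. *)
Lemma geo_segment tau L z v c1 c2 c3 c2' : (l1norm v <= L)%N ->
  geo tau L z v = c1 ++ c2 ++ c3 ->
  vend (vend z c1) c2' = vend (vend z c1) c2 ->
  stime tau (vend z c1) c2' <= stime tau (vend z c1) c2 ->
  (size c2 <= size c2')%N.
Proof.
move=> vL gE e2 t2; rewrite leqNgt; apply/negP => s2.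
have [] := geo_best tau z vL; rewrite gE mem_cand => /andP[/eqP gv gL] gb.
have cc : c1 ++ c2' ++ c3 \in cand L v.
  rewrite mem_cand; apply/andP; split; last first.
    by apply: leq_trans gL; rewrite !size_cat leq_add2l leq_add2r ltnW.
  rewrite -gv; apply/eqP/(addrI z); rewrite -!vendE !vend_cat.
  by congr vend.
have tt : time tau z (c1 ++ c2' ++ c3) <= time tau z (c1 ++ c2 ++ c3).
  by rewrite /time !stime_cat e2 lerD2l lerD2l lerD2r.
have /allP/(_ _ cc)/orP[|/andP[_]] := gb; first by rewrite ltNge tt.
by rewrite !size_cat leq_add2l leq_add2r leqNgt s2.
Qed.

Lemma not_uniq_loop z c : ~~ uniq (verts z c) ->
  exists c1 c2 c3, [/\ c = c1 ++ c2 ++ c3, c2 != [::] &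
    vend (vend z c1) c2 = vend z c1].
Proof.
elim: c z => // a c IH z; rewrite [verts _ _]/= [uniq _]/= negb_and negbK.
case/orP => [/mem_vertsP[c1 [c2 [-> h]]]|/IH[c1 [c2 [c3 [-> c2n h]]]]].
  by exists [::], (a :: c1), c2.
by exists (a :: c1), c2, c3.
Qed.

(** An excursion from a vertex back to itself could be cut out. *)
Lemma geo_uniq tau L z v w : (l1norm v <= L)%N -> (forall k, 0 <= tau k) ->
  uniq (verts w (geo tau L z v)).
Proof.
move=> vL t0.
have {w} -> : uniq (verts w (geo tau L z v)) = uniq (verts z (geo tau L z v)).
  have e u : verts u (geo tau L z v) = map (+%R u) (verts 0 (geo tau L z v)).
    by rewrite -{1}[u]add0r vertsD; apply: eq_map => y; rewrite addrC.
  by rewrite (e w) (e z) !map_inj_uniq //; exact: addrI.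
apply/negPn/negP => /not_uniq_loop[c1 [c2 [c3 [gE c2n e]]]].
have := geo_segment (c2' := [::]) vL gE (esym e) (stime_ge0 _ _ t0).
by rewrite leqn0 size_eq0 (negbTE c2n).
Qed.

Lemma geo_trail_near tau L z v y : (l1norm v <= L)%N ->
  y \in verts z (geo tau L z v) -> (l1norm (y - z) <= L)%N.
Proof.
move=> vL /mem_vertsP[c1 [c2 [gE <-]]]; apply: leq_trans (l1norm_vend _ _) _.
by apply: leq_trans (size_geo tau z vL); rewrite gE size_cat leq_addr.
Qed.

End Geodesics.

(** * Skeletons of paths and resampling *)

Section Skeleton.
Context {d : nat}.
Implicit Types (z y u o : site d) (c : seq (dir d)).

Definition offset r (f : {ffun 'I_d -> 'I_(2 * r).+1}) : site d :=
  \row_i ((f i : nat)%:Z - r%:Z).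

Fixpoint skeleton z (os : seq (site d)) : seq (site d) :=
  z :: if os is o :: os' then skeleton (z + o) os' else [::].

Lemma size_skeleton z os : size (skeleton z os) = (size os).+1.
Proof. by elim: os z => //= o os IH z; rewrite IH. Qed.

Lemma offset_mem r o : (l1norm o <= r)%N -> exists f, o = @offset r f.
Proof.
move=> or; have : o \in box 0 r by apply: mem_box; rewrite subr0.
by move=> /mapP[f _]; rewrite add0r => ->; exists f.
Qed.

(** There are far fewer skeletons than paths: one offset in a box for each block
of [l] steps. *)
Lemma skeleton_cover l m z c : (size c <= m * l)%N ->
  exists s : m.-tuple {ffun 'I_d -> 'I_(2 * l).+1}, forall y, y \in verts z c ->
    exists2 u, u \in skeleton z (map (@offset l) s) & (l1norm (y - u) <= l)%N.
Proof.
elim: m z c => [|m IH] z c.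
  rewrite mul0n leqn0 size_eq0 => /eqP ->; exists [tuple] => y.
  by rewrite inE => /eqP ->; exists z; rewrite ?inE //= subrr l1norm0.
move=> cs; have cE := cat_take_drop l c.
have st : (size (take l c) <= l)%N by rewrite size_take_min geq_minl.
have [f fE] := offset_mem (leq_trans (l1norm_vend z (take l c)) st).
have [|s hs] := IH (vend z (take l c)) (drop l c).
  by rewrite size_drop leq_subLR -mulSn.
exists [tuple of f :: s] => y.
rewrite -cE /verts trail_cat inE mem_cat.
have e : z + offset f = vend z (take l c) by rewrite -fE subrKC.
case/predU1P => [->|/orP[yt|yd]].
- by exists z; rewrite ?mem_head // subrr l1norm0.
- exists z; rewrite ?mem_head //.
  have /mem_vertsP[c1 [c2 [tE <-]]] : y \in verts z (take l c) by rewrite inE yt orbT.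
  apply: leq_trans (l1norm_vend _ _) _; apply: leq_trans st.
  by rewrite tE size_cat leq_addr.
have [|u us yu] := hs y; first by rewrite inE yd orbT.
by exists u; rewrite //= e inE us orbT.
Qed.

Variable M : nat.

Definition residue y : {ffun 'I_d -> 'I_M.+1} :=
  [ffun i => inord `|(y ord0 i %% (M.+1)%:Z)%Z|%N].

Lemma residue_inj_near y y' : residue y = residue y' -> y != y' ->
  (M < l1norm (y - y'))%N.
Proof.
move=> /ffunP e yy'.
have [i yi] : exists i, y ord0 i != y' ord0 i.
  apply/existsP; apply: contraNT yy'; rewrite negb_exists => /forallP h.
  by apply/eqP/rowP => i; apply/eqP; have := h i; rewrite negbK.
apply: leq_trans (leq_coord_l1norm (y - y') i).
have := congr1 val (e i); rewrite !ffunE /= !mxE.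
move: (y ord0 i) (y' ord0 i) yi => a b ab.
have M0 : (M.+1%:Z != 0)%R by [].
have b1 := modz_ge0 a M0; have b2 := modz_ge0 b M0.
have c1 : (a %% M.+1%:Z < M.+1%:Z)%Z by rewrite ltz_pmod.
have c2 : (b %% M.+1%:Z < M.+1%:Z)%Z by rewrite ltz_pmod.
rewrite !inordK; [|by lia|by lia] => h.
have := divz_eq a M.+1%:Z; have := divz_eq b M.+1%:Z.
have hh : (a %% M.+1%:Z)%Z = (b %% M.+1%:Z)%Z by lia.
rewrite hh; set q1 := (a %/ _)%Z; set q2 := (b %/ _)%Z; set r := (b %% _)%Z.
clearbody q1 q2 r; clear -ab => h1 h2.
have q12 : q1 != q2 by apply: contraNneq ab => q12; rewrite h1 h2 q12.
have -> : a - b = (q1 - q2) * M.+1%:Z by rewrite h1 h2; ring.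
rewrite abszM /=; have : (0 < `|(q1 - q2)%R|)%N by lia.
by move=> q0; rewrite -[X in (X <= _)%N]mul1n leq_mul.
Qed.

End Skeleton.

Section Averages.
Context {R : realType}.

Lemma sqr_average (p : Type) (r : seq p) (w a : p -> R) :
  (forall s, 0 <= w s) -> \sum_(s <- r) w s = 1 ->
  (\sum_(s <- r) w s * a s) ^+ 2 <= \sum_(s <- r) w s * a s ^+ 2.
Proof.
move=> w0 w1; set m := \sum_(s <- r) w s * a s.
have : 0 <= \sum_(s <- r) w s * (a s - m) ^+ 2.
  by apply: sumr_ge0 => s _; rewrite mulr_ge0 ?sqr_ge0.
have -> : \sum_(s <- r) w s * (a s - m) ^+ 2 =
    \sum_(s <- r) w s * a s ^+ 2 - m ^+ 2; last by rewrite subr_ge0.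
rewrite (eq_bigr (fun s => w s * a s ^+ 2 + w s * m ^+ 2 - 2 * m * (w s * a s))).
  by rewrite sumrB big_split /= -mulr_suml -mulr_sumr w1 -/m; ring.
by move=> s _; ring.
Qed.

Lemma expR_bool_le (x : bool) : expR x%:R <= 1 + 3 * x%:R :> R.
Proof.
case: x; last by rewrite /= expR0 mulr0 addr0.
have e4 : 4^-1 <= expR (-1) :> R.
  have -> : -1 = - (2^-1) + - (2^-1) :> R by field.
  rewrite expRD (_ : 4^-1 = 2^-1 * 2^-1); last by field.
  have h : 2^-1 <= expR (- 2^-1) :> R.
    by apply: le_trans (expR_ge1Dx _); lra.
  by rewrite ler_pM.
have := ler_wpM2l (expR_ge0 1) e4; rewrite -expRD subrr expR0 /=; lra.
Qed.

Context {J S : finType} (p : S -> R).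
Hypothesis p_ge0 : forall s, 0 <= p s.
Hypothesis p_sum1 : \sum_s p s = 1.
Local Notation Om := {ffun J -> S}.
Local Notation Ex := (@Ex R J S p).

(** As resampling is reversible, a bound on how much it increases [f] controls
both directions. *)
Lemma deviation_le (i : J) (f N : Om -> R) :
  (forall x, 0 <= N x) -> (forall x s, f (upd x i s) - f x <= N x) ->
  Ex (fun x => deviation p i f x ^+ 2) <= 2 * Ex (fun x => N x ^+ 2) /\
  Ex (fun x => `|deviation p i f x|) <= 2 * Ex N.
Proof.
move=> N0 fN.
have devE x : deviation p i f x = \sum_s p s * (f x - f (upd x i s)).
  rewrite /deviation -[in LHS](mul1r (f x)) -p_sum1 mulr_suml -sumrB.
  by apply: eq_bigr => s _; rewrite mulrBr.
pose h1 (x y : Om) : R := Num.max 0 (f y - f x).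
have h1_ge0 x y : 0 <= h1 x y by rewrite /h1 le_max lexx.
have h1N x s : h1 x (upd x i s) <= N x by rewrite /h1 ge_max N0 fN.
have habs x y : `|f x - f y| <= h1 x y + h1 y x.
  by rewrite /h1 ler_norml; case: (lerP 0 (f y - f x)); case: (lerP 0 (f x - f y)); lra.
have hsq x y : (f x - f y) ^+ 2 <= h1 x y ^+ 2 + h1 y x ^+ 2.
  rewrite /h1; have [xy|xy] := lerP 0 (f y - f x).
    by rewrite -[leLHS]sqrrN opprB lerDl sqr_ge0.
  by rewrite max_r ?expr0n ?add0r //; lra.
split.
  apply: (@le_trans _ _ (Ex (fun x => \sum_s p s * h1 x (upd x i s) ^+ 2) +
      Ex (fun x => \sum_s p s * h1 (upd x i s) x ^+ 2))).
    rewrite -ExD; apply: (ler_Ex p_ge0) => x.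
    rewrite devE -big_split /=; apply: le_trans (sqr_average _ p_ge0 p_sum1) _.
    apply: ler_sum => s _; rewrite -mulrDr.
    by apply: ler_wpM2l.
  rewrite -(Ex_exchange p i (fun x y => h1 x y ^+ 2)) -mulr2n -[leLHS]mulr_natl ler_wpM2l //.
  apply: (ler_Ex p_ge0) => x; rewrite -[leRHS]mul1r -p_sum1 mulr_suml.
  by apply: ler_sum => s _; rewrite ler_wpM2l // ler_sqr ?nnegrE.
apply: (@le_trans _ _ (Ex (fun x => \sum_s p s * h1 x (upd x i s)) +
    Ex (fun x => \sum_s p s * h1 (upd x i s) x))).
  rewrite -ExD; apply: (ler_Ex p_ge0) => x.
  rewrite devE -big_split /=; apply: le_trans (ler_norm_sum _ _ _) _.
  by apply: ler_sum => s _; rewrite -mulrDr normrM (ger0_norm (p_ge0 s)) ler_wpM2l.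
rewrite -(Ex_exchange p i h1) -mulr2n -[leLHS]mulr_natl ler_wpM2l //.
apply: (ler_Ex p_ge0) => x; rewrite -[leRHS]mul1r -p_sum1 mulr_suml.
by apply: ler_sum => s _; rewrite ler_wpM2l.
Qed.

End Averages.

(** * Rare vertices on a path *)

Lemma count_uniq_sub (T : eqType) (P : pred T) (s t : seq T) : uniq s ->
  (forall y, y \in s -> P y -> y \in t) -> (count P s <= count P t)%N.
Proof.
move=> us st; rewrite -!size_filter; apply: uniq_leq_size; first exact: filter_uniq.
by move=> y; rewrite !mem_filter => /andP[Py ys]; rewrite Py st.
Qed.

Lemma size_flatten_box (d : nat) (us : seq (site d)) l :
  size (flatten [seq box u l | u <- us]) = (size us * (2 * l).+1 ^ d)%N.
Proof. by elim: us => //= u us IH; rewrite size_cat IH size_box mulSn. Qed.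

Lemma prod_le_exp (R : realType) (T : eqType) (r : seq T) (F : T -> R) (c : R) :
  (forall y, y \in r -> 0 <= F y <= c) -> \prod_(y <- r) F y <= c ^+ size r.
Proof.
elim: r => [|y r IH] h; first by rewrite big_nil.
have /andP[Fy0 Fyc] := h y (mem_head _ _).
rewrite big_cons /= exprS ler_pM //.
  rewrite big_seq prodr_ge0 // => u ur.
  have uyr : u \in y :: r by rewrite inE ur orbT.
  by case/andP: (h u uyr).
by apply: IH => u ur; apply: h; rewrite inE ur orbT.
Qed.

Lemma expR_sum_seq (R : realType) (T : Type) (r : seq T) (F : T -> R) :
  expR (\sum_(y <- r) F y) = \prod_(y <- r) expR (F y).
Proof.
by elim: r => [|y r IH]; rewrite ?big_nil ?expR0 // !big_cons expRD IH.
Qed.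

Section Greedy.
Context {R : realType} {d : nat} {J S : finType} (p : S -> R).
Hypothesis p_ge0 : forall s, 0 <= p s.
Hypothesis p_sum1 : \sum_s p s = 1.
Local Notation Om := {ffun J -> S}.
Local Notation Ex := (@Ex R J S p).
Context (a0 : nat) (W : nat -> site d -> {set J}) (Kx : Om -> site d -> nat).
Context (B : pred (site d)) (q : nat -> R).
Hypothesis W_disj : forall k y y' j,
  (a0 * k + 2 < l1norm (y - y'))%N -> j \in W k y -> j \notin W k y'.
Hypothesis K_dep : forall k y j x s,
  j \notin W k y -> (k < Kx (upd x j s) y)%N = (k < Kx x y)%N.
Hypothesis q_ge0 : forall k, 0 <= q k.
Hypothesis K_tail : forall k y, B y ->
  Ex (fun x => (k < Kx x y)%N%:R) <= q k.
Context (z : site d) (L : nat) (pi : Om -> seq (dir d)).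
Hypothesis pi_uniq : forall x, uniq (verts z (pi x)).
Hypothesis pi_size : forall x, (size (pi x) <= L)%N.
Hypothesis B_ball : forall y, (l1norm (y - z) <= L)%N -> B y.

Lemma mem_verts_pi x y : y \in verts z (pi x) -> (l1norm (y - z) <= L)%N.
Proof.
move=> /mem_vertsP[c1 [c2 [cE <-]]]; apply: leq_trans (l1norm_vend _ _) _.
by apply: leq_trans (pi_size x); rewrite cE size_cat leq_addr.
Qed.

Lemma Ex_count (k : nat) (r : seq (site d)) :
  Ex (fun x => (count (fun y => k < Kx x y)%N r)%:R) =
  \sum_(y <- r) Ex (fun x => (k < Kx x y)%N%:R).
Proof.
rewrite -Ex_sum; apply: eq_Ex => x; rewrite -sum1_count big_mkcond natr_sum /=.
by apply: eq_bigr => y _; case: (k < Kx x y)%N.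
Qed.

Lemma greedy_crude k :
  Ex (fun x => (count (fun y => k < Kx x y)%N (verts z (pi x)))%:R) <=
  (2 * L).+1%:R ^+ d * q k.
Proof.
pose r := [seq y <- box z L | B y].
apply: (@le_trans _ _ (Ex (fun x => (count (fun y => k < Kx x y)%N r)%:R))).
  apply: (ler_Ex p_ge0) => x; rewrite ler_nat; apply: count_uniq_sub => // y yc _.
  by rewrite mem_filter (B_ball (mem_verts_pi yc)) mem_box // (mem_verts_pi yc).
rewrite Ex_count; apply: (@le_trans _ _ (\sum_(y <- r) q k)).
  rewrite !big_seq; apply: ler_sum => y; rewrite mem_filter => /andP[By _].
  exact: K_tail.
rewrite big_const_seq count_predT iter_addr_0 -[leLHS]mulr_natl ler_wpM2r //.
by rewrite -natrX ler_nat -(size_box z L) size_filter count_size.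
Qed.

(** Whatever the choice of the path, its vertices lie near a skeleton, and
skeletons are few enough for a union bound. In one residue class modulo the range
of dependence, the events that vertices have a large radius are independent, so
that their number near a fixed skeleton has an exponential moment. *)
Lemma greedy_level k l m : (L <= m * l)%N ->
  Ex (fun x => (count (fun y => k < Kx x y)%N (verts z (pi x)))%:R) <=
  (a0 * k + 3)%:R ^+ d * (m%:R * (d%:R * ln (2 * l).+1%:R) +
     3 * q k * (m.+1%:R * (2 * l).+1%:R ^+ d) + 1).
Proof.
move=> Lml; pose M := (a0 * k + 2)%N.
pose A (s : m.-tuple {ffun 'I_d -> 'I_(2 * l).+1}) := undup
  [seq y <- flatten [seq box u l | u <- skeleton z (map (@offset d l) s)] | B y].
have sA s : (size (A s))%:R <= m.+1%:R * (2 * l).+1%:R ^+ d :> R.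
  rewrite -natrX -natrM ler_nat; apply: leq_trans (size_undup _) _.
  rewrite size_filter; apply: leq_trans (count_size _ _) _.
  by rewrite size_flatten_box size_skeleton size_map size_tuple.
pose xi x y := (k < Kx x y)%N.
pose Nc c x := count (fun y => xi x y && (residue M y == c)) (verts z (pi x)).
pose At c s := [seq y <- A s | residue M y == c].
pose Nt c s x := \sum_(y <- At c s) (xi x y)%:R : R.
pose a := m%:R * (d%:R * ln (2 * l).+1%:R) +
     3 * q k * (m.+1%:R * (2 * l).+1%:R ^+ d) : R.
have NcE x : (count (xi x) (verts z (pi x)))%:R =
    \sum_(c : {ffun 'I_d -> 'I_M.+1}) (Nc c x)%:R :> R.
  rewrite -sum1_count (partition_big (residue M) xpredT) //= natr_sum.
  by apply: eq_bigr => c _; rewrite /Nc -sum1_count.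
have moment c s : Ex (fun x => expR (Nt c s x)) <=
    expR (3 * q k * (m.+1%:R * (2 * l).+1%:R ^+ d)).
  under eq_Ex do rewrite /Nt expR_sum_seq.
  rewrite (Ex_prod_indep (p := p) p_sum1 (D := W k)); first last.
  - move=> y y'; rewrite !mem_filter => /andP[/eqP yc _] /andP[/eqP yc' _] yy' j.
    by apply: W_disj; apply: residue_inj_near; rewrite ?yc.
  - by move=> y j _ jW x s'; rewrite /xi K_dep.
  - by rewrite filter_uniq // undup_uniq.
  apply: le_trans (prod_le_exp (c := expR (3 * q k)) _) _.
    move=> y; rewrite mem_filter mem_undup mem_filter => /and3P[_ By _].
    apply/andP; split; first by apply: (Ex_ge0 p_ge0) => x; exact: expR_ge0.
    apply: (@le_trans _ _ (Ex (fun x => 1 + 3 * (xi x y)%:R))).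
      by apply: (ler_Ex p_ge0) => x; exact: expR_bool_le.
    rewrite ExD ExZ (Ex_cst p_sum1).
    apply: le_trans (expR_ge1Dx _); rewrite lerD2l ler_wpM2l //.
    exact: K_tail.
  rewrite -expRM_natr ler_expR; apply: ler_wpM2l; first by rewrite mulr_ge0.
  apply: le_trans (sA s); rewrite ler_nat size_filter; exact: count_size.
have class_bound c : Ex (fun x => (Nc c x)%:R) <= a + 1.
  (* The inequality n <= a + exp (n - a) replaces a maximum over skeletons by a
     sum; it costs at most 1 once a exceeds the logarithm of the mean of that sum. *)
  apply: (@le_trans _ _ (Ex (fun x => a + expR (- a) * \sum_s expR (Nt c s x)))).
    apply: (ler_Ex p_ge0) => x.
    have [s hs] := skeleton_cover z (leq_trans (pi_size x) Lml).
    have NN : (Nc c x)%:R <= Nt c s x.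
      have -> : Nt c s x = (count (xi x) (At c s))%:R.
        rewrite /Nt -sum1_count [in RHS]big_mkcond natr_sum /=.
        by apply: eq_bigr => y _; case: (xi x y).
      rewrite ler_nat count_filter; apply: (@leq_trans (count (fun y => xi x y && (residue M y == c)) (A s))).
        apply: count_uniq_sub => // y yc _; rewrite mem_undup mem_filter.
        rewrite (B_ball (mem_verts_pi yc)); have [u us yu] := hs y yc.
        by apply/flatten_mapP; exists u => //; apply: mem_box.
      by rewrite (eq_count (a2 := predI (xi x) (fun y => residue M y == c))).
    apply: (@le_trans _ _ (a + expR (- a) * expR (Nt c s x))).
      rewrite -expRD; have := expR_ge1Dx (- a + Nt c s x); lra.
    rewrite lerD2l ler_wpM2l ?expR_ge0 // (bigD1 s) //= lerDl.
    by apply: sumr_ge0 => s' _; exact: expR_ge0.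
  rewrite ExD ExZ (Ex_cst p_sum1) lerD2l Ex_sum.
  apply: (@le_trans _ _ (expR (- a) * \sum_(s : m.-tuple {ffun 'I_d -> 'I_(2 * l).+1})
      expR (3 * q k * (m.+1%:R * (2 * l).+1%:R ^+ d)))).
    by rewrite ler_wpM2l ?expR_ge0 //; apply: ler_sum.
  rewrite sumr_const card_tuple card_ffun !card_ord; move: moment; rewrite /a.
  set T := 3 * q k * _ => _; set e := expR T.
  rewrite -[e *+ _]mulr_natl mulrCA -expRD.
  rewrite -[X in X * _]lnK ?posrE ?ltr0n ?expn_gt0 // -expRD -[leRHS]expR0 ler_expR.
  rewrite !natrX !lnXn ?exprn_gt0 //.
  by rewrite -[_ *+ d]mulr_natl -[_ *+ m]mulr_natl opprD addrNK subrr.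
under eq_Ex do rewrite NcE.
rewrite Ex_sum; apply: le_trans (ler_sum _ (fun c _ => class_bound c)) _.
rewrite sumr_const card_ffun !card_ord -[leLHS]mulr_natl natrX.
by rewrite (_ : M.+1 = (a0 * k + 3)%N) // /M addn3 addn2.
Qed.

End Greedy.

(** * The sum of the squared influences *)

Lemma sum_inv_sqr_le (R : realType) n :
  \sum_(j < n) (j.+1%:R ^- 2) <= 2 :> R.
Proof.
suff : \sum_(j < n) (j.+1%:R ^- 2) <= 2 - 2 / n.+1%:R :> R.
  by move=> h; apply: le_trans h _; rewrite gerBl divr_ge0.
elim: n => [|n IH]; first by rewrite big_ord0 divr1 subrr.
rewrite big_ord_recr /=; apply: le_trans (lerD IH (lexx _)) _.
have a0 : 0 < n.+1%:R :> R by rewrite ltr0n.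
have a1 : 1 <= n.+1%:R :> R by rewrite ler1n.
rewrite -(natr1 n.+1); set a : R := n.+1%:R in a0 a1 *.
rewrite -subr_ge0 (_ : _ - _ = (a - 1) / (a ^+ 2 * (a + 1))); last first.
  by field; rewrite !gt_eqF //; lra.
by rewrite divr_ge0 ?mulr_ge0 ?sqr_ge0 //; lra.
Qed.

Section Influence.
Context {R : realType} {d : nat} {J S : finType} (p : S -> R).
Hypothesis p_ge0 : forall s, 0 <= p s.
Hypothesis p_sum1 : \sum_s p s = 1.
Local Notation Om := {ffun J -> S}.
Local Notation Ex := (@Ex R J S p).
Context (a0 D : nat) (W : nat -> site d -> {set J}) (Kx : Om -> site d -> nat).
Context (B : pred (site d)) (q : nat -> R) (Cq : R) (k0 : nat).
Hypothesis d_gt0 : (0 < d)%N.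
Hypothesis W_mono : forall k k' y, (k <= k')%N -> W k y \subset W k' y.
Hypothesis W_card : forall k y, (#|W k y| <= D * k)%N.
Hypothesis W_disj : forall k y y' j,
  (a0 * k + 2 < l1norm (y - y'))%N -> j \in W k y -> j \notin W k y'.
Hypothesis K_dep : forall k y j x s,
  j \notin W k y -> (k < Kx (upd x j s) y)%N = (k < Kx x y)%N.
Hypothesis K_cap : forall x y, (Kx x y <= k0)%N.
Hypothesis q_ge0 : forall k, 0 <= q k.
Hypothesis Cq_ge0 : 0 <= Cq.
Hypothesis q_decay : forall k, q k * k.+1%:R ^+ ((2 * d + 4) * d + d + 3) <= Cq.
Hypothesis K_tail : forall k y, B y ->
  Ex (fun x => (k < Kx x y)%N%:R) <= q k.
Context (z : site d) (L : nat) (pi : Om -> seq (dir d)).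
Hypothesis L_gt0 : (0 < L)%N.
Hypothesis pi_uniq : forall x, uniq (verts z (pi x)).
Hypothesis pi_size : forall x, (size (pi x) <= L)%N.
Hypothesis B_ball : forall y, (l1norm (y - z) <= L)%N -> B y.

Definition greedy_cst : R :=
  2 * (a0 + 3)%:R ^+ d * (d%:R * (2 * d + 6)%:R + 6 * 3 ^+ d * Cq + 1) + 3 ^+ d * Cq.

Lemma greedy_cst_ge0 : 0 <= greedy_cst.
Proof.
have ? : 0 <= 3 ^+ d :> R by rewrite exprn_ge0.
have ? : 0 <= (a0 + 3)%:R ^+ d :> R by rewrite exprn_ge0.
by rewrite addr_ge0 ?mulr_ge0 // !addr_ge0 ?mulr_ge0.
Qed.

(** Skeletons at the scale [k.+1 ^ (2 * d + 4)], polynomial in the level [k], so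
that rare levels are charged to few blocks; when the path is shorter than one
block, the union bound over all vertices suffices. *)
Lemma greedy_polynomial k :
  k.+1%:R ^+ d.+1 * Ex (fun x => (count (fun y => k < Kx x y)%N (verts z (pi x)))%:R)
  <= greedy_cst * L%:R * k.+1%:R ^- 2.
Proof.
set E := Ex _; have [A AdE] : exists A, A = (2 * d + 4)%N by exists (2 * d + 4)%N.
have AE' : A = (d.+1 + 2 + d + 1)%N by rewrite AdE; lia.
have [ka kaE] : exists ka : R, ka = k.+1%:R by exists k.+1%:R.
rewrite -kaE; have ka1 : 1 <= ka by rewrite kaE ler1n.
have ka0 : 0 < ka by lra.
have L1 : 1 <= L%:R :> R by rewrite ler1n.
have t0 : 0 <= 3 ^+ d :> R by rewrite exprn_ge0.
have kaX n : 1 <= ka ^+ n by rewrite exprn_ege1.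
have kaX0 n : 0 < ka ^+ n by rewrite exprn_gt0.
rewrite ler_pdivlMr // mulrAC -exprD.
have qd : q k * ka ^+ (A * d + d + 3) <= Cq by rewrite kaE AdE q_decay.
pose l := (k.+1 ^ A)%N.
have lE : l%:R = ka ^+ A :> R by rewrite kaE natrX.
have l0 : (0 < l)%N by rewrite expn_gt0.
have [lL|Ll] := leqP l L; last first.
  have E_le : E <= 3 ^+ d * (L%:R * ka ^+ (A * d)) * q k.
    apply: le_trans (greedy_crude p_ge0 q_ge0 K_tail pi_uniq pi_size B_ball k) _.
    rewrite ler_wpM2r //; apply: (@le_trans _ _ ((3 * L%:R) ^+ d)).
      by rewrite lerXn2r ?nnegrE ?mulr_ge0 // -natrM ler_nat; lia.
    rewrite exprMn ler_wpM2l // -(prednK d_gt0) exprS ler_wpM2l //.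
    apply: (@le_trans _ _ ((ka ^+ A) ^+ d.-1)).
      by rewrite lerXn2r ?nnegrE ?(ltW (kaX0 _)) // -lE ler_nat ltnW.
    by rewrite -exprM ler_weXn2l // leq_mul2l leqnSn orbT.
  apply: le_trans (ler_wpM2l (ltW (kaX0 _)) E_le) _.
  apply: (@le_trans _ _ (3 ^+ d * L%:R * Cq)).
    rewrite [leLHS](_ : _ = 3 ^+ d * L%:R * (q k * (ka ^+ (d.+1 + 2) * ka ^+ (A * d)))); last first.
      by move: (ka ^+ _) (ka ^+ (A * d)) (3 ^+ d) => u1 u2 u3; ring.
    rewrite ler_wpM2l ?mulr_ge0 // -exprD.
    by rewrite (_ : _ + _ = A * d + d + 3)%N //; lia.
  rewrite mulrAC ler_wpM2r // /greedy_cst lerDr.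
  by rewrite mulr_ge0 // ?mulr_ge0 ?exprn_ge0 // !addr_ge0 ?mulr_ge0.
pose m := (L %/ l).+1.
have Lml : (L <= m * l)%N by rewrite ltnW // ltn_ceil.
have m1 : 1 <= m%:R :> R by rewrite ler1n.
have mL : m%:R * ka ^+ A <= 2 * L%:R.
  rewrite -lE -!natrM ler_nat /m mulSn mul2n -addnn leq_add //.
  exact: leq_trunc_div.
clearbody m.
have := greedy_level p_ge0 p_sum1 W_disj K_dep q_ge0 K_tail pi_uniq pi_size B_ball k Lml.
rewrite -/E => E_le.
clearbody l.
have l3 : (2 * l).+1%:R <= 3 * ka ^+ A by rewrite -lE -natrM ler_nat; lia.
have lnl : ln (2 * l).+1%:R <= (2 * d + 6)%:R * ka.
  apply: (@le_trans _ _ (ln (3 * ka ^+ A))).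
    by rewrite ler_ln ?posrE ?ltr0n // mulr_gt0.
  rewrite lnM ?posrE // lnXn // -[ln ka *+ _]mulr_natl.
  have ln3 : ln 3 <= 2 :> R.
    have t3 : 0 < 3 :> R by [].
    by have := ln_tangent t3 (ltr01 : 0 < 1 :> R); rewrite ln1 divr1; lra.
  have lnk : ln ka <= ka.
    by have := ln_tangent ka0 (ltr01 : 0 < 1 :> R); rewrite ln1 divr1; lra.
  have := ler_wpM2l (ler0n R A) lnk; rewrite AdE natrD (natrD _ (2 * d) 6) => h.
  by nra.
have qe : q k * (2 * l).+1%:R ^+ d <= 3 ^+ d * Cq.
  apply: (@le_trans _ _ (q k * (3 * ka ^+ A) ^+ d)).
    by rewrite ler_wpM2l // lerXn2r ?nnegrE // mulr_ge0 // ltW.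
  rewrite exprMn mulrCA ler_wpM2l // -exprM; apply: le_trans qd.
  by rewrite ler_wpM2l // ler_weXn2l //; lia.
have [H HE] : exists H : R, H = d%:R * (2 * d + 6)%:R + 6 * 3 ^+ d * Cq + 1.
  by eexists.
have tC : 0 <= 3 ^+ d * Cq by rewrite mulr_ge0.
have inner : m%:R * (d%:R * ln (2 * l).+1%:R) +
     3 * q k * (m.+1%:R * (2 * l).+1%:R ^+ d) + 1 <= m%:R * ka * H.
  have h1 : m%:R * (d%:R * ln (2 * l).+1%:R) <= m%:R * ka * (d%:R * (2 * d + 6)%:R).
    rewrite -mulrA ler_wpM2l // (mulrC ka) -mulrA ler_wpM2l //.
  have h2 : 3 * q k * (m.+1%:R * (2 * l).+1%:R ^+ d) <= m%:R * ka * (6 * 3 ^+ d * Cq).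
    rewrite (_ : 3 * _ * _ = 3 * m.+1%:R * (q k * (2 * l).+1%:R ^+ d)); last by ring.
    apply: le_trans (ler_wpM2l _ qe) _; first by rewrite mulr_ge0.
    rewrite (_ : _ * (6 * _ * _) = 6 * (m%:R * ka) * (3 ^+ d * Cq)); last by ring.
    rewrite ler_wpM2r // -natr1; nra.
  have h3 : 1 <= m%:R * ka * 1 by rewrite mulr1; nra.
  by rewrite HE !mulrDr; lra.
have H0 : 0 <= H by rewrite HE !addr_ge0 ?mulr_ge0.
have outer : (a0 * k + 3)%:R ^+ d <= (a0 + 3)%:R ^+ d * ka ^+ d :> R.
  rewrite -exprMn lerXn2r ?nnegrE ?mulr_ge0 ?(ltW ka0) // kaE -natrM ler_nat.
  by rewrite mulnDl leq_add ?leq_pmulr ?leq_mul.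
apply: (@le_trans _ _ (ka ^+ (d.+1 + 2) *
    ((a0 + 3)%:R ^+ d * ka ^+ d * (m%:R * ka * H)))).
  rewrite ler_wpM2l ?(ltW (kaX0 _)) //; apply: le_trans E_le _.
  apply: (@le_trans _ _ ((a0 * k + 3)%:R ^+ d * (m%:R * ka * H))).
    by rewrite ler_wpM2l ?exprn_ge0.
  by rewrite ler_wpM2r ?mulr_ge0 // ltW.
have AE : ka ^+ A = ka ^+ (d.+1 + 2) * ka ^+ d * ka.
  by rewrite AE' exprD expr1 exprD.
have ringE (u1 u2 u3 h n c : R) :
  u1 * (u3 * u2 * (n * c * h)) = u3 * h * (n * (u1 * u2 * c)).
  by ring.
rewrite ringE.
rewrite -AE {ringE}.
apply: le_trans (ler_wpM2l _ mL) _; first by rewrite mulr_ge0 ?exprn_ge0.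
rewrite /greedy_cst -HE [leRHS]mulrDl.
rewrite (_ : 2 * _ * H * _ = (a0 + 3)%:R ^+ d * H * (2 * L%:R)); last first.
  by move: ((a0 + 3)%:R ^+ d) => u1; ring.
by rewrite lerDl mulr_ge0.
Qed.

Definition hits i x := count (fun y => i \in W (Kx x y) y) (verts z (pi x)).

(** The sum counts the pairs of vertices with a common influencing coordinate. The
larger of their two radii is then comparable to their distance, and the pair is
charged to the vertex that has it. *)
Lemma sum_hits_sqr x : (\sum_i hits i x ^ 2 <=
  \sum_(y <- verts z (pi x))
    2 * ((2 * (a0 * Kx x y + 2)).+1 ^ d * (D * Kx x y)))%N.
Proof.
set V := verts z (pi x); pose bb i y : nat := i \in W (Kx x y) y.
pose near' y y' := (Kx x y' <= Kx x y)%N && (l1norm (y' - y) <= a0 * Kx x y + 2)%N.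
pose c y y' := if near' y y' then (D * Kx x y)%N else 0%N.
have Wb y : (\sum_i bb i y <= D * Kx x y)%N.
  apply: leq_trans (W_card (Kx x y) y); rewrite -sum1_card [leqRHS]big_mkcond /=.
  by apply: leq_sum => i _; rewrite /bb; case: (i \in _).
have half y y' : (Kx x y' <= Kx x y)%N -> (\sum_i bb i y * bb i y' <= c y y')%N.
  move=> KK; rewrite /c /near' KK /=; have [_|yy'] := leqP (l1norm (y' - y)).
    apply: leq_trans (Wb y); apply: leq_sum => i _.
    by rewrite /bb; do 2 case: (i \in _).
  rewrite big1 // => i _; rewrite /bb; case: (boolP (i \in W (Kx x y') y')) => [iy'|]; last by rewrite muln0.
  have /negbTE -> // : i \notin W (Kx x y) y.
  by apply: (W_disj yy'); apply: (fintype.subsetP (W_mono y' KK)).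
have pair y y' : (\sum_i bb i y * bb i y' <= c y y' + c y' y)%N.
  have [KK|/ltnW KK] := leqP (Kx x y') (Kx x y).
    by apply: leq_trans (half _ _ KK) (leq_addr _ _).
  under eq_bigr do rewrite mulnC.
  by apply: leq_trans (half _ _ KK) (leq_addl _ _).
have -> : (\sum_i hits i x ^ 2 = \sum_(y <- V) \sum_(y' <- V) \sum_i bb i y * bb i y')%N.
  rewrite (eq_bigr (fun i => \sum_(y <- V) \sum_(y' <- V) bb i y * bb i y')%N).
    rewrite exchange_big /=; apply: eq_bigr => y _.
    by rewrite exchange_big.
  move=> i _; rewrite -big_distrlr /= -mulnn.
  suff -> : hits i x = (\sum_(y <- V) bb i y)%N by [].
  by rewrite /hits -sum1_count big_mkcond; apply: eq_bigr => y _; rewrite /bb; case: (i \in _).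
apply: (@leq_trans (\sum_(y <- V) \sum_(y' <- V) (c y y' + c y' y))%N).
  by apply: leq_sum => y _; apply: leq_sum => y' _.
under eq_bigr do rewrite big_split.
rewrite big_split /= [X in (_ + X)%N]exchange_big /= addnn -mul2n -big_distrr /=.
rewrite leq_mul2l /=; apply: leq_sum => y _.
rewrite -big_mkcond /= big_const_seq iter_addn_0 mulnC leq_mul2r; apply/orP; right.
rewrite -size_filter; apply: (size_in_ball (z := y)); first exact/filter_uniq/pi_uniq.
by move=> y'; rewrite mem_filter => /andP[/andP[]].
Qed.

Definition influence_cst : R := 4 * D%:R * (2 * a0 + 5)%:R ^+ d * greedy_cst.

Lemma influence_sum :
  \sum_i Ex (fun x => (hits i x)%:R ^+ 2) <= influence_cst * L%:R.
Proof.
pose C1 : R := 2 * D%:R * (2 * a0 + 5)%:R ^+ d.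
have C10 : 0 <= C1 by rewrite mulr_ge0 ?mulr_ge0 ?exprn_ge0.
rewrite -Ex_sum.
apply: (@le_trans _ _ (Ex (fun x => C1 * \sum_(k < k0) k.+1%:R ^+ d.+1 *
    (count (fun y => k < Kx x y)%N (verts z (pi x)))%:R))).
  apply: (ler_Ex p_ge0) => x.
  rewrite (eq_bigr (fun i => (hits i x ^ 2)%N%:R)); last by move=> i _; rewrite natrX.
  rewrite -natr_sum; apply: (@le_trans _ _ (C1 * \sum_(y <- verts z (pi x)) (Kx x y)%:R ^+ d.+1)).
    apply: le_trans (_ : (\sum_(y <- verts z (pi x))
    2 * ((2 * (a0 * Kx x y + 2)).+1 ^ d * (D * Kx x y)))%N%:R <= _).
      by rewrite ler_nat sum_hits_sqr.
    rewrite natr_sum mulr_sumr; apply: ler_sum => y _.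
    case: (Kx x y) => [|k]; first by rewrite !muln0 expr0n mulr0.
    rewrite /C1 !natrM natrX exprS.
    rewrite [leRHS](_ : _ = 2 * ((2 * a0 + 5)%:R ^+ d * k.+1%:R ^+ d * (D%:R * k.+1%:R))); last by ring.
    rewrite ler_wpM2l // ler_wpM2r ?mulr_ge0 // -exprMn lerXn2r ?nnegrE ?mulr_ge0 //.
    rewrite -natrM ler_nat mulnDl -mulnA; move: (a0 * k.+1)%N => u; lia.
  rewrite ler_wpM2l //.
  rewrite (eq_bigr (fun k : 'I_k0 => \sum_(y <- verts z (pi x)) k.+1%:R ^+ d.+1 *
      (k < Kx x y)%N%:R)); last first.
    move=> k _; rewrite -mulr_sumr; congr (_ * _).
    by rewrite -sum1_count big_mkcond natr_sum /=; apply: eq_bigr => y _; case: (_ < _)%N.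
  rewrite exchange_big /=; apply: ler_sum => y _.
  have := K_cap x y; case: (Kx x y) => [|k] kk0.
    by rewrite expr0n /=; apply: sumr_ge0 => k _; rewrite mulr_ge0 ?exprn_ge0.
  rewrite (bigD1 (Ordinal kk0)) //= leqnn mulr1 lerDl.
  by apply: sumr_ge0 => j _; rewrite mulr_ge0 ?exprn_ge0.
rewrite ExZ Ex_sum /influence_cst.
rewrite (_ : 4 * _ * _ * _ = C1 * (2 * greedy_cst)); last by rewrite /C1; ring.
rewrite -mulrA ler_wpM2l //.
apply: (@le_trans _ _ (\sum_(k < k0) greedy_cst * L%:R * k.+1%:R ^- 2)).
  by apply: ler_sum => k _; rewrite ExZ; exact: greedy_polynomial.
rewrite -mulr_sumr (_ : 2 * _ * _ = greedy_cst * L%:R * 2); last by ring.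
by rewrite ler_wpM2l ?mulr_ge0 ?greedy_cst_ge0 ?sum_inv_sqr_le.
Qed.

End Influence.

(** * The variance of an averaged passage time *)

Section AveragedPassageTime.
Context {R : realType} {d : nat} {K : eqType} {dist : K -> K -> R}
  {shift : site d -> K -> K} (G : keying dist shift).
Context {J S : finType} (p : S -> R) (p0 : R).
Hypothesis p_ge0 : forall s, 0 <= p s.
Hypothesis p_sum1 : \sum_s p s = 1.
Hypothesis p0_gt0 : 0 < p0.
Hypothesis p0_le : forall s, p s = 0 \/ p0 <= p s.
Local Notation Om := {ffun J -> S}.
Local Notation Ex := (@Ex R J S p).
Context (a0 D : nat) (W : nat -> site d -> {set J}) (Kx : Om -> site d -> nat).
Context (B : pred (site d)) (q : nat -> R) (Cq : R) (k0 : nat).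
Hypothesis d_gt0 : (0 < d)%N.
Hypothesis W_mono : forall k k' y, (k <= k')%N -> W k y \subset W k' y.
Hypothesis W_card : forall k y, (#|W k y| <= D * k)%N.
Hypothesis W_disj : forall k y y' j,
  (a0 * k + 2 < l1norm (y - y'))%N -> j \in W k y -> j \notin W k y'.
Hypothesis K_dep : forall k y j x s,
  j \notin W k y -> (k < Kx (upd x j s) y)%N = (k < Kx x y)%N.
Hypothesis K_cap : forall x y, (Kx x y <= k0)%N.
Hypothesis q_ge0 : forall k, 0 <= q k.
Hypothesis Cq_ge0 : 0 <= Cq.
Hypothesis q_decay : forall k, q k * k.+1%:R ^+ ((2 * d + 4) * d + d + 3) <= Cq.
Hypothesis K_tail : forall k y, B y ->
  Ex (fun x => (k < Kx x y)%N%:R) <= q k.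
Context (b : R) (tau : Om -> K -> R).
Hypothesis b_ge0 : 0 <= b.
Hypothesis tau_ge0 : forall x k, 0 <= tau x k.
Hypothesis tau_le : forall x k, tau x k <= b.
Hypothesis tau_loc : forall x j s y k, j \notin W (Kx x y) y -> k \in near G y ->
  tau (upd x j s) k = tau x k.
Context (L : nat) (v : site d) (Z : seq (site d)).
Hypothesis L_gt0 : (0 < L)%N.
Hypothesis vL : (l1norm v <= L)%N.
Hypothesis Z_gt0 : (0 < size Z)%N.
Hypothesis B_ball : forall z y, z \in Z -> (l1norm (y - z) <= L)%N -> B y.

Local Notation gpath z := (fun x => geo G (tau x) L z v).
Local Notation hit z i x := (hits W Kx z (gpath z) i x).

Definition avg_time x : R := (size Z)%:R^-1 * \sum_(z <- Z) ltime G (tau x) L z v.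

(** Along the path that is optimal before the change, only the vertices hit by
the resampled coordinate become slower. *)
Lemma ltime_resample z i x s :
  ltime G (tau (upd x i s)) L z v - ltime G (tau x) L z v <= b * (hit z i x)%:R.
Proof.
rewrite lerBlDl; have [gc _] := geo_best G (tau x) z vL.
apply: le_trans (ltime_le G (tau (upd x i s)) z gc) _.
apply: time_perturb => // y k yc ky iy.
by rewrite (tau_loc s iy ky).
Qed.

Lemma avg_deviation i :
  Ex (fun x => deviation p i avg_time x ^+ 2) <=
    2 * b ^+ 2 * ((size Z)%:R^-1 * \sum_(z <- Z) Ex (fun x => (hit z i x)%:R ^+ 2)) /\
  Ex (fun x => `|deviation p i avg_time x|) <=
    2 * b * ((size Z)%:R^-1 * \sum_(z <- Z) Ex (fun x => (hit z i x)%:R)).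
Proof.
pose N x : R := b * \sum_(z <- Z) (size Z)%:R^-1 * (hit z i x)%:R.
have Z0 : 0 <= (size Z)%:R^-1 :> R by rewrite invr_ge0.
have N0 x : 0 <= N x by rewrite mulr_ge0 // sumr_ge0 // => z _; rewrite mulr_ge0.
have [|h1 h2] := @deviation_le R J S p p_ge0 p_sum1 i avg_time N N0.
  move=> x s; rewrite /avg_time -mulrBr -sumrB /N -mulr_sumr mulrCA ler_wpM2l //.
  by rewrite mulr_sumr; apply: ler_sum => z _; exact: ltime_resample.
split.
  apply: le_trans h1 _; rewrite -mulrA ler_wpM2l //.
  rewrite -!Ex_sum -!ExZ; apply: (ler_Ex p_ge0) => x.
  rewrite /N exprMn ler_wpM2l ?sqr_ge0 //.
  rewrite mulr_sumr; apply: sqr_average => //.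
  by rewrite big_const_seq count_predT iter_addr_0 -[_ *+ _]mulr_natr mulVf // pnatr_eq0 -lt0n.
apply: le_trans h2 _; rewrite -mulrA ler_wpM2l //.
rewrite -!Ex_sum -!ExZ; apply: (ler_Ex p_ge0) => x.
by rewrite /N -mulr_sumr.
Qed.

(** The Efron-Stein inequality would give the bound without [ln lam] on the left.
The gain comes from the first moments of the deviations, all of which are at most
of order [eta]: the parameter [lam] may be as large as the inverse of [eta]. *)
Lemma variance_avg_time (eta lam : R) : 0 < lam -> 0 <= eta ->
  (forall i, (size Z)%:R^-1 * \sum_(z <- Z) Ex (fun x => (hit z i x)%:R) <= eta) ->
  (Ex (fun x => avg_time x ^+ 2) - Ex avg_time ^+ 2) * ln lam <=
  (8 / p0 + 4 * (lam * eta)) * b ^+ 2 * influence_cst a0 D (d := d) Cq * L%:R.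
Proof.
move=> lam0 eta0 small; set C := influence_cst _ _ _.
have Zn : (size Z)%:R != 0 :> R by rewrite pnatr_eq0 -lt0n.
have Z0 : 0 <= (size Z)%:R^-1 :> R by rewrite invr_ge0.
have total : \sum_i (size Z)%:R^-1 * (\sum_(z <- Z) Ex (fun x => (hit z i x)%:R ^+ 2))
    <= C * L%:R.
  rewrite -mulr_sumr exchange_big /=.
  apply: (@le_trans _ _ ((size Z)%:R^-1 * \sum_(z <- Z) C * L%:R)).
    rewrite ler_wpM2l // !big_seq; apply: ler_sum => z zZ.
    apply: (influence_sum p_ge0 p_sum1 d_gt0 W_mono W_card W_disj K_dep K_cap
      q_ge0 Cq_ge0 q_decay K_tail L_gt0).
    - by move=> x; apply: geo_uniq.
    - by move=> x; apply: size_geo.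
    - by move=> y; apply: B_ball.
  by rewrite big_const_seq count_predT iter_addr_0 -[C * _ *+ _]mulr_natl mulKf.
apply: le_trans (falik_samorodnitsky p_ge0 p_sum1 p0_gt0 p0_le avg_time lam0) _.
have b2 : 0 <= b ^+ 2 by rewrite sqr_ge0.
rewrite [leRHS](_ : _ = 4 / p0 * (2 * b ^+ 2 * (C * L%:R)) +
   lam * (4 * b ^+ 2 * eta * (C * L%:R))); last first.
  by move: (C) (p0^-1) => c ip; ring.
apply: lerD.
  apply: ler_wpM2l; first by rewrite divr_ge0 // ltW.
  apply: le_trans (ler_wpM2l _ total); last by rewrite mulr_ge0.
  rewrite mulr_sumr; apply: ler_sum => i _; exact: (avg_deviation i).1.
apply: ler_wpM2l; first exact: ltW.
apply: le_trans (ler_wpM2l _ total); last by rewrite !mulr_ge0.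
rewrite mulr_sumr; apply: ler_sum => i _.
have [_ h] := avg_deviation i.
set A := _ * \sum_(z <- Z) _ in h; set A2 := _ * \sum_(z <- Z) _.
have A_eta : A <= eta := small i.
have AA2 : A <= A2.
  rewrite ler_wpM2l //; apply: ler_sum => z _; apply: (ler_Ex p_ge0) => x.
  by rewrite -natrX ler_nat; case: (hits _ _ _ _ _ _) => // n; rewrite leq_pmulr.
have A0 : 0 <= A.
  rewrite mulr_ge0 //; apply: sumr_ge0 => z _; exact: (Ex_ge0 p_ge0).
have dev0 : 0 <= Ex (fun x => `|deviation p i avg_time x|) by apply: (Ex_ge0 p_ge0).
apply: (@le_trans _ _ ((2 * b * A) * (2 * b * A))).
  by rewrite expr2 ler_pM.
rewrite (_ : 2 * b * A * _ = 4 * b ^+ 2 * (A * A)); last by ring.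
have AA : A * A <= eta * A2 by exact: ler_pM.
by rewrite -[leRHS]mulrA; apply: ler_wpM2l; rewrite ?mulr_ge0.
Qed.

End AveragedPassageTime.

(** * Laws of finitely many coordinates *)

Section FiniteLaws.
Context {R : realType} {disp : measure_display} {T : measurableType disp}
  (P : probability T R).

Definition pr (A : set T) : R := fine (P A).

Lemma prE A : measurable A -> P A = (pr A)%:E.
Proof. by move=> mA; rewrite /pr fineK // fin_num_measure. Qed.

Lemma pr_ge0 A : 0 <= pr A.
Proof. exact: fine_ge0. Qed.

Lemma pr_le1 A : measurable A -> pr A <= 1.
Proof. by move=> mA; rewrite -lee_fin -prE // probability_le1. Qed.

Lemma integral_weighted_indic (I : Type) (r : seq I) (c : I -> R) (A : I -> set T) :
  (forall k, 0 <= c k) -> (forall k, measurable (A k)) ->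
  (\int[P]_w (\sum_(k <- r) c k * \1_(A k) w)%:E)%E =
  (\sum_(k <- r) c k * pr (A k))%:E.
Proof.
move=> c0 mA; under eq_integral do rewrite -sumEFin.
rewrite ge0_integral_sum //; first last.
- by move=> k w _; rewrite lee_fin mulr_ge0.
- move=> k; apply/measurable_EFinP; apply: measurable_funM => //.
rewrite -sumEFin; apply: eq_bigr => k _.
under eq_integral do rewrite EFinM.
rewrite ge0_integralZl_EFin //; last first.
  exact/measurable_EFinP.
by rewrite integral_indic // setIT EFinM -[in RHS]prE.
Qed.

(** The left-hand side is the mean number of events that occur, which is at most
the length of [r] on the exceptional event [G]. *)
Lemma sum_pr_le (I : eqType) (r : seq I) (A : I -> set T) (G : set T) (c : R) :
  0 <= c -> (forall k, measurable (A k)) -> measurable G ->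
  (forall w, ~ G w -> \sum_(k <- r) \1_(A k) w <= c) ->
  \sum_(k <- r) pr (A k) <= c + (size r)%:R * pr G.
Proof.
move=> c0 mA mG h.
have -> : \sum_(k <- r) pr (A k) = \sum_(k <- r) 1 * pr (A k).
  by apply: eq_bigr => k _; rewrite mul1r.
have -> : c + (size r)%:R * pr G =
    \sum_(k <- [:: true; false]) (if k then c else (size r)%:R) *
      pr (if k then setT else G).
  by rewrite !big_cons big_nil addr0 /pr probability_setT mulr1.
rewrite -lee_fin -!integral_weighted_indic //; first last.
- by case.
- by case.
apply: ge0_le_integral => //.
- by move=> w _; rewrite lee_fin sumr_ge0 // => k _; rewrite mulr_ge0.
- apply/measurable_EFinP; apply: measurable_sum => k.
  by apply: measurable_funM => //; exact: measurable_indic.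
- apply/measurable_EFinP; apply: measurable_sum => k.
  by apply: measurable_funM => //; case: k; exact: measurable_indic.
move=> w _; rewrite lee_fin !big_cons big_nil addr0 indicT mulr1.
under eq_bigr do rewrite mul1r.
have [Gw|Gw] := pselect (G w); last first.
  by apply: le_trans (h w Gw) _; rewrite lerDl mulr_ge0.
rewrite [\1_G w]indicE mem_set // mulr1.
apply: (@le_trans _ _ (size r)%:R); last by rewrite lerDr.
apply: (@le_trans _ _ (\sum_(k <- r) 1)).
  by apply: ler_sum => k _; rewrite indicE; case: (_ \in _).
by rewrite big_const_seq count_predT iter_addr_0.
Qed.

Lemma pr_union_le (I : eqType) (r : seq I) (A : I -> set T) (B : set T) :
  (forall k, measurable (A k)) -> measurable B ->
  (forall w, B w -> exists2 k, k \in r & A k w) ->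
  pr B <= \sum_(k <- r) pr (A k).
Proof.
move=> mA mB h.
have -> : pr B = \sum_(k <- [:: tt]) 1 * pr B by rewrite big_seq1 mul1r.
have -> : \sum_(k <- r) pr (A k) = \sum_(k <- r) 1 * pr (A k).
  by apply: eq_bigr => k _; rewrite mul1r.
rewrite -lee_fin -(integral_weighted_indic [:: tt] (c := fun=> 1) (A := fun=> B)) //.
rewrite -integral_weighted_indic //.
apply: ge0_le_integral => //.
- by move=> w _; rewrite lee_fin sumr_ge0 // => k _; rewrite mulr_ge0.
- apply/measurable_EFinP; apply: measurable_sum => k.
  by apply: measurable_funM => //; exact: measurable_indic.
- apply/measurable_EFinP; apply: measurable_sum => k.
  by apply: measurable_funM => //; exact: measurable_indic.
move=> w _; rewrite lee_fin big_seq1 mul1r.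
under eq_bigr do rewrite mul1r.
have [Bw|Bw] := pselect (B w); last first.
  by rewrite indicE memNset // sumr_ge0.
have [k kr Ak] := h w Bw.
rewrite indicE mem_set // (perm_big _ (perm_to_rem kr)) big_cons indicE mem_set //.
by rewrite lerDl sumr_ge0.
Qed.

Context {S : finType} {I : countType} (X : I -> T -> S) (i0 : I).
Hypothesis iidX : iid P X.

Definition law (s : S) : R := pr (X i0 @^-1` [set s]).

Lemma measurable_X i (B : set S) : measurable (X i @^-1` B).
Proof. by case: iidX => + _ _; apply. Qed.

Lemma law_ge0 s : 0 <= law s.
Proof. exact: pr_ge0. Qed.

Lemma law_sum1 : \sum_s law s = 1.
Proof.
have -> : \sum_s law s = \sum_s 1 * law s.
  by apply: eq_bigr => s _; rewrite mul1r.
apply: EFin_inj; rewrite -integral_weighted_indic //; last by move=> s; exact: measurable_X.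
under eq_integral => w _.
  rewrite (bigD1 (X i0 w)) //= big1; last first.
    by move=> s sX; rewrite mul1r indicE memNset // => /= e; rewrite e eqxx in sX.
  rewrite addr0 mul1r indicE mem_set //; over.
by rewrite integral_cst //= mul1e; exact: probability_setT.
Qed.

(** The product of the positive masses is below each of them. *)
Lemma law_lower_bound : exists2 p0, 0 < p0 & forall s, law s = 0 \/ p0 <= law s.
Proof.
exists (\prod_(s | law s != 0) law s).
  by apply: prodr_gt0 => s s0; rewrite lt_neqAle eq_sym s0 law_ge0.
move=> s; have [->|s0] := eqVneq (law s) 0; [by left|right].
rewrite (bigD1 s) //= -[leRHS]mulr1 ler_wpM2l ?law_ge0 //.
apply: prodr_ile1 => s' _; rewrite law_ge0 /=.
by apply: pr_le1; exact: measurable_X.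
Qed.

Context (J : {fset I}).

Definition XJ (w : T) : {ffun J -> S} := restr J (fun i => X i w).

Lemma measurable_XJ (A : set {ffun J -> S}) : measurable (XJ @^-1` A).
Proof.
have m1 x : measurable (XJ @^-1` [set x]).
  have -> : XJ @^-1` [set x] = \bigcap_(j in [set: J]) (X (val j) @^-1` [set x j]).
    apply/seteqP; split => [w /= <- j _ /=|w /= h]; first by rewrite ffunE.
    by apply/ffunP => j; rewrite ffunE; exact: h.
  by apply: fin_bigcap_measurable => // j _; exact: measurable_X.
have -> : XJ @^-1` A = \bigcup_(x in A) XJ @^-1` [set x].
  by apply/seteqP; split => [w /= Aw|w /= [x Ax ->]] //; exists (XJ w).
by apply: fin_bigcup_measurable => //; exact: finite_finset.
Qed.

Lemma pr_XJ1 x : pr (XJ @^-1` [set x]) = mu law x.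
Proof.
have [_ same indep] := iidX.
pose B i : set S := [set s | forall h : i \in J, s = x [` h]%fset].
have := indep J B.
have -> : \bigcap_(i in [set` J]) (X i @^-1` B i) = XJ @^-1` [set x].
  apply/seteqP; split => [w /= h|w /= e i iJ /= h]; last by rewrite -e ffunE.
  apply/ffunP => j; rewrite ffunE; have := h (val j) (valP j) (valP j).
  by move=> ->; congr (x _); apply/val_inj.
rewrite big_seq_fsetE /= => h; apply: EFin_inj.
rewrite -prE; last exact: measurable_XJ.
rewrite h /mu -prodEFin; apply: eq_bigr => j _.
rewrite -prE; last exact: measurable_X.
transitivity (P (X (val j) @^-1` [set x j])); last exact: same.
congr (P (_ @^-1` _)); apply/seteqP; split => s /=.
  by move=> /(_ (valP j)) ->; congr (x _); apply/val_inj.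
by move=> -> h'; congr (x _); apply/val_inj.
Qed.

Lemma integral_XJ (f : {ffun J -> S} -> R) : (forall x, 0 <= f x) ->
  (\int[P]_w (f (XJ w))%:E)%E = (Ex law f)%:E.
Proof.
move=> f0.
transitivity (\int[P]_w (\sum_x f x * \1_(XJ @^-1` [set x]) w)%:E)%E.
  apply: eq_integral => w _; congr EFin.
  rewrite (bigD1 (XJ w)) //= big1; last first.
    by move=> x xX; rewrite indicE memNset ?mulr0 // => /= e; rewrite e eqxx in xX.
  by rewrite addr0 indicE mem_set // mulr1.
rewrite integral_weighted_indic //; last by move=> x; exact: measurable_XJ.
by congr EFin; apply: eq_bigr => x _; rewrite pr_XJ1 mulrC.
Qed.

Lemma pr_XJ (A : pred {ffun J -> S}) :
  pr [set w | A (XJ w)] = Ex law (fun x => (A x)%:R).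
Proof.
apply: EFin_inj; rewrite -integral_XJ //.
have mA : measurable [set w | A (XJ w)] by exact: (measurable_XJ [set x | A x]).
rewrite -prE // -[X in P X]setIT -integral_indic //.
apply: eq_integral => w _; rewrite indicE; congr ((nat_of_bool _)%:R%:E).
by apply/idP/idP; [rewrite inE|move=> h; rewrite inE].
Qed.

End FiniteLaws.

(** * Measurability of events of the environment *)

Section EnvironmentEvents.
Context {R : realType} {d : nat} {K : eqType} {dist : K -> K -> R}
  {shift : site d -> K -> K} (G : keying dist shift).

Definition env_gen : set (set (K -> R)) :=
  [set A | exists k B, measurable B /\ A = [set x | B (x k)]].

Local Notation Env := (g_sigma_algebraType env_gen).
Local Notation event A := (product_sigma (measurable : set (set R)) A).

Lemma eventE (A : set (K -> R)) : event A = (measurable (A : set Env)).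
Proof. by []. Qed.

Lemma measurable_coord k : measurable_fun setT (fun x : Env => x k).
Proof.
move=> _ B mB; rewrite setTI; apply: sub_sigma_algebra.
by exists k, B.
Qed.

Lemma measurable_time z c : measurable_fun setT (fun x : Env => time G x z c).
Proof.
rewrite /time; apply: measurable_funD.
  by apply: measurable_sum => k; exact: measurable_coord.
elim: c z => [|a c IH] z /=; first exact: measurable_cst.
by apply: measurable_funD => //; exact: measurable_coord.
Qed.

Lemma measurable_better z c c' :
  measurable_fun setT (fun x : Env => better G x z c c').
Proof.
apply: measurable_or; first by apply: measurable_fun_ltr; exact: measurable_time.
apply: measurable_and; last exact: measurable_cst.
by apply: measurable_fun_eqr; exact: measurable_time.
Qed.

Lemma measurable_all (I : Type) (r : seq I) (f : I -> Env -> bool) :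
  (forall i, measurable_fun setT (f i)) ->
  measurable_fun setT (fun x => all (fun i => f i x) r).
Proof.
move=> mf; elim: r => [|i r IH] /=; first exact: measurable_cst.
exact: measurable_and.
Qed.

Lemma measurable_nth_find (I : Type) (i0 : I) (r : seq I) (f : Env -> I -> bool)
    (Q : pred I) : (forall i, measurable_fun setT (f^~ i)) ->
  measurable_fun setT (fun x => Q (nth i0 r (find (f x) r))).
Proof.
move=> mf; elim: r => [|i r IH] /=; first exact: measurable_cst.
rewrite (_ : (fun x => _) = (fun x => (f x i && Q i) ||
    (~~ f x i && Q (nth i0 r (find (f x) r))))).
  apply: measurable_or.
    by apply: measurable_and; [exact: mf|exact: measurable_cst].
  by apply: measurable_and; [apply: measurable_neg; exact: mf|exact: IH].
by apply/funext => x; case: (f x i); rewrite ?orbF.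
Qed.

Lemma event_bool (f : Env -> bool) : measurable_fun setT f -> event [set x | f x].
Proof.
move=> mf; rewrite eventE; have := mf measurableT [set true] I.
by rewrite setTI; congr (measurable _); apply/seteqP; split => x /=.
Qed.

Lemma event_geo L z v (Q : pred (seq (dir d))) : event [set x | Q (geo G x L z v)].
Proof.
apply: event_bool.
apply: (@measurable_nth_find _ [::] (cand L v) (fun x => best G x L z v) Q) => c.
by apply: measurable_all => c'; exact: measurable_better.
Qed.

Definition has_optimal (x : K -> R) u w (Q : pred nat) := exists c,
  [/\ vend u c = w, Q (size c) &
      forall c', vend u c' = w -> time G x u c <= time G x u c'].

Lemma event_has_optimal u w Q : event [set x | has_optimal x u w Q].
Proof.
rewrite eventE.
have -> : [set x | has_optimal x u w Q] =
    \bigcup_(c in [set: seq (dir d)]) \bigcap_(c' in [set: seq (dir d)])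
      ([set x | (vend u c == w) && Q (size c) &&
        ((vend u c' == w) ==> (time G x u c <= time G x u c'))] : set Env).
  apply/seteqP; split => [x /= [c [cw Qc h]]|x [c _ h]].
    exists c => // c' _ /=; rewrite cw eqxx Qc /=; apply/implyP => /eqP; exact: h.
  have /= /andP[/andP[/eqP cw Qc] _] := h c I; exists c; split => // c' /eqP c'w.
  by have /= /andP[_] := h c' I; rewrite c'w.
apply: countable_bigcupT_measurable => [|c]; first exact: (@countableP (seq ('I_d * bool))).
have mI c' : measurable ([set x | (vend u c == w) && Q (size c) &&
        ((vend u c' == w) ==> (time G x u c <= time G x u c'))] : set Env).
  rewrite -eventE; apply: event_bool; apply: measurable_and; first exact: measurable_cst.
  rewrite (_ : (fun x => _) = (fun x : Env => (vend u c' != w) || (time G x u c <= time G x u c'))).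
    apply: measurable_or; first exact: measurable_cst.
    by apply: measurable_fun_ler; exact: measurable_time.
  by apply/funext => x; rewrite implybE.
rewrite -[X in measurable X]setCK setC_bigcap; apply: measurableC.
apply: countable_bigcupT_measurable => [|c']; first exact: (@countableP (seq ('I_d * bool))).
exact: measurableC.
Qed.

Context {disp : measure_display} {T : measurableType disp}.
Context (t : K -> T -> R).
Hypothesis t_meas : forall k, measurable_fun setT (t k).

Lemma event_pullback (A : set (K -> R)) : event A ->
  measurable [set w | A (fun k => t k w)].
Proof.
rewrite eventE => mA.
suff : measurable_fun setT ((fun w => (fun k => t k w)) : T -> Env).
  by move=> /(_ measurableT A mA); rewrite setTI.
apply: (@measurability _ _ T Env setT (fun w => (fun k => t k w)) env_gen) => //.
move=> _ [_ [k [B [mB ->]]] <-]; rewrite setTI /=.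
by have := t_meas k measurableT mB; rewrite setTI.
Qed.

Definition inf_time (x : K -> R) z w := inf [set time G x z c | c in [set c | vend z c = w]].

Lemma inf_time_lt (x : K -> R) z w (a : R) : (forall k, 0 <= x k) ->
  (inf_time x z w < a) <-> exists2 c, vend z c = w & time G x z c < a.
Proof.
move=> x0; have [c0 [c0w _]] := straight_code z w.
have lb : has_lbound [set time G x z c | c in [set c | vend z c = w]].
  by exists 0 => _ [c _ <-]; exact: time_ge0.
have hi : has_inf [set time G x z c | c in [set c | vend z c = w]].
  by split => //; exists (time G x z c0), c0.
split => [h|[c cw h]].
  have [_ [c cw <-] hc] := inf_lt hi.1 h; by exists c.
by apply: le_lt_trans h; apply: ge_inf => //; exists c.
Qed.

(** Paths have countably many codes. *)
Lemma measurable_inf_time z w : (forall k om, 0 <= t k om) ->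
  measurable_fun setT (fun om => inf_time (fun k => t k om) z w).
Proof.
move=> t0; apply: (measurability _ (RGenInftyO.measurableE R)) => //.
move=> _ [_ [a ->] <-]; rewrite setTI.
have -> : (fun om => inf_time (fun k => t k om) z w) @^-1` `]-oo, a[%classic =
   \bigcup_(c in [set: seq (dir d)]) [set om |
     (vend z c == w) && (time G (fun k => t k om) z c < a)].
  apply/seteqP; split => [om|om [c _ /= /andP[/eqP cw h]]].
    rewrite /= in_itv /= => /(inf_time_lt _ _ _ (t0^~ om)) [c /eqP cw h].
    by exists c => //=; rewrite cw.
  by rewrite /= in_itv /=; apply/(inf_time_lt _ _ _ (t0^~ om)); exists c.
apply: countable_bigcupT_measurable => [|c]; first exact: (@countableP (seq ('I_d * bool))).
apply: (event_pullback (A := [set x | (vend z c == w) && (time G x z c < a)])).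
apply: event_bool; apply: measurable_and; first exact: measurable_cst.
by apply: measurable_fun_ltr; [exact: measurable_time|exact: measurable_cst].
Qed.

End EnvironmentEvents.

(** * Visits of an optimal path to a cube *)

Section LocalGeometry.
Context {R : realType} {d : nat} {K : eqType} {dist : K -> K -> R}
  {shift : site d -> K -> K} (G : keying dist shift).
Implicit Types (z y u w v : site d) (c : seq (dir d)).

Lemma nth_verts z c i : (i <= size c)%N -> nth 0 (verts z c) i = vend z (take i c).
Proof.
elim: c z i => [|a c IH] z [|i] //= ic; by rewrite -IH.
Qed.

Lemma lattice_ivt_decreasing z c y r :
  (l1norm (vend z c - y) <= r <= l1norm (z - y))%N ->
  exists c1 c2, c = c1 ++ c2 /\ l1norm (vend z c1 - y) = r.
Proof.
elim: c z => [|a c IH] z /=.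
  by move=> h; exists [::], [::]; split => //; apply/eqP; rewrite eqn_leq.
case/andP => rc; rewrite leq_eqVlt => /predU1P[->|rz].
  by exists [::], (a :: c).
have [|c1 [c2 [-> h]]] := IH (z + dvec a); last by exists (a :: c1), c2.
rewrite rc /= -ltnS; apply: leq_trans rz _.
have -> : z - y = (z + dvec a - y) - dvec a by rewrite [in RHS]addrAC addrK.
by apply: leq_trans (l1normD _ _) _; rewrite l1normN l1norm_dvec addn1.
Qed.

Lemma size_uniq_spread (s : seq nat) N : uniq s ->
  (forall i j, i \in s -> j \in s -> (i <= j)%N -> (j - i <= N)%N) ->
  (size s <= N.+1)%N.
Proof.
case: s => // i0 s us h.
have ex : exists n, n \in i0 :: s by exists i0; exact: mem_head.
case: (ex_minnP ex) => a a_in amin.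
rewrite -(size_iota a N.+1); apply: uniq_leq_size => // j j_in.
by rewrite mem_iota amin //=; have := h a j a_in j_in (amin j j_in); lia.
Qed.

Variable c1 : R.
Variable N1 : nat.
Hypothesis c1_le : c1 <= N1%:R.

Definition short_optimal (x : K -> R) u w :=
  has_optimal G x u w (fun n => n.+1%:R <= c1 * (l1norm (u - w))%:R).

Lemma short_optimalP x u w : short_optimal x u w -> exists c,
  [/\ vend u c = w, (size c <= N1 * l1norm (u - w))%N &
      forall c', vend u c' = w -> time G x u c <= time G x u c'].
Proof.
move=> [c [cw cs h]]; exists c; split => //.
rewrite -(ler_nat R) natrM; apply: le_trans (_ : (size c).+1%:R <= _).
  by rewrite ler_nat.
by apply: le_trans cs _; rewrite ler_wpM2r.
Qed.

Lemma geo_segment_short x L v e1 e2 e3 : (l1norm v <= L)%N ->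
  geo G x L 0 v = e1 ++ e2 ++ e3 ->
  short_optimal x (vend 0 e1) (vend (vend 0 e1) e2) ->
  (size e2 <= N1 * l1norm (vend (vend 0 e1) e2 - vend 0%R e1))%N.
Proof.
move=> vL gE /short_optimalP[c [cw cs h]]; rewrite l1normB; apply: leq_trans cs.
apply: (geo_segment vL gE cw).
by have := h e2 erefl; rewrite /time lerD2l.
Qed.

Variables (m L : nat) (v : site d).
Hypothesis vL : (l1norm v <= L)%N.
Hypothesis v_far : (3 * (d * m) <= l1norm v)%N.

(** Two visits to a cube may be too close to each other for a short optimal path
between them to be likely. But one of the ends of the selected path lies at
distance at least [d * m] from one of the two visits; prolonging the excursion up
to that distance produces a segment whose ends are far apart. *)
Lemma excursion_short x y i j : (i <= j <= size (geo G x L 0 v))%N ->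
  let V := verts 0 (geo G x L 0 v) in
  (forall w u, y - w \in cube m -> l1norm (u - w) = (d * m)%N ->
    short_optimal x u w /\ short_optimal x w u) ->
  y - nth 0 V i \in cube m -> y - nth 0 V j \in cube m ->
  (j - i <= N1 * (d * m))%N.
Proof.
set c := geo G x L 0 v => /andP[ij jc] V good.
rewrite /V !nth_verts ?(leq_trans ij) // => iy jy.
have ve : vend 0 c = v by rewrite /c vend_geo // add0r.
set ui := vend 0 (take i c) in iy *; set uj := vend 0 (take j c) in jy *.
pose mid := drop i (take j c).
have takeE : take j c = take i c ++ mid.
  by rewrite -[LHS](cat_take_drop i) take_takel.
have smid : size mid = (j - i)%N by rewrite size_drop size_takel.
have mE : vend ui mid = uj by rewrite /ui /uj takeE vend_cat.
have dij : (l1norm (uj - ui) <= d * m)%N.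
  have := cube_diff iy jy.
  by rewrite opprB addrC addrA subrK.
have cE : c = take i c ++ mid ++ drop j c by rewrite catA -takeE cat_take_drop.
have far : (d * m <= l1norm (v - ui))%N \/ (d * m <= l1norm (0 - uj))%N.
  have := l1norm_triangle ui v 0; have := l1norm_triangle uj ui 0.
  rewrite [l1norm (0 - uj)]l1normB !subr0 (l1normB ui uj).
  by move: v_far dij; case: (leqP (d * m) (l1norm (v - ui))); [left|right]; lia.
case: far => far.
  have [|e1 [e2 [eE eR]]] := @lattice_ivt _ uj (drop j c) ui (d * m).
    by rewrite dij /uj -vend_cat cat_take_drop ve.
  have gE : geo G x L 0 v = take i c ++ (mid ++ e1) ++ e2.
    by rewrite -/c {1}cE eE -!catA.
  have eR' : l1norm (vend ui (mid ++ e1) - ui) = (d * m)%N by rewrite vend_cat mE.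
  have [_ so] := good ui (vend ui (mid ++ e1)) iy eR'.
  have := geo_segment_short vL gE so; rewrite -/ui eR'.
  by apply: leq_trans; rewrite size_cat smid leq_addr.
have [|e1 [e2 [eE eR]]] := @lattice_ivt_decreasing 0 (take i c) uj (d * m).
  by rewrite far andbT -/ui l1normB.
have gE : geo G x L 0 v = e1 ++ (e2 ++ mid) ++ drop j c.
  by rewrite -/c {1}cE eE -!catA.
have mE' : vend (vend 0 e1) (e2 ++ mid) = uj.
  by rewrite vend_cat -(vend_cat 0) -eE.
have [so _] := good uj (vend 0 e1) jy eR; rewrite -mE' in so.
have := geo_segment_short vL gE so; rewrite mE' l1normB eR.
by apply: leq_trans; rewrite size_cat smid leq_addl.
Qed.

Lemma local_visits x y : (forall k, 0 <= x k) ->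
  (forall w u, y - w \in cube m -> l1norm (u - w) = (d * m)%N ->
    short_optimal x u w /\ short_optimal x w u) ->
  (count (fun z => (y - z)%R \in verts 0%R (geo G x L 0 v)) (cube m) <= (N1 * (d * m)).+1)%N.
Proof.
move=> x0 good; set V := verts 0 (geo G x L 0 v).
have uV : uniq V by exact: geo_uniq.
pose s := [seq index (y - z) V | z <- cube m & (y - z) \in V].
rewrite -size_filter -(size_map (fun z => index (y - z) V)).
have mem_s i : i \in s -> (i <= size (geo G x L 0 v))%N /\ y - nth 0 V i \in cube m.
  move=> /mapP[z]; rewrite mem_filter => /andP[zV zc] ->; split.
    by rewrite -ltnS -(size_verts 0) index_mem.
  by rewrite nth_index // opprB addrC subrK.
apply: size_uniq_spread.
  rewrite map_inj_in_uniq ?filter_uniq ?cube_uniq // => z z'.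
  rewrite !mem_filter => /andP[zV _] /andP[z'V _] e.
  have := congr1 (nth 0 V) e; rewrite !nth_index // => /addrI; exact: oppr_inj.
move=> i j /mem_s[_ iy] /mem_s[jc jy] ij.
by apply: (@excursion_short x y i j) => //; rewrite ij.
Qed.

End LocalGeometry.

Section InfTime.
Context {R : realType} {d : nat} {K : eqType} {dist : K -> K -> R}
  {shift : site d -> K -> K} (G : keying dist shift).
Context (x : K -> R) (b : R).
Hypothesis x_ge0 : forall k, 0 <= x k.
Hypothesis x_le : forall k, x k <= b.
Hypothesis b_ge0 : 0 <= b.
Implicit Types (z y u w v : site d) (c : seq (dir d)).

Lemma inf_time_le z w c : vend z c = w -> inf_time G x z w <= time G x z c.
Proof.
move=> cw; apply: ge_inf; last by exists c.
by exists 0 => _ [c' _ <-]; exact: time_ge0.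
Qed.

Lemma le_inf_time z w (a : R) :
  (forall c, vend z c = w -> a <= time G x z c) -> a <= inf_time G x z w.
Proof.
move=> h; apply: lb_le_inf; last by move=> _ [c cw <-]; exact: h.
by have [c [cw _]] := straight_code z w; exists (time G x z c), c.
Qed.

Lemma inf_time_ge0 z w : 0 <= inf_time G x z w.
Proof. by apply: le_inf_time => c _; exact: time_ge0. Qed.

Lemma inf_time_ub z w : inf_time G x z w <= b * (l1norm (w - z)).+1%:R.
Proof.
have [c [cw cs]] := straight_code z w.
by apply: le_trans (inf_time_le cw) _; rewrite -cs; exact: time_le.
Qed.

(** Straight paths join the old end points to the new ones. *)
Lemma inf_time_lipschitz u w u' w' :
  inf_time G x u w <= inf_time G x u' w' +
    b * (l1norm (u' - u) + l1norm (w - w') + 1)%:R.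
Proof.
rewrite -lerBlDr; apply: le_inf_time => c cw; rewrite lerBlDr.
have [e1 [e1w e1s]] := straight_code u u'; have [e2 [e2w e2s]] := straight_code w' w.
have cat_w : vend u (e1 ++ c ++ e2) = w by rewrite !vend_cat e1w cw e2w.
apply: le_trans (inf_time_le cat_w) _.
rewrite /time !stime_cat e1w cw !natrD mulr1n !mulrDr mulr1.
have h0 := sum_ini_le G u b_ge0 x_le.
have h1 := stime_le G u e1 x_le; have h2 := stime_le G w' e2 x_le.
have h3 : 0 <= \sum_(k <- ini G u') x k by apply: sumr_ge0.
rewrite e1s in h1; rewrite e2s in h2; lra.
Qed.

Lemma ltime_inf_time (c1 : R) N1 L z v : c1 <= N1%:R ->
  (l1norm v <= L)%N -> (N1 * l1norm v <= L)%N ->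
  short_optimal G c1 x z (z + v) -> ltime G x L z v = inf_time G x z (z + v).
Proof.
move=> c1N vL NL /(short_optimalP c1N)[c [cw cs h]].
have [gc _] := geo_best G x z vL.
apply/le_anti/andP; split; last by apply: inf_time_le; exact: cand_vend gc.
apply: le_inf_time => c' cw'; apply: le_trans (h _ cw'); apply: ltime_le.
rewrite mem_cand; apply/andP; split.
  by apply/eqP/(addrI z); rewrite -vendE.
apply: leq_trans cs _; apply: leq_trans NL.
by rewrite opprD addrA subrr sub0r l1normN.
Qed.

End InfTime.

(** * Transfer of variances *)

Section VarianceTransfer.
Context {R : realType} {disp : measure_display} {T : measurableType disp}
  (P : probability T R).

Lemma bounded_Lfun1 (Y : T -> R) (M : R) : measurable_fun setT Y ->
  (forall w, `|Y w| <= M) -> Y \in Lfun P 1.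
Proof.
move=> mY YM; apply/Lfun1_integrable; apply: measurable_bounded_integrable => //.
  by apply: le_lt_trans (probability_le1 P _) _; rewrite ?ltry.
by exists M; split; [exact: num_real|move=> M' MM' w _; exact: le_trans (YM w) (ltW MM')].
Qed.

(** Shifting [Z] by [c] does not change its variance, and a variance is at most
the second moment. *)
Lemma variance_le_sqr_dist (Z : T -> R) (c M : R) : measurable_fun setT Z ->
  (forall w, `|Z w| <= M) ->
  ('V_P[Z] <= \int[P]_w ((Z w - c) ^+ 2)%:E)%E.
Proof.
move=> mZ ZM.
have Z1 : Z \in Lfun P 1 by exact: bounded_Lfun1 ZM.
have mY : measurable_fun setT (Z \- cst c) by apply: measurable_funB.
have YM w : `|(Z \- cst c) w| <= M + `|c|.
  by apply: le_trans (ler_normB _ _) _; rewrite lerD2r.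
have Y1 : Z \- cst c \in Lfun P 1 by exact: bounded_Lfun1 YM.
have YY1 : (Z \- cst c) * (Z \- cst c) \in Lfun P 1.
  apply: (@bounded_Lfun1 _ ((M + `|c|) ^+ 2)); first exact: measurable_funM.
  by move=> w; rewrite normrM expr2 ler_pM.
have -> : 'V_P[Z] = 'V_P[Z \- cst c].
  rewrite /variance unlock expectationB ?Lfun_cst // expectation_cst.
  rewrite fineB ?expectation_fin_num //=.
  set m := fine _; suff -> : Z \- cst c \- cst (m - c) = Z \- cst m by [].
  by apply/funext => w /=; rewrite opprB addrA subrK.
rewrite /variance covarianceE //.
rewrite [X in (X - _)%E](_ : _ = \int[P]_w (((Z \- cst c) * (Z \- cst c)) w)%:E)%E; last first.
  by rewrite unlock.
apply: (@le_trans _ _ (\int[P]_w (((Z \- cst c) * (Z \- cst c)) w)%:E)%E).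
  by rewrite leeBlDr ?fin_numM ?expectation_fin_num // leeDl // -expe2 sqre_ge0.
by rewrite le_eqVlt; apply/orP; left; apply/eqP; apply: eq_integral => w _; rewrite expr2.
Qed.

Context {S : finType} {I : countType} (X : I -> T -> S) (i0 : I).
Hypothesis iidX : iid P X.
Context (J : {fset I}).
Local Notation p := (law P X i0).
Local Notation Ex := (@Ex R J S p).

Lemma measurable_fun_XJ (f : {ffun J -> S} -> R) :
  measurable_fun setT (fun w => f (XJ X J w)).
Proof.
move=> _ B mB; rewrite setTI.
exact: (measurable_XJ iidX (f @^-1` B)).
Qed.

Lemma variance_approx (Z : T -> R) (F : {ffun J -> S} -> R) (E : set T) (D M : R) :
  measurable_fun setT Z -> measurable E ->
  (forall w, 0 <= Z w <= M) -> (forall x, 0 <= F x <= M) ->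
  (forall w, ~ E w -> `|Z w - F (XJ X J w)| <= D) -> 0 <= D ->
  ('V_P[Z] <= (2 * D ^+ 2 + 2 * M ^+ 2 * pr P E +
     2 * (Ex (fun x => F x ^+ 2) - Ex F ^+ 2))%:E)%E.
Proof.
move=> mZ mE ZM FM ZF D0; pose c := Ex F.
have ZM' w : `|Z w| <= M by have /andP[z0 zM] := ZM w; rewrite ger0_norm.
apply: le_trans (variance_le_sqr_dist c mZ ZM') _.
pose A (k : bool) := if k then setT else E.
pose co (k : bool) : R := if k then 2 * D ^+ 2 else 2 * M ^+ 2.
have co0 k : 0 <= co k by case: k; rewrite mulr_ge0 ?sqr_ge0.
have mA k : measurable (A k) by case: k => /=; [exact: measurableT|exact: mE].
pose f x : R := 2 * (F x - c) ^+ 2.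
have f0 x : 0 <= f x by rewrite mulr_ge0 ?sqr_ge0.
have mco : measurable_fun setT (fun w => \sum_(k <- [:: true; false]) co k * \1_(A k) w : R).
  apply: measurable_sum => k; apply: measurable_funM => //; exact: measurable_indic.
have co_ge0 w : 0 <= \sum_(k <- [:: true; false]) co k * \1_(A k) w.
  by apply: sumr_ge0 => k _; rewrite mulr_ge0.
have -> : 2 * D ^+ 2 + 2 * M ^+ 2 * pr P E + 2 * (Ex (fun x => F x ^+ 2) - Ex F ^+ 2) =
    \sum_(k <- [:: true; false]) co k * pr P (A k) + Ex f.
  rewrite !big_cons big_nil addr0 /= /pr probability_setT mulr1.
  congr (_ + _); rewrite /f ExZ; congr (2 * _).
  transitivity (Ex (fun x => F x ^+ 2 - (2 * c * F x - c ^+ 2))).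
    by rewrite !ExB ExZ (Ex_cst (law_sum1 i0 iidX)) -/c; ring.
  by apply: eq_Ex => x; ring.
rewrite EFinD -integral_weighted_indic // -(integral_XJ i0 iidX) //.
rewrite -ge0_integralD //; first last.
- by apply/measurable_EFinP; exact: measurable_fun_XJ.
- by move=> w _; rewrite lee_fin.
- exact/measurable_EFinP.
- by move=> w _; rewrite lee_fin.
apply: ge0_le_integral => //.
- by move=> w _; rewrite lee_fin sqr_ge0.
- apply/measurable_EFinP; apply: measurable_funX; exact: measurable_funB.
- apply: emeasurable_funD; apply/measurable_EFinP => //; exact: measurable_fun_XJ.
move=> w _; rewrite -EFinD lee_fin !big_cons big_nil addr0 /= indicT mulr1 /f.
set y := XJ X J w.
have sq (u u' : R) : (u + u') ^+ 2 <= 2 * u ^+ 2 + 2 * u' ^+ 2.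
  by rewrite -subr_ge0 (_ : _ - _ = (u - u') ^+ 2) ?sqr_ge0 //; ring.
have -> : Z w - c = (Z w - F y) + (F y - c) by rewrite addrA subrK.
apply: le_trans (sq _ _) _; rewrite lerD2r -[2 * M ^+ 2 * _]mulrA -mulrDr ler_wpM2l //.
rewrite -[leLHS]real_normK ?num_real // indicE.
have [Ew|Ew] := pselect (E w); last first.
  by rewrite memNset // mulr0 addr0 ler_sqr ?nnegrE //; exact: ZF.
rewrite mem_set // mulr1; apply: (@le_trans _ _ (M ^+ 2)); last by rewrite lerDr sqr_ge0.
have /andP[z0 zM] := ZM w; have /andP[F0 F1] := FM y.
by rewrite ler_sqr ?nnegrE ?(le_trans z0 zM) // ler_norml; lra.
Qed.

End VarianceTransfer.

(** * The finite model *)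

Section FiniteModel.
Context {R : realType} {d : nat} {K : eqType} {dist : K -> K -> R}
  {shift : site d -> K -> K} (G : keying dist shift).
Context {disp : measure_display} {T : measurableType disp} (P : probability T R).
Context (t : K -> T -> R) (b : R) {S : finType} {I : countType}
  (X : I -> T -> S) (g : K -> (I -> S) -> R) (iseq : K -> nat -> I)
  (i0 : I) (s0 : S).
Hypothesis iidX : iid P X.
Hypothesis t_meas : forall k, measurable_fun setT (t k).
Hypothesis t_bound : forall k w, 0 <= t k w <= b.
Hypothesis b_ge0 : 0 <= b.
Hypothesis t_rep : forall k w, t k w = g k (fun i => X i w).
Context (q0 : nat -> R).
Hypothesis q0_ge0 : forall n, 0 <= q0 n.

Definition det k n (x : I -> S) : Prop :=
  determines (restr (first_indices (iseq k) n) x) (g k).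

Hypothesis det_tail : forall k n, pr P [set w | ~ det k n (fun i => X i w)] <= q0 n.
Context (a0 : nat).
Hypothesis far_disj : forall k k' n i, (a0 * n)%:R < dist k k' ->
  i \in first_indices (iseq k) n -> i \notin first_indices (iseq k') n.
Hypothesis stationary : cond_iii P shift t.

Lemma restrP (V : {fset I}) (x x' : I -> S) :
  restr V x = restr V x' <-> (forall i, i \in V -> x i = x' i).
Proof.
split => [/ffunP h i iV|h]; first by have := h [` iV]%fset; rewrite !ffunE.
by apply/ffunP => j; rewrite !ffunE; apply: h; exact: valP.
Qed.

Lemma mem_first_indices k n i :
  i \in first_indices (iseq k) n <-> exists2 j, (j < n)%N & i = iseq k j.
Proof.
split => [/imfsetP[j /=]|[j jn ->]].
  by rewrite mem_iota add0n => jn ->; exists j.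
by apply/imfsetP; exists j => //=; rewrite mem_iota add0n.
Qed.

Lemma first_indices_mono k n n' i : (n <= n')%N ->
  i \in first_indices (iseq k) n -> i \in first_indices (iseq k) n'.
Proof.
move=> nn' /mem_first_indices[j jn ->]; apply/mem_first_indices.
by exists j => //; exact: leq_trans nn'.
Qed.

Lemma det_mono k n n' x : (n <= n')%N -> det k n x -> det k n' x.
Proof.
move=> nn' h x1 x2 /restrP h1 /restrP h2; apply: h; apply/restrP => i iV.
  by apply: h1; exact: first_indices_mono iV.
by apply: h2; exact: first_indices_mono iV.
Qed.

Lemma det_agree k n x x' : det k n x ->
  (forall i, i \in first_indices (iseq k) n -> x' i = x i) ->
  det k n x' /\ g k x' = g k x.
Proof.
move=> h /restrP e; split; first by rewrite /det e.
exact: h.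
Qed.

Lemma measurable_undet k n : measurable [set w | ~ det k n (fun i => X i w)].
Proof.
exact: (measurable_XJ iidX (J := first_indices (iseq k) n)
  [set y | ~ determines y (g k)]).
Qed.

Context (m L k0 : nat) (v : site d).

Definition domain : seq (site d) := box 0 (L + d * m).
Definition domain_keys : seq K := flatten [seq near G y | y <- domain].
Definition coords : {fset I} :=
  seq_fset tt (flatten [seq [seq iseq k j | j <- iota 0 k0] | k <- domain_keys]).

Local Notation J := coords.
Local Notation Om := {ffun J -> S}.
Local Notation p := (law P X i0).
Local Notation Ex := (@Ex R J S p).

Lemma mem_coords k n i : k \in domain_keys -> (n <= k0)%N ->
  i \in first_indices (iseq k) n -> i \in J.
Proof.
move=> kD nk /mem_first_indices[j jn ->]; rewrite seq_fsetE.
apply/flatten_mapP; exists k => //; apply: map_f.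
by rewrite mem_iota add0n (leq_trans jn).
Qed.

Lemma mem_domain_keys y k : y \in domain -> k \in near G y -> k \in domain_keys.
Proof. by move=> yD ky; apply/flatten_mapP; exists y. Qed.

Definition ext (x : Om) (i : I) : S := if insub i is Some j then x j else s0.

Lemma ext_XJ w i : i \in J -> ext (XJ X J w) i = X i w.
Proof.
by move=> iJ; rewrite /ext insubT ffunE.
Qed.

Lemma ext_upd x (j : J) s i : i != val j -> ext (upd x j s) i = ext x i.
Proof.
rewrite /ext => ij; case: insubP => // u _ uE; rewrite updE.
by case: eqP => // uj; rewrite -uE uj eqxx in ij.
Qed.

(** An environment carried by finitely many coordinates, which agrees with the
original one on the domain outside of the event [undetermined]. Values are
clamped because [g] is controlled only on configurations that occur. *)
Definition tau (x : Om) (k : K) : R :=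
  if `[< det k k0 (ext x) >] then Num.max 0 (Num.min b (g k (ext x))) else 0.

Definition all_det n (x : Om) y := all (fun k => `[< det k n (ext x) >]) (near G y).

(** How many coordinates of each sequence have to be revealed before the passage
times near [y] are known, truncated at [k0]. *)
Definition radius (x : Om) y : nat := find (fun n => all_det n x y) (iota 0 k0).

Definition reach n y : {set J} :=
  [set j : J | has (fun k => val j \in first_indices (iseq k) n) (near G y)].

Lemma tau_ge0 x k : 0 <= tau x k.
Proof. by rewrite /tau; case: ifP => // _; rewrite le_max lexx. Qed.

Lemma tau_le x k : tau x k <= b.
Proof. by rewrite /tau; case: ifP => // _; rewrite ge_max b_ge0 ge_min lexx. Qed.

Lemma radius_le x y : (radius x y <= k0)%N.
Proof. by rewrite -[leqRHS](size_iota 0) find_size. Qed.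

Lemma lt_radius n x y : (n < radius x y)%N = (n < k0)%N && ~~ all_det n x y.
Proof.
apply/idP/andP => [nr|[nk nd]].
  have nk : (n < k0)%N by apply: leq_trans nr (radius_le x y).
  by split => //; have := before_find 0%N nr; rewrite nth_iota // add0n => ->.
rewrite ltnNge; apply: contra nd => rn.
have rk : (radius x y < k0)%N by exact: leq_ltn_trans nk.
have : all_det (radius x y) x y.
  have := @nth_find _ 0%N (fun n => all_det n x y) (iota 0 k0).
  by rewrite has_find size_iota -/(radius x y) => /(_ rk); rewrite nth_iota ?add0n.
move=> /allP h; apply/allP => k /h /asboolP hd; apply/asboolP.
exact: det_mono hd.
Qed.

Lemma reachP n y (j : J) : reflect
  (exists2 k, k \in near G y & val j \in first_indices (iseq k) n) (j \in reach n y).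
Proof. by rewrite inE; exact: hasP. Qed.

Lemma reach_mono n n' y : (n <= n')%N -> reach n y \subset reach n' y.
Proof.
move=> nn'; apply/fintype.subsetP => j /reachP[k ky ki]; apply/reachP.
by exists k => //; exact: first_indices_mono ki.
Qed.

Lemma reach_card n y : (#|reach n y| <= (2 * d + 1) * n)%N.
Proof.
rewrite cardE -(size_map val).
apply: (@leq_trans (size (flatten [seq [seq iseq k j | j <- iota 0 n] | k <- near G y]))).
  apply: uniq_leq_size; first by rewrite map_inj_uniq ?enum_uniq //; exact: val_inj.
  move=> i /mapP[j]; rewrite mem_enum => /reachP[k ky /mem_first_indices[j' jn ->]] ->.
  by apply/flatten_mapP; exists k => //; apply: map_f; rewrite mem_iota add0n.
apply: (@leq_trans (size (near G y) * n)); last by rewrite leq_mul2r size_near orbT.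
elim: (near G y) => //= k s IH; by rewrite size_cat size_map size_iota mulSn leq_add2l.
Qed.

Lemma reach_disj n y y' (j : J) : (a0 * n + 2 < l1norm (y - y'))%N ->
  j \in reach n y -> j \notin reach n y'.
Proof.
move=> yy' /reachP[k ky kj]; apply/negP => /reachP[k' ky' kj'].
have : (a0 * n)%:R < dist k k'.
  have := near_dist ky ky'; move: yy'; rewrite -(ltr_nat R) natrD; lra.
by move=> /far_disj/(_ kj); rewrite kj'.
Qed.

Lemma all_det_upd n x y (j : J) s : j \notin reach n y ->
  all_det n (upd x j s) y = all_det n x y.
Proof.
move=> jn; apply: eq_in_all => k ky; apply/asboolP/asboolP => h.
  apply: (det_agree h _).1 => i ik; rewrite ext_upd //.
  by apply: contraNneq jn => e; apply/reachP; exists k => //; rewrite -e.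
apply: (det_agree h _).1 => i ik; rewrite ext_upd //.
by apply: contraNneq jn => e; apply/reachP; exists k => //; rewrite -e.
Qed.

Lemma radius_upd n y (j : J) x s : j \notin reach n y ->
  (n < radius (upd x j s) y)%N = (n < radius x y)%N.
Proof. by move=> jn; rewrite !lt_radius all_det_upd. Qed.

Lemma tau_upd x (j : J) s y k : j \notin reach (radius x y) y -> k \in near G y ->
  tau (upd x j s) k = tau x k.
Proof.
move=> jr ky; set n := radius x y in jr.
have agree i : i \in first_indices (iseq k) n -> ext (upd x j s) i = ext x i.
  move=> ik; rewrite ext_upd //.
  by apply: contraNneq jr => e; apply/reachP; exists k => //; rewrite -e.
rewrite /tau; have [nk|kn] := ltnP n k0.
  have : all_det n x y.
    by apply/negPn/negP => nd; have := lt_radius n x y; rewrite nk nd ltnn.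
  move=> /allP/(_ k ky)/asboolP dx; have [dx' ->] := det_agree dx agree.
  by rewrite !asboolT //; apply: det_mono (ltnW nk) _.
have nk : n = k0 by apply/eqP; rewrite eqn_leq radius_le.
rewrite nk in agree.
case: asboolP => [dx'|ndx'].
  have agree' i : i \in first_indices (iseq k) k0 -> ext x i = ext (upd x j s) i.
    by move=> ik; rewrite agree.
  by have [dx ->] := det_agree dx' agree'; rewrite asboolT.
by rewrite asboolF // => dx; apply: ndx'; exact: (det_agree dx agree).1.
Qed.

Lemma det_ext_XJ k n w : k \in domain_keys -> (n <= k0)%N ->
  det k n (fun i => X i w) <-> det k n (ext (XJ X J w)).
Proof.
move=> kD nk; split => h; apply: (det_agree h _).1 => i ik.
  by rewrite ext_XJ //; exact: mem_coords ik.
by rewrite ext_XJ //; exact: mem_coords ik.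
Qed.

Lemma radius_tail n y : y \in domain ->
  Ex (fun x => (n < radius x y)%N%:R) <= (2 * d + 1)%:R * q0 n.
Proof.
move=> yD.
rewrite -(pr_XJ i0 iidX (fun x : Om => (n < radius x y)%N)).
apply: (@le_trans _ _ (\sum_(k <- near G y) q0 n)); last first.
  rewrite big_const_seq count_predT iter_addr_0 -[_ *+ _]mulr_natl.
  by rewrite ler_wpM2r ?ler_nat ?size_near.
apply: (@le_trans _ _ (\sum_(k <- near G y) pr P [set w | ~ det k n (fun i => X i w)])).
  apply: pr_union_le.
  - by move=> k; exact: measurable_undet.
  - exact: (measurable_XJ iidX [set x : Om | (n < radius x y)%N]).
  move=> w /=; rewrite lt_radius => /andP[nk /allPn[k ky /asboolPn nd]].
  exists k => // /det_ext_XJ h; apply: nd; apply: h (ltnW nk).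
  exact: mem_domain_keys ky.
by apply: ler_sum => k _; exact: det_tail.
Qed.

Definition undetermined : set T :=
  [set w | exists2 k, k \in domain_keys & ~ det k k0 (fun i => X i w)].

Lemma measurable_undetermined : measurable undetermined.
Proof.
have -> : undetermined =
    \bigcup_(k in [set` domain_keys]) [set w | ~ det k k0 (fun i => X i w)].
  by apply/seteqP; split => [w [k kD nd]|w [k kD nd]]; exists k.
apply: fin_bigcup_measurable; first exact: finite_seq.
by move=> k _; exact: measurable_undet.
Qed.

Lemma pr_undetermined : pr P undetermined <= (size domain_keys)%:R * q0 k0.
Proof.
apply: (@le_trans _ _ (\sum_(k <- domain_keys) pr P [set w | ~ det k k0 (fun i => X i w)])).
  apply: pr_union_le.
  - by move=> k; exact: measurable_undet.
  - exact: measurable_undetermined.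
  by move=> w [k kD nd]; exists k.
apply: (@le_trans _ _ (\sum_(k <- domain_keys) q0 k0)).
  by apply: ler_sum => k _; exact: det_tail.
by rewrite big_const_seq count_predT iter_addr_0 -[_ *+ _]mulr_natl.
Qed.

Lemma tau_XJ w k : ~ undetermined w -> k \in domain_keys ->
  tau (XJ X J w) k = t k w.
Proof.
move=> nu kD; have dw : det k k0 (fun i => X i w).
  by apply: contrapT => nd; apply: nu; exists k.
have agree i : i \in first_indices (iseq k) k0 -> ext (XJ X J w) i = X i w.
  by move=> ik; rewrite ext_XJ //; exact: mem_coords ik.
have [dx gE] := det_agree dw agree.
have /andP[t0 tb] := t_bound k w; rewrite /tau asboolT // gE -t_rep.
by rewrite min_r // max_r.
Qed.


Hypothesis d_gt0 : (0 < d)%N.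
Hypothesis m_gt0 : (0 < m)%N.
Hypothesis L_gt0 : (0 < L)%N.
Hypothesis vL : (l1norm v <= L)%N.

Local Notation visited z x := (verts z (geo G (tau x) L z v)).
Local Notation hit z i x := (hits reach radius z (fun x => geo G (tau x) L z v) i x).
Local Notation env w := (fun k => t k w).

Lemma domain_ball z y : z \in cube m -> (l1norm (y - z) <= L)%N -> y \in domain.
Proof.
move=> zc yz; apply: mem_box; apply: leq_trans (l1norm_triangle z _ _) _.
by rewrite subr0 leq_add // cube_l1norm.
Qed.

Lemma geo_tau_XJ w z : ~ undetermined w -> z \in cube m ->
  geo G (tau (XJ X J w)) L z v = geo G (env w) L z v.
Proof.
move=> nu zc; apply: eq_geo => y k yz ky; apply: tau_XJ => //.
by apply: mem_domain_keys ky; exact: domain_ball yz.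
Qed.

Lemma ltime_tau_XJ w z : ~ undetermined w -> z \in cube m ->
  ltime G (tau (XJ X J w)) L z v = ltime G (env w) L z v.
Proof.
move=> nu zc; apply: eq_ltime => // y k yz ky; apply: tau_XJ => //.
by apply: mem_domain_keys ky; exact: domain_ball yz.
Qed.

Lemma hit_le n z i x : z \in cube m ->
  (hit z i x)%:R <= \sum_(y <- domain | i \in reach n y) (y \in visited z x)%:R +
    \sum_(y <- domain) (n < radius x y)%N%:R :> R.
Proof.
move=> zc.
have -> : \sum_(y <- domain) (n < radius x y)%N%:R =
    (count (fun y => n < radius x y)%N domain)%:R :> R.
  by rewrite -sum1_count [in RHS]big_mkcond natr_sum; apply: eq_bigr => y _; case: ltnP.
have -> : \sum_(y <- domain | i \in reach n y) (y \in visited z x)%:R =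
    (count (fun y => (i \in reach n y) && (y \in visited z x)) domain)%:R :> R.
  rewrite -sum1_count [in RHS]big_mkcondr natr_sum.
  by apply: eq_bigr => y _; case: (y \in _).
rewrite -natrD ler_nat /hits.
apply: leq_trans (_ : count (predU (fun y => (i \in reach n y) && (y \in visited z x))
   (fun y => n < radius x y)%N) domain <= _)%N; last first.
  by rewrite count_predUI leq_addr || rewrite -count_predUI leq_addr.
apply: (@leq_trans (count (fun y => (y \in visited z x) &&
    (i \in reach (radius x y) y)) (visited z x))).
  by rewrite leq_eqVlt; apply/orP; left; apply/eqP; apply: eq_in_count => y ->.
apply: leq_trans (count_uniq_sub (t := domain) _ _) _.
- exact: geo_uniq (tau_ge0 x).
- by move=> y yv _; apply: domain_ball zc _; exact: geo_trail_near vL yv.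
apply: sub_count => y /andP[yv iy] /=.
have [ny|yn] := ltnP n (radius x y); first by rewrite orbT.
by rewrite orbF yv andbT; exact: (fintype.subsetP (reach_mono _ yn)).
Qed.

Context (c1 : R) (N1 : nat) (beta : nat -> R).
Hypothesis c1_le : c1 <= N1%:R.
Hypothesis beta_ge0 : forall n, 0 <= beta n.
Hypothesis not_short : forall u w,
  pr P [set om | ~ short_optimal G c1 (env om) u w] <= beta (l1norm (u - w)).
Hypothesis v_far : (3 * (d * m) <= l1norm v)%N.

Lemma measurable_not_short u w : measurable [set om | ~ short_optimal G c1 (env om) u w].
Proof.
rewrite (_ : [set om | _] = ~` [set om | short_optimal G c1 (env om) u w]) //.
apply: measurableC.
exact: (event_pullback t_meas (event_has_optimal G u w _)).
Qed.

Definition far_pairs y : seq (site d * site d) :=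
  [seq ((y - z)%R, (y - z + o)%R) | z <- cube m, o <- [seq o <- box 0 (d * m) | l1norm o == (d * m)%N]] ++
  [seq ((y - z + o)%R, (y - z)%R) | z <- cube m, o <- [seq o <- box 0 (d * m) | l1norm o == (d * m)%N]].

Definition far_bad y : set T :=
  [set om | exists2 q, q \in far_pairs y & ~ short_optimal G c1 (env om) q.1 q.2].

Lemma far_pairs_dist y q : q \in far_pairs y -> l1norm (q.1 - q.2) = (d * m)%N.
Proof.
rewrite mem_cat => /orP[] /allpairsP[[z o] [_ + ->]] /=;
  rewrite mem_filter => /andP[/eqP oE _].
  by rewrite opprD addrA subrr sub0r l1normN.
by rewrite addrAC subrr add0r.
Qed.

Lemma size_far_pairs y : (size (far_pairs y) <= 2 * (m ^ d * (2 * (d * m)).+1 ^ d))%N.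
Proof.
rewrite size_cat !size_allpairs addnn -mul2n leq_mul2l /= size_cube leq_mul2l.
by rewrite -(size_box (0 : site d)) size_filter count_size orbT.
Qed.

Lemma measurable_far_bad y : measurable (far_bad y).
Proof.
have -> : far_bad y = \bigcup_(q in [set` far_pairs y])
    [set om | ~ short_optimal G c1 (env om) q.1 q.2].
  by apply/seteqP; split => [w [k kD nd]|w [k kD nd]]; exists k.
apply: fin_bigcup_measurable; first exact: finite_seq.
by move=> k _; exact: measurable_not_short.
Qed.

Lemma pr_far_bad y :
  pr P (far_bad y) <= (2 * (m ^ d * (2 * (d * m)).+1 ^ d))%:R * beta (d * m).
Proof.
apply: (@le_trans _ _ (\sum_(q <- far_pairs y)
    pr P [set om | ~ short_optimal G c1 (env om) q.1 q.2])).
  apply: (@pr_union_le _ _ _ P _ _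
    (fun q => [set om | ~ short_optimal G c1 (env om) q.1 q.2])).
  - by move=> q; exact: measurable_not_short.
  - exact: measurable_far_bad.
  by move=> w [k kD nd]; exists k.
apply: (@le_trans _ _ (\sum_(q <- far_pairs y) beta (d * m))).
  rewrite !big_seq; apply: ler_sum => q /far_pairs_dist <-; exact: not_short.
rewrite big_const_seq count_predT iter_addr_0 -[_ *+ _]mulr_natl.
by rewrite ler_wpM2r // ler_nat size_far_pairs.
Qed.

(** [far_pairs y] contains all the pairs that [local_visits] asks about. *)
Lemma far_good y om : ~ far_bad y om -> forall w u, y - w \in cube m ->
  l1norm (u - w) = (d * m)%N ->
  short_optimal G c1 (env om) u w /\ short_optimal G c1 (env om) w u.
Proof.
move=> nb w u wc uw.
have oS : u - w \in [seq o <- box 0 (d * m) | l1norm o == (d * m)%N].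
  by rewrite mem_filter uw eqxx mem_box // subr0 uw.
have w1 : y - (y - w) = w by rewrite opprB addrC subrK.
have w2 : y - (y - w) + (u - w) = u by rewrite w1 addrC subrK.
split; apply: contrapT => h; apply: nb.
  exists (u, w) => //; rewrite mem_cat; apply/orP; right.
  by apply/allpairsP; exists (y - w, u - w); split => //=; rewrite w1 addrC subrK.
exists (w, u) => //; rewrite mem_cat; apply/orP; left.
by apply/allpairsP; exists (y - w, u - w); split => //=; rewrite w1 addrC subrK.
Qed.

(** By stationarity, averaging the probability of visiting a given vertex over
the starting points in a cube counts the visits of one path to a cube. *)
Lemma sum_visits y :
  \sum_(z <- cube m) Ex (fun x => (y \in visited z x)%:R) <=
  (N1 * (d * m)).+1%:R + (m ^ d)%:R * (pr P (far_bad y) + pr P undetermined).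
Proof.
pose A0 z := [set om | (y - z)%R \in verts 0 (geo G (env om) L 0 v)].
have mA0 z : measurable (A0 z).
  exact: (event_pullback t_meas (event_geo G L 0 v (fun c => (y - z)%R \in verts 0 c))).
have one z : z \in cube m ->
    Ex (fun x => (y \in visited z x)%:R) <= pr P (A0 z) + pr P undetermined.
  move=> zc; rewrite -(pr_XJ i0 iidX (fun x : Om => y \in visited z x)).
  pose A1 := [set om | y \in verts z (geo G (env om) L z v)].
  have A1E : A1 = [set om | [set x | (y - z)%R \in verts 0 (geo G x L 0 v)]
      (fun k => t (shift z k) om)].
    apply/seteqP; split => om; rewrite /A1 /=.
      rewrite -{1}[z]add0r vertsD => /mapP[u uv ->]; rewrite addrK.
      by rewrite -[(fun k => _)]/(env om \o shift z) geo_shift add0r.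
    rewrite -[(fun k => t (shift z k) om)]/(env om \o shift z) geo_shift add0r.
    move=> h; rewrite -{1}[z]add0r vertsD; apply/mapP; exists (y - z) => //.
    by rewrite subrK.
  have mA1 : measurable A1.
    exact: (event_pullback t_meas (event_geo G L z v (fun c => y \in verts z c))).
  have -> : pr P (A0 z) = pr P A1.
    rewrite /pr A1E stationary //.
    exact: (event_geo G L 0 v (fun c => (y - z)%R \in verts 0 c)).
  have -> : pr P A1 + pr P undetermined =
      \sum_(k <- [:: true; false]) pr P (if k then A1 else undetermined).
    by rewrite !big_cons big_nil addr0.
  apply: pr_union_le.
  - by case; [exact: mA1|exact: measurable_undetermined].
  - exact: (measurable_XJ iidX [set x : Om | y \in visited z x]).
  move=> w /= h; have [u|nu] := pselect (undetermined w); first by exists false.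
  by exists true => //; rewrite /A1 /= -geo_tau_XJ.
apply: (@le_trans _ _ (\sum_(z <- cube m) (pr P (A0 z) + pr P undetermined))).
  by rewrite !big_seq; apply: ler_sum => z; exact: one.
rewrite big_split /= big_const_seq count_predT iter_addr_0 -[_ *+ _]mulr_natl size_cube.
rewrite mulrDr addrA lerD2r.
have := @sum_pr_le _ _ _ P _ (cube m) A0 (far_bad y) (N1 * (d * m)).+1%:R.
rewrite size_cube; apply => //; first exact: measurable_far_bad.
move=> om nb; have t0 k : 0 <= env om k by case/andP: (t_bound k om).
apply: le_trans (_ : (count (fun z => (y - z)%R \in verts 0%R (geo G (env om) L 0 v)) (cube m))%:R <= _).
  rewrite -sum1_count [in leRHS]big_mkcond natr_sum; apply: ler_sum => z _.
  rewrite indicE /A0; case: ifP => h; first by case: (_ \in _).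
  by rewrite memNset //= h.
rewrite ler_nat; apply: (local_visits c1_le) => //.
exact: far_good.
Qed.

(** A coordinate reaches only the vertices of one ball, unless some radius exceeds
[n]; the sum in parentheses bounds the probability that a given one of them is
visited, averaged over the translates of the end points. *)
Definition influence_bound n : R :=
  (2 * (a0 * n + 2)).+1%:R ^+ d *
    ((N1 * (d * m)).+1%:R / (m ^ d)%:R +
     (2 * (m ^ d * (2 * (d * m)).+1 ^ d))%:R * beta (d * m) +
     (size domain_keys)%:R * q0 k0) +
  (size domain)%:R * ((2 * d + 1)%:R * q0 n).

Lemma influence_bound_ge0 n : 0 <= influence_bound n.
Proof.
rewrite /influence_bound addr_ge0 ?mulr_ge0 ?exprn_ge0 ?addr_ge0 ?mulr_ge0 //.
Qed.

(** The vertices that [i] reaches at level [n] are pairwise close to each other,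
and each of them is rarely visited by [sum_visits]. *)
Lemma small_influence n i :
  (size (cube (d := d) m))%:R^-1 * \sum_(z <- cube m) Ex (fun x => (hit z i x)%:R) <=
  influence_bound n.
Proof.
rewrite size_cube; have M0 : 0 < (m ^ d)%:R :> R by rewrite ltr0n expn_gt0 m_gt0.
set beta1 := (2 * (m ^ d * (2 * (d * m)).+1 ^ d))%:R * beta (d * m).
set beta2 := (size domain_keys)%:R * q0 k0.
set u : R := (N1 * (d * m)).+1%:R.
set U : R := (2 * (a0 * n + 2)).+1%:R ^+ d.
rewrite mulrC ler_pdivrMr // [leRHS]mulrC /influence_bound.
rewrite -/U -/u -/beta1 -/beta2.
have u0 : 0 <= u + (m ^ d)%:R * (beta1 + beta2).
  by rewrite addr_ge0 ?mulr_ge0 // addr_ge0 ?mulr_ge0.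
have -> : (m ^ d)%:R * (U * (u / (m ^ d)%:R + beta1 + beta2) +
    (size domain)%:R * ((2 * d + 1)%:R * q0 n)) =
   U * (u + (m ^ d)%:R * (beta1 + beta2)) +
   (m ^ d)%:R * ((size domain)%:R * ((2 * d + 1)%:R * q0 n)).
  by field; rewrite gt_eqF.
apply: (@le_trans _ _ (\sum_(z <- cube m)
   (\sum_(y <- domain | i \in reach n y) Ex (fun x => (y \in visited z x)%:R) +
    \sum_(y <- domain) Ex (fun x => (n < radius x y)%N%:R)))).
  rewrite big_seq [leRHS]big_seq; apply: ler_sum => z zc; rewrite -!Ex_sum -ExD.
  by apply: (ler_Ex (law_ge0 P X i0)) => x; exact: hit_le.
rewrite big_split /= exchange_big /=; apply: lerD; last first.
  apply: (@le_trans _ _ (\sum_(z <- cube m) (size domain)%:R * ((2 * d + 1)%:R * q0 n))).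
    apply: ler_sum => z _.
    apply: (@le_trans _ _ (\sum_(y <- domain) (2 * d + 1)%:R * q0 n)).
      by rewrite !big_seq; apply: ler_sum => y; exact: radius_tail.
    by rewrite big_const_seq count_predT iter_addr_0 -[_ *+ _]mulr_natl.
  by rewrite big_const_seq count_predT iter_addr_0 -[_ *+ _]mulr_natl size_cube.
apply: (@le_trans _ _ (\sum_(y <- domain | i \in reach n y) (u + (m ^ d)%:R * (beta1 + beta2)))).
  apply: ler_sum => y _; apply: le_trans (sum_visits y) _.
  by rewrite lerD2l ler_wpM2l // lerD ?pr_far_bad ?pr_undetermined.
rewrite big_const_seq iter_addr_0 -[_ *+ _]mulr_natl ler_wpM2r // /U -natrX ler_nat.
rewrite -size_filter; case sE : [seq y <- domain | i \in reach n y] => [//|y0 s].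
rewrite -sE; apply: (size_in_ball (z := y0)); first exact/filter_uniq/box_uniq.
have : y0 \in [seq y <- domain | i \in reach n y] by rewrite sE mem_head.
rewrite mem_filter => /andP[iy0 _] y; rewrite mem_filter => /andP[iy _].
by rewrite leqNgt; apply/negP => /reach_disj/(_ iy); rewrite iy0.
Qed.

Context (Cq p0 : R).
Hypothesis Cq_ge0 : 0 <= Cq.
Hypothesis q0_decay : forall n,
  (2 * d + 1)%:R * q0 n * n.+1%:R ^+ ((2 * d + 4) * d + d + 3) <= Cq.
Hypothesis p0_gt0 : 0 < p0.
Hypothesis p0_le : forall s, p s = 0 \/ p0 <= p s.
Hypothesis N1L : (N1 * l1norm v <= L)%N.

Definition exceptional : set T :=
  undetermined `|` [set om | exists2 z, z \in cube m & ~ short_optimal G c1 (env om) z (z + v)].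

Lemma measurable_exceptional : measurable exceptional.
Proof.
apply: measurableU; first exact: measurable_undetermined.
rewrite (_ : [set om | _] = \bigcup_(z in [set` cube m])
    [set om | ~ short_optimal G c1 (env om) z (z + v)]).
  apply: fin_bigcup_measurable; first exact: finite_seq.
  by move=> k _; exact: measurable_not_short.
by apply/seteqP; split => [w [k kD nd]|w [k kD nd]]; exists k.
Qed.

Lemma pr_exceptional : pr P exceptional <=
  (size domain_keys)%:R * q0 k0 + (m ^ d)%:R * beta (l1norm v).
Proof.
pose A (o : option (site d)) := if o is Some z
  then [set om | ~ short_optimal G c1 (env om) z (z + v)] else undetermined.
apply: (@le_trans _ _ (\sum_(o <- None :: map Some (cube m)) pr P (A o))).
  apply: pr_union_le.
  - by case => [z|]; [exact: measurable_not_short|exact: measurable_undetermined].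
  - exact: measurable_exceptional.
  move=> w [u|[z zc h]]; first by exists None; rewrite ?mem_head.
  by exists (Some z) => //; rewrite inE; apply: map_f.
rewrite big_cons big_map /=; apply: lerD; first exact: pr_undetermined.
apply: (@le_trans _ _ (\sum_(z <- cube (d := d) m) beta (l1norm v))).
  apply: ler_sum => z _; apply: le_trans (not_short _ _) _.
  by rewrite opprD addrA subrr sub0r l1normN.
by rewrite big_const_seq count_predT iter_addr_0 -[_ *+ _]mulr_natl size_cube.
Qed.

(** Outside of an exceptional event, the passage time differs from its average
over translated end points by at most the cost of the translation. *)
Lemma variance_inf_time (lam : R) n : 1 < lam ->
  ('V_P[fun om => inf_time G (env om) 0 v] <=
   (2 * (b * (2 * (d * m) + 1)%:R) ^+ 2 +
    2 * (b * L.+1%:R) ^+ 2 *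
      ((size domain_keys)%:R * q0 k0 + (m ^ d)%:R * beta (l1norm v)) +
    2 * ((8 / p0 + 4 * (lam * influence_bound n)) * b ^+ 2 *
         influence_cst a0 (2 * d + 1) (d := d) Cq * L%:R / ln lam))%:E)%E.
Proof.
move=> lam1; have lam0 : 0 < lam by lra.
have lnlam : 0 < ln lam by rewrite ln_gt0.
pose F : Om -> R := avg_time G tau L v (cube m).
have M0 : 0 < (m ^ d)%:R :> R by rewrite ltr0n expn_gt0 m_gt0.
have avg_cst (a : R) : (size (cube (d := d) m))%:R^-1 * \sum_(z <- cube (d := d) m) a = a.
  rewrite big_const_seq count_predT iter_addr_0 -[a *+ _]mulr_natl size_cube mulKf //.
  by rewrite gt_eqF.
have Z0 : 0 <= (size (cube (d := d) m))%:R^-1 :> R by rewrite invr_ge0.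
have varF := @variance_avg_time R d K dist shift G J S p p0 (law_ge0 P X i0)
  (law_sum1 i0 iidX) p0_gt0 p0_le a0 (2 * d + 1) reach radius
  (fun y => y \in domain) (fun n => (2 * d + 1)%:R * q0 n) Cq k0 d_gt0
  reach_mono reach_card reach_disj radius_upd radius_le
  (fun n => mulr_ge0 (ler0n _ _) (q0_ge0 n)) Cq_ge0 q0_decay radius_tail
  b tau b_ge0 tau_ge0 tau_le tau_upd L v (cube m) L_gt0 vL _ domain_ball
  (influence_bound n) lam lam0 (influence_bound_ge0 n) (small_influence n).
have {}varF : Ex (fun x => F x ^+ 2) - Ex F ^+ 2 <=
    (8 / p0 + 4 * (lam * influence_bound n)) * b ^+ 2 *
         influence_cst a0 (2 * d + 1) (d := d) Cq * L%:R / ln lam.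
  by rewrite ler_pdivlMr //; apply: varF; rewrite size_cube expn_gt0 m_gt0.
have tb k om : 0 <= env om k /\ env om k <= b by apply/andP; exact: t_bound.
have t0 om k : 0 <= env om k := (tb k om).1.
have t1 om k : env om k <= b := (tb k om).2.
have mZ : measurable_fun setT (fun om => inf_time G (env om) 0 v).
  by apply: measurable_inf_time => // k om; exact: t0.
apply: le_trans (@variance_approx _ _ _ P _ _ X i0 iidX J _ F exceptional
    (b * (2 * (d * m) + 1)%:R) (b * L.+1%:R) mZ _ _ _ _ _) _.
- exact: measurable_exceptional.
- move=> om; apply/andP; split; first exact: inf_time_ge0.
  apply: le_trans (inf_time_ub G (t0 om) (t1 om) b_ge0 0 v) _.
  by rewrite ler_wpM2l // ler_nat subr0.
- move=> x; apply/andP; split.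
    by rewrite mulr_ge0 // sumr_ge0 // => z _; exact: (time_ge0 _ _ _ (tau_ge0 x)).
  rewrite -(avg_cst (b * L.+1%:R)) ler_wpM2l //; apply: ler_sum => z _.
  apply: le_trans (time_le G z _ b_ge0 (tau_le x)) _.
  by rewrite ler_wpM2l // ler_nat ltnS size_geo.
- move=> om nE.
  have nu : ~ undetermined om by move=> u; apply: nE; left.
  have sh z : z \in cube m -> short_optimal G c1 (env om) z (z + v).
    by move=> zc; apply: contrapT => h; apply: nE; right; exists z.
  have -> : F (XJ X J om) = (size (cube (d := d) m))%:R^-1 *
      \sum_(z <- cube m) inf_time G (env om) z (z + v).
    rewrite /F /avg_time; congr (_ * _); apply: eq_big_seq => z zc.
    by rewrite ltime_tau_XJ // (ltime_inf_time (t0 om) c1_le vL N1L (sh z zc)).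
  rewrite -{1}(avg_cst (inf_time G (env om) 0 v)) -mulrBr -sumrB.
  rewrite normrM (ger0_norm Z0) -[leRHS]avg_cst ler_wpM2l //.
  apply: le_trans (ler_norm_sum _ _ _) _.
  rewrite !big_seq; apply: ler_sum => z zc.
  have zm := cube_l1norm zc.
  have zb : (l1norm (z - 0) + l1norm (v - (z + v)) + 1 <= 2 * (d * m) + 1)%N.
    have -> : v - (z + v) = - z by rewrite addrC opprD subrK.
    by rewrite subr0 l1normN; lia.
  have zb' : (l1norm (0 - z) + l1norm (z + v - v) + 1 <= 2 * (d * m) + 1)%N.
    by rewrite addrK sub0r l1normN; lia.
  have h1 := inf_time_lipschitz G (t0 om) (t1 om) b_ge0 0 v z (z + v).
  have h2 := inf_time_lipschitz G (t0 om) (t1 om) b_ge0 z (z + v) 0 v.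
  have k1 : b * (l1norm (z - 0) + l1norm (v - (z + v)) + 1)%:R <= b * (2 * (d * m) + 1)%:R.
    by rewrite ler_wpM2l // ler_nat.
  have k2 : b * (l1norm (0 - z) + l1norm (z + v - v) + 1)%:R <= b * (2 * (d * m) + 1)%:R.
    by rewrite ler_wpM2l // ler_nat.
  by rewrite ler_norml; apply/andP; split; lra.
- by rewrite mulr_ge0.
rewrite lee_fin; apply: lerD; last by rewrite ler_wpM2l.
by rewrite lerD2l ler_wpM2l ?mulr_ge0 ?sqr_ge0 // pr_exceptional.
Qed.

End FiniteModel.

(** * Estimates at the chosen scale *)

Section Scales.
Context {R : realType}.

(** Stretched exponentials decay faster than any power; only this consequence of
the tail assumptions is used. *)
Lemma stretched_exp_le (c0 e0 e1 : R) (A : nat) : 0 < c0 -> 0 < e0 -> 0 < e1 ->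
  exists2 C : R, 0 < C & forall k : nat, (0 < k)%N ->
    c0 * expR (- e0 * k%:R `^ e1) <= C / k.+1%:R ^+ A.
Proof.
move=> c00 e00 e10.
have [N NA] : exists N : nat, A%:R / e1 <= N.+1%:R :> R.
  exists (Num.truncn (A%:R / e1)); exact/ltW/truncnS_gt.
have NA' : A%:R <= e1 * N.+1%:R by rewrite mulrC -ler_pdivrMr.
exists (c0 * (N.+1%:R / e0) ^+ N.+1 * 2 ^+ A).
  by rewrite !mulr_gt0 ?exprn_gt0 ?divr_gt0.
move=> k k0; have k1 : 1 <= k%:R :> R by rewrite ler1n.
have kp : 0 < k%:R :> R by rewrite ltr0n.
set u := k%:R `^ e1; have u0 : 0 < u by rewrite powR_gt0.
set n := N.+1; have n0 : 0 < n%:R :> R by rewrite ltr0n.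
have low : (e0 * u / n%:R) ^+ n <= expR (e0 * u).
  rewrite -[X in expR X](@divfK _ n%:R) ?gt_eqF // expRM_natr lerXn2r ?nnegrE ?expR_ge0 //.
    by rewrite divr_ge0 // mulr_ge0 // ltW.
  by apply: le_trans (expR_ge1Dx _); rewrite lerDr.
have ukA : k%:R ^+ A <= u ^+ n.
  rewrite -[u ^+ n]powR_mulrn ?powR_ge0 // -[k%:R ^+ A]powR_mulrn ?ler0n // -powRrM.
  by rewrite ler_powR.
rewrite mulNr expRN ler_pdivlMr ?exprn_gt0 //.
rewrite -!mulrA ler_wpM2l ?(ltW c00) // mulrC ler_pdivrMr ?expR_gt0 //.
apply: (@le_trans _ _ ((n%:R / e0) ^+ n * 2 ^+ A * (e0 * u / n%:R) ^+ n)); last first.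
  by rewrite ler_wpM2l // mulr_ge0 ?exprn_ge0 ?divr_ge0 // ltW.
rewrite mulrAC -exprMn (_ : n%:R / e0 * _ = u); last first.
  by field; rewrite !gt_eqF.
apply: le_trans (_ : k%:R ^+ A * 2 ^+ A <= _); last by rewrite ler_wpM2r ?exprn_ge0.
rewrite -exprMn lerXn2r ?nnegrE ?mulr_ge0 // -natrM ler_nat; lia.
Qed.

Lemma root_bracket (e n : nat) : (0 < e)%N -> (0 < n)%N ->
  exists r, (r ^ e <= n < r.+1 ^ e)%N.
Proof.
move=> e0 n0; have ex : exists r, (n < r.+1 ^ e)%N.
  exists n; apply: (@leq_trans (n.+1 ^ 1)); first by rewrite expn1.
  by rewrite leq_exp2l.
case: (ex_minnP ex) => r hr rmin; exists r; rewrite hr andbT.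
case: r hr rmin => [|r] hr rmin; first by rewrite exp0n.
by rewrite leqNgt; apply/negP => /rmin; rewrite ltnn.
Qed.

(** The first summands pay for the number of vertices of the domain, the bracket
for the sum over the levels in [greedy_polynomial]. *)
Definition decay_exponent (d : nat) := (8 * d * d + d + ((2 * d + 4) * d + d + 3))%N.

Definition influence_scale_cst (d a0 N N1 : nat) (Q Bt : R) : R :=
  (2 * a0 + 5)%:R ^+ d * (N1 * d + 1)%:R +
  2 * (2 * a0 + 5)%:R ^+ d * (2 * d + 1)%:R ^+ d * Bt + 1 +
  (5 * N)%:R ^+ d * (2 * d + 1)%:R * Q.

(** With levels up to [r] and cubes of side [m = r ^ (2 * d)], a coordinate reaches
of the order of [r ^ d] vertices. A path spends of the order of [m] steps in a
cube, that is, at most a fraction [1 / m] of the translates visit a given vertex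
since [d >= 2]. The influence is therefore at most of order [r ^ d / m]. *)
Lemma influence_scale (d a0 N N1 r n D m : nat) (Q Bt x : R) :
  (2 <= d)%N -> (0 < r)%N -> 0 <= Q -> 0 <= Bt ->
  (D <= (5 * (N * n)) ^ d)%N -> (n < r.+1 ^ (8 * d))%N ->
  (2 * (a0 * r + 2)).+1%:R ^+ d * r%:R ^+ d * x <= 1 ->
  m = (r ^ (2 * d))%N ->
  r%:R ^+ d * ((2 * (a0 * r + 2)).+1%:R ^+ d *
    ((N1 * (d * m)).+1%:R / (m ^ d)%:R +
     (2 * (m ^ d * (2 * (d * m)).+1 ^ d))%:R * (Bt / (d * m).+1%:R ^+ (2 * d + 2)) + x) +
  D%:R * ((2 * d + 1)%:R * (Q / r.+1%:R ^+ decay_exponent d))) <=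
  influence_scale_cst d a0 N N1 Q Bt.
Proof.
move=> d2 r0 Q0 Bt0 Dn nr Ux mE.
have m0 : (0 < m)%N by rewrite mE expn_gt0 r0.
set rho : R := r%:R; have rho1 : 1 <= rho by rewrite ler1n.
have rho0 : 0 < rho by lra.
set M : R := m%:R; have ME : M = rho ^+ (2 * d) by rewrite /M mE natrX.
have M1 : 1 <= M by rewrite ME exprn_ege1.
have M0 : 0 < M by lra.
have mdE : (m ^ d)%:R = M ^+ d :> R by rewrite natrX.
set U : R := (2 * (a0 * r + 2)).+1%:R ^+ d in Ux *.
set CU : R := (2 * a0 + 5)%:R ^+ d.
have CU0 : 0 <= CU by rewrite exprn_ge0.
have U0 : 0 <= U by rewrite exprn_ge0.
have UC : U <= CU * rho ^+ d.
  rewrite /U /CU -exprMn lerXn2r ?nnegrE ?mulr_ge0 ?ler0n // -natrM ler_nat mulnDl -mulnA.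
  by move: r0; move: (a0 * r)%N => u; lia.
have rU : rho ^+ d * U <= CU * M.
  apply: (@le_trans _ _ (rho ^+ d * (CU * rho ^+ d))).
    by rewrite ler_wpM2l ?exprn_ge0 // ltW.
  by rewrite mulrCA -exprD ME addnn mul2n.
have rU0 : 0 <= rho ^+ d * U by rewrite mulr_ge0 ?exprn_ge0 // ltW.
have t1 : rho ^+ d * U * ((N1 * (d * m)).+1%:R / (m ^ d)%:R) <= CU * (N1 * d + 1)%:R.
  apply: (@le_trans _ _ (CU * M * ((N1 * d + 1)%:R / M))); last first.
    by rewrite -mulrA [M * _]mulrC divfK // gt_eqF.
  apply: ler_pM => //.
  have h : (N1 * (d * m)).+1%:R <= (N1 * d + 1)%:R * M.
    by rewrite -natrM ler_nat mulnDl mul1n mulnA -addn1 leq_add2l.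
  rewrite mdE ler_pdivrMr ?exprn_gt0 //; apply: le_trans h _.
  rewrite -mulrA ler_wpM2l // mulrC ler_pdivlMr // -expr2.
  by rewrite ler_weXn2l.
have t2 : rho ^+ d * U * ((2 * (m ^ d * (2 * (d * m)).+1 ^ d))%:R *
    (Bt / (d * m).+1%:R ^+ (2 * d + 2))) <= 2 * CU * (2 * d + 1)%:R ^+ d * Bt.
  have h1 : (2 * (m ^ d * (2 * (d * m)).+1 ^ d))%:R <=
      2 * ((2 * d + 1)%:R ^+ d * M ^+ (2 * d)).
    have -> : M ^+ (2 * d) = M ^+ d * M ^+ d by rewrite -exprD addnn mul2n.
    rewrite natrM ler_wpM2l // natrM mdE natrX [leRHS]mulrCA ler_wpM2l ?exprn_ge0 ?(ltW M0) //.
    rewrite -exprMn lerXn2r ?nnegrE ?mulr_ge0 ?(ltW M0) //.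
    by rewrite -natrM ler_nat mulnDl mul1n -mulnA -addn1 leq_add2l.
  have h2 : Bt / (d * m).+1%:R ^+ (2 * d + 2) <= Bt / M ^+ (2 * d + 2).
    rewrite ler_wpM2l // lef_pV2 ?posrE ?exprn_gt0 // lerXn2r ?nnegrE ?(ltW M0) //.
    by rewrite ler_nat (leq_trans _ (leqnSn _)) // leq_pmull // ltnW.
  apply: (@le_trans _ _ (CU * M * (2 * ((2 * d + 1)%:R ^+ d * M ^+ (2 * d)) *
      (Bt / M ^+ (2 * d + 2))))).
    by apply: ler_pM => //; [rewrite mulr_ge0 ?divr_ge0 ?exprn_ge0|apply: ler_pM; rewrite ?divr_ge0 ?exprn_ge0].
  rewrite exprD [leLHS](_ : _ = 2 * CU * (2 * d + 1)%:R ^+ d * Bt * M^-1); last first.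
    move: ((2 * d + 1)%:R ^+ d) (M ^+ (2 * d)) (exprn_gt0 (2 * d) M0) => w1 w2 w20.
    by field; rewrite !gt_eqF.
  rewrite ler_piMr ?invf_le1 //.
  by rewrite !mulr_ge0 ?exprn_ge0.
have t3 : rho ^+ d * U * x <= 1 by rewrite [rho ^+ d * _]mulrC.
have t4 : rho ^+ d * (D%:R * ((2 * d + 1)%:R * (Q / r.+1%:R ^+ decay_exponent d))) <=
    (5 * N)%:R ^+ d * (2 * d + 1)%:R * Q.
  set S1 : R := r.+1%:R; have S11 : 1 <= S1 by rewrite ler1n.
  have S10 : 0 < S1 by lra.
  have hD : D%:R <= (5 * N)%:R ^+ d * S1 ^+ (8 * d * d).
    rewrite exprM -exprMn -natrX -natrM -natrX ler_nat; apply: leq_trans Dn _.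
    by rewrite leq_exp2r ?(ltnW d2) // mulnA leq_mul2l (ltnW nr) orbT.
  have hr : rho ^+ d <= S1 ^+ d.
    by rewrite lerXn2r ?nnegrE ?(ltW rho0) ?(ltW S10) // ler_nat.
  apply: (@le_trans _ _ (S1 ^+ d * ((5 * N)%:R ^+ d * S1 ^+ (8 * d * d) *
      ((2 * d + 1)%:R * (Q / S1 ^+ decay_exponent d))))).
    have q0 : 0 <= (2 * d + 1)%:R * (Q / S1 ^+ decay_exponent d).
      by rewrite mulr_ge0 // divr_ge0 // exprn_ge0 // ltW.
    apply: ler_pM => //; first by rewrite exprn_ge0 // ltW.
      by rewrite mulr_ge0.
    by rewrite ler_wpM2r.
  rewrite /decay_exponent (exprD _ (8 * d * d + d)) (exprD _ (8 * d * d)).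
  set e := ((2 * d + 4) * d + d + 3)%N; have e1 : 1 <= S1 ^+ e by rewrite exprn_ege1.
  have e0 : 0 < S1 ^+ e by lra.
  have a1 : 0 < S1 ^+ d by rewrite exprn_gt0.
  have a2 : 0 < S1 ^+ (8 * d * d) by rewrite exprn_gt0.
  rewrite [leLHS](_ : _ = (5 * N)%:R ^+ d * (2 * d + 1)%:R * Q * (S1 ^+ e)^-1); last first.
    move: (S1 ^+ e) (S1 ^+ d) (S1 ^+ (8 * d * d)) ((5 * N)%:R ^+ d) e0 a1 a2 => w1 w2 w3 w4 *.
    by field; rewrite !gt_eqF.
  rewrite ler_piMr ?invf_le1 //.
  by rewrite !mulr_ge0 ?exprn_ge0.
rewrite /influence_scale_cst -/CU mulrDr mulrA !mulrDr.
by rewrite lerD // lerD // lerD.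
Qed.

Lemma ln_nat_le (n : nat) : ln n%:R <= n%:R :> R.
Proof.
case: n => [|n]; first by rewrite ln0.
have := ln_tangent (ltr0Sn R n) ltr01; rewrite ln1 divr1; lra.
Qed.

End Scales.

(** * Sublinear variance *)

Section SublinearVariance.
Context {R : realType} {d : nat} {K : eqType} {dist : K -> K -> R}
  {shift : site d -> K -> K} (G : keying dist shift).
Context {disp : measure_display} {T : measurableType disp} (P : probability T R).
Context (t : K -> T -> R) (b : R) {S : finType} {I : countType}
  (X : I -> T -> S) (g : K -> (I -> S) -> R) (iseq : K -> nat -> I).
Hypothesis d_ge2 : (2 <= d)%N.
Hypothesis iidX : iid P X.
Hypothesis t_meas : forall k, measurable_fun setT (t k).
Hypothesis t_bound : forall k w, 0 <= t k w <= b.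
Hypothesis b_ge0 : 0 <= b.
Hypothesis t_rep : forall k w, t k w = g k (fun i => X i w).
Hypothesis tailX : cond_i' P X g iseq.
Hypothesis disjX : cond_ii dist iseq.
Hypothesis stationary : cond_iii P shift t.

Local Notation env w := (fun k => t k w).

Lemma determination_tail : exists2 Q : R, 0 < Q & forall k n,
  pr P [set w | ~ det g iseq k n (fun i => X i w)] <= Q / n.+1%:R ^+ decay_exponent d.
Proof.
have [c0 [e0 [e1 [c00 e00 e10 tail]]]] := tailX.
have [C C0 hC] := stretched_exp_le (decay_exponent d) c00 e00 e10.
have mU k n := measurable_undet g iseq iidX k n.
exists (C + 1) => [|k n]; first by lra.
case: n => [|n].
  rewrite expr1n divr1; apply: le_trans (pr_le1 P (mU k 0%N)) _; lra.
have := tail k n.+1 isT; rewrite prE ?lee_fin; last exact: mU.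
move=> /le_trans; apply; apply: le_trans (hC n.+1 isT) _.
by rewrite ler_wpM2r ?invr_ge0 ?exprn_ge0 // lerDl.
Qed.

Lemma far_disjoint : exists a0 : nat, forall k k' n i, (a0 * n)%:R < dist k k' ->
  i \in first_indices (iseq k) n -> i \notin first_indices (iseq k') n.
Proof.
have [al al0 h] := disjX.
exists (Num.truncn al^-1).+1 => k k' [|n] i far.
  by move=> /mem_first_indices[].
move=> ik; apply: (fdisjointP (h k k' n.+1 isT _)) => //.
rewrite mulrC -ltr_pdivrMr //; apply: le_lt_trans far.
rewrite natrM mulrC ler_wpM2r //.
exact/ltW/truncnS_gt.
Qed.

Lemma ln_scale (r n : nat) : (2 <= r)%N -> (0 < n)%N -> (n < r.+1 ^ (8 * d))%N ->
  ln n%:R <= 16 * ln (r%:R ^+ d) :> R.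
Proof.
move=> r2 n0 nr; have r0 : 0 < r%:R :> R by rewrite ltr0n (leq_trans _ r2).
have -> : 16 * ln (r%:R ^+ d) = ln (r%:R ^+ (16 * d)) :> R.
  by rewrite !lnXn // -[RHS]mulr_natl natrM -mulrA -[ln _ *+ d]mulr_natl.
rewrite ler_ln ?posrE ?ltr0n ?exprn_gt0 // -natrX ler_nat (leq_trans (ltnW nr)) //.
rewrite (_ : 16 * d = 2 * (8 * d))%N; last by lia.
rewrite [leqRHS]expnM leq_exp2r; last by rewrite muln_gt0 /= (ltnW d_ge2).
by rewrite -mulnn; nia.
Qed.

(** The level [k0] may depend on all the other parameters. *)
Lemma truncation_level (x th : R) (A : nat) : 0 < th -> (0 < A)%N -> 0 <= x ->
  exists k0 : nat, x / k0.+1%:R ^+ A <= th.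
Proof.
move=> th0 A0 x0; exists (Num.truncn (x / th)).
set k := Num.truncn _; have k1 : 1 <= k.+1%:R :> R by rewrite ler1n.
have kA : k.+1%:R <= k.+1%:R ^+ A :> R by rewrite ler_eXnr.
rewrite ler_pdivrMr ?exprn_gt0 //.
apply: le_trans (_ : th * k.+1%:R <= _); last by rewrite ler_wpM2l // ltW.
rewrite mulrC -ler_pdivrMr //; exact/ltW/truncnS_gt.
Qed.

(** The scale [r] is about the [8 * d]-th root of the distance: the cubes then have
side at most of order [n ^ (1 / 4)], which makes the cost of averaging
negligible, while [lam = r ^ d] is still a power of the distance. *)
Theorem variance_sublinear (c1 c2 c3 : R) : 0 < c2 -> 0 < c3 ->
  (forall u w, (P [set om | ~ short_optimal G c1 (env om) u w] <=
     (c2 * expR (- c3 * (l1norm (u - w))%:R))%:E)%E) ->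
  infinite_set [set: I] ->
  exists2 C : R, 0 < C & forall v : site d, (2 <= l1norm v)%N ->
    ('V_P[fun om => inf_time G (env om) 0 v] <=
      (C * (l1norm v)%:R / ln (l1norm v)%:R)%:E)%E.
Proof.
move=> c20 c30 short /infinite_setN0[i0 _].
have d0 : (0 < d)%N by exact: ltnW d_ge2.
have d8 : ((2 * d).+1 <= 8 * d)%N by move: d0; clear; lia.
have d8' : ((2 * d * 2).+1 <= 8 * d)%N by move: d0; clear; lia.
have d2E : (2 * d + 2 = 2 + d + d)%N by clear; lia.
have five a l : (a <= l)%N -> (0 < l)%N -> ((2 * (l + a)).+1 <= 5 * l)%N.
  by clear; lia.
have [Q Q0 tail] := determination_tail.
have [a0 fd] := far_disjoint.
have [p0 p00 p0_le] := law_lower_bound i0 iidX.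
have s0 : S.
  have := law_sum1 i0 iidX; case: (pickP (@predT S)) => // no.
  by rewrite big_pred0 // => /eqP; rewrite eq_sym oner_eq0.
have [Bt1 Bt10 hB] := stretched_exp_le (2 * d + 2) c20 c30 ltr01.
pose Bt := Bt1 + 1; have Bt0 : 0 <= Bt by rewrite /Bt; lra.
pose beta n : R := Bt / n.+1%:R ^+ (2 * d + 2).
have beta0 n : 0 <= beta n by rewrite divr_ge0 ?exprn_ge0.
have mS u w := measurable_not_short G t_meas c1 u w.
have not_short u w : pr P [set om | ~ short_optimal G c1 (env om) u w] <= beta (l1norm (u - w)).
  case nE : (l1norm (u - w)) => [|n].
    rewrite /beta expr1n divr1; apply: le_trans (pr_le1 P (mS u w)) _.
    by rewrite /Bt; lra.
  have := short u w; rewrite prE ?lee_fin ?nE; last exact: mS.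
  move=> /le_trans; apply; have := hB n.+1 isT; rewrite powRr1 // => /le_trans; apply.
  by rewrite /beta ler_wpM2r ?invr_ge0 ?exprn_ge0 // /Bt lerDl.
pose q0 n : R := Q / n.+1%:R ^+ decay_exponent d.
have q00 n : 0 <= q0 n by rewrite divr_ge0 ?exprn_ge0 // ltW.
have A0 : (0 < decay_exponent d)%N by rewrite /decay_exponent !addn_gt0 d0 orbT.
pose Cq : R := (2 * d + 1)%:R * Q.
have Cq0 : 0 <= Cq by rewrite mulr_ge0 // ltW.
have q0_decay n : (2 * d + 1)%:R * q0 n * n.+1%:R ^+ ((2 * d + 4) * d + d + 3) <= Cq.
  rewrite /Cq -mulrA ler_wpM2l // /q0 mulrAC ler_pdivrMr ?exprn_gt0 //.
  by rewrite ler_wpM2l ?(ltW Q0) // ler_weXn2l ?ler1n // /decay_exponent leq_addl.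
pose N1 := (Num.truncn c1).+1; pose N := N1.
have c1N : c1 <= N1%:R by exact/ltW/truncnS_gt.
pose Ceta := influence_scale_cst d a0 N N1 Q Bt.
have [Cinf [CinfE Cinf0]] : exists Cinf : R,
    Cinf = influence_cst a0 (2 * d + 1) (d := d) Cq /\ 0 <= Cinf.
  eexists; split; first by [].
  by rewrite !mulr_ge0 ?exprn_ge0 // greedy_cst_ge0.
pose n0 := ((3 * d) ^ (8 * d))%N.
pose Ca : R := 2 * (b * (2 * d + 1)%:R) ^+ 2 * (16 * d%:R).
pose Cb : R := 2 * b ^+ 2 * (1 + N.+1%:R ^+ 2 * Bt).
pose Cc : R := 2 * ((8 / p0 + 4 * Ceta) * b ^+ 2 * Cinf * N%:R * 16).
pose Cs : R := (b * n0.+1%:R) ^+ 2 + 1.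
have Ca0 : 0 <= Ca by rewrite !mulr_ge0 ?sqr_ge0.
have Cb0 : 0 <= Cb by rewrite mulr_ge0 ?mulr_ge0 ?sqr_ge0 // addr_ge0 ?mulr_ge0 ?exprn_ge0.
have Ceta0 : 0 <= Ceta.
  by rewrite !addr_ge0 ?mulr_ge0 ?exprn_ge0 // ltW.
have Cc0 : 0 <= Cc.
  have hp : 0 <= 8 / p0 by rewrite divr_ge0 // ltW.
  have hp' : 0 <= 8 / p0 + 4 * Ceta by rewrite addr_ge0 // mulr_ge0.
  by rewrite !mulr_ge0 ?sqr_ge0.
have Cs0 : 0 < Cs by rewrite ltr_wpDl ?sqr_ge0.
have C0 : 0 < Ca + Cb + Cc + Cs by rewrite ltr_wpDl // !addr_ge0.
exists (Ca + Cb + Cc + Cs) => // v v2.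
have [n nE] : exists n, n = l1norm v by eexists.
rewrite -nE in v2 *.
have n_gt0 : (0 < n)%N by exact: ltnW.
have nR0 : 0 < n%:R :> R by rewrite ltr0n.
have lnn0 : 0 < ln n%:R :> R by rewrite ln_gt0 // ltr1n.
have ratio1 : 1 <= n%:R / ln n%:R :> R by rewrite ler_pdivlMr // mul1r ln_nat_le.
have e8 : (0 < 8 * d)%N by rewrite muln_gt0 d0.
have [r /andP[rn nr]] := root_bracket e8 n_gt0.
have [r3|r3] := ltnP r (3 * d).
  (* At bounded distances the variance is bounded, as the passage time is. *)
  have nn0 : (n <= n0)%N.
    by rewrite (leq_trans (ltnW nr)) // /n0 leq_exp2r.
  have Zb om : 0 <= inf_time G (env om) 0 v <= b * n0.+1%:R.
    have h0 k : 0 <= env om k by case/andP: (t_bound k om).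
    have h1 k : env om k <= b by case/andP: (t_bound k om).
    rewrite inf_time_ge0 //= (le_trans (inf_time_ub G h0 h1 b_ge0 0 v)) //.
    by rewrite ler_wpM2l // ler_nat subr0 -nE.
  have mZ : measurable_fun setT (fun om => inf_time G (env om) 0 v).
    by apply: measurable_inf_time => // k om; case/andP: (t_bound k om).
  apply: le_trans (@variance_le_sqr_dist _ _ _ P _ 0 (b * n0.+1%:R) mZ _) _.
    by move=> om; have /andP[z0 z1] := Zb om; rewrite ger0_norm.
  apply: (@le_trans _ _ (\int[P]_w ((b * n0.+1%:R) ^+ 2)%:E)%E).
    apply: ge0_le_integral => //.
    - by move=> w _; rewrite lee_fin sqr_ge0.
    - apply/measurable_EFinP; apply: measurable_funX; exact: measurable_funB.
    move=> w _; rewrite lee_fin subr0; have /andP[z0 z1] := Zb w.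
    by rewrite ler_sqr ?nnegrE // (le_trans z0).
  rewrite integral_cst //= [X in (_ * X)%E](_ : _ = 1%E) ?mule1; last exact: probability_setT.
  rewrite lee_fin -mulrA.
  apply: (@le_trans _ _ (Cs * 1)); first by rewrite mulr1 /Cs lerDl.
  by apply: ler_pM => //; rewrite ?(ltW Cs0) //; lra.
have r2 : (2 <= r)%N by apply: leq_trans r3; rewrite (leq_trans d_ge2) // leq_pmull.
have r_gt0 : (0 < r)%N by exact: ltnW.
set rho : R := r%:R; have rho1 : 1 < rho by rewrite ltr1n.
have rho0 : 0 < rho by lra.
have [m mE] : exists m, m = (r ^ (2 * d))%N by eexists.
have m0 : (0 < m)%N by rewrite mE expn_gt0 r_gt0.
pose L := (N * n)%N.
have L0 : (0 < L)%N by rewrite muln_gt0.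
have vL : (l1norm v <= L)%N by rewrite -nE /L leq_pmull.
have far : (3 * (d * m) <= l1norm v)%N.
  rewrite -nE; apply: leq_trans rn; rewrite mulnA.
  apply: (@leq_trans (r * m)); first by rewrite leq_mul2r r3 orbT.
  by rewrite mE -expnS leq_pexp2l.
pose U : R := (2 * (a0 * r + 2)).+1%:R ^+ d.
have U1 : 1 <= U by rewrite exprn_ege1 // ler1n.
have rd1 : 1 <= rho ^+ d by rewrite exprn_ege1 // ltW.
have L1 : 1 <= L.+1%:R ^+ 2 :> R by rewrite exprn_ege1 // ler1n.
pose keys := size (domain_keys G m L).
have U0 : 0 < U by exact: lt_le_trans U1.
have rd0 : 0 < rho ^+ d by exact: lt_le_trans rd1.
have L20 : 0 < L.+1%:R ^+ 2 :> R by exact: lt_le_trans L1.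
have th0 : 0 < (L.+1%:R ^+ 2 * (U * rho ^+ d))^-1.
  by rewrite invr_gt0 !mulr_gt0.
have [k0 hk0] := truncation_level th0 A0 (mulr_ge0 (ler0n R keys) (ltW Q0)).
pose x : R := keys%:R * q0 k0.
have x0 : 0 <= x by rewrite mulr_ge0.
have hx : L.+1%:R ^+ 2 * (U * rho ^+ d) * x <= 1.
  by rewrite mulrC -ler_pdivlMr ?mulr_gt0 // div1r /x /q0 mulrA.
have Urx0 : 0 <= U * rho ^+ d * x by rewrite !mulr_ge0 // ltW.
have hx1 : U * rho ^+ d * x <= 1.
  by apply: le_trans hx; rewrite -[leRHS]mulrA ler_peMl.
have hx2 : L.+1%:R ^+ 2 * x <= 1.
  apply: le_trans hx; rewrite [leRHS]mulrAC ler_peMr //; last by rewrite mulr_ege1.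
  by apply: mulr_ge0 => //; exact: ltW.
have lam1 : 1 < rho ^+ d by rewrite exprn_egt1 // -lt0n.
have dom : (size (domain m L : seq (site d)) <= (5 * (N * n)) ^ d)%N.
  rewrite size_box leq_exp2r // -/L.
  apply: five => //.
  by apply: leq_trans vL; apply: leq_trans far; rewrite leq_pmull.
have eta := @influence_scale R d a0 N N1 r n _ m Q Bt x d_ge2 r_gt0 (ltW Q0) Bt0 dom nr hx1 mE.
apply: le_trans (@variance_inf_time R d K dist shift G disp T P t b S I X g iseq i0 s0
  iidX t_meas t_bound b_ge0 t_rep q0 q00 tail a0 fd stationary m L k0 v d0 m0 L0 vL
  c1 N1 beta c1N beta0 not_short far Cq p0 Cq0 q0_decay p00 p0_le _ (rho ^+ d) r lam1) _.
  by rewrite /L /N -nE.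
rewrite lee_fin -/x -CinfE -nE.
set lameta := rho ^+ d * influence_bound _ _ _ _ _ _ _ _ _.
have {}eta : lameta <= Ceta by exact: eta.
have lnlam : 0 < ln (rho ^+ d) by rewrite ln_gt0.
have lns : ln n%:R <= 16 * ln (rho ^+ d) by exact: ln_scale.
have nR : rho ^+ (8 * d) <= n%:R by rewrite -natrX ler_nat.
have ME : m%:R = rho ^+ (2 * d) :> R by rewrite mE natrX.
have partA : 2 * (b * (2 * (d * m) + 1)%:R) ^+ 2 <= Ca * (n%:R / ln n%:R).
  have h1 : (2 * (d * m) + 1)%:R <= (2 * d + 1)%:R * m%:R :> R.
    by rewrite -natrM ler_nat mulnDl mul1n -mulnA leq_add2l.
  have h2 : m%:R ^+ 2 <= 16 * d%:R * (n%:R / ln n%:R) :> R.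
    rewrite mulrA ler_pdivlMr //.
    have lr : ln (rho ^+ d) <= d%:R * rho.
      by rewrite lnXn // -[_ *+ d]mulr_natl ler_wpM2l // ln_nat_le.
    apply: (@le_trans _ _ (m%:R ^+ 2 * (16 * (d%:R * rho)))).
      rewrite ler_wpM2l ?exprn_ge0 //; apply: le_trans lns _.
      by rewrite ler_wpM2l.
    rewrite [leLHS](_ : _ = 16 * d%:R * (m%:R ^+ 2 * rho)); last by ring.
    rewrite ler_wpM2l ?mulr_ge0 //; apply: le_trans nR.
    by rewrite ME -exprM -exprSr ler_weXn2l ?(ltW rho1).
  apply: (@le_trans _ _ (2 * (b * (2 * d + 1)%:R) ^+ 2 * m%:R ^+ 2)).
    rewrite -mulrA ler_wpM2l // -exprMn lerXn2r ?nnegrE ?mulr_ge0 //.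
    by rewrite -mulrA ler_wpM2l.
  by rewrite /Ca -[leRHS]mulrA ler_wpM2l // mulr_ge0 ?sqr_ge0.
have partB : 2 * (b * L.+1%:R) ^+ 2 * (x + (m ^ d)%:R * beta n) <= Cb * (n%:R / ln n%:R).
  apply: (@le_trans _ _ (Cb * 1)); last by rewrite ler_wpM2l.
  rewrite mulr1 /Cb exprMn mulrA -[leLHS]mulrA ler_wpM2l ?mulr_ge0 ?sqr_ge0 //.
  rewrite mulrDr lerD //.
  have h1 : L.+1%:R ^+ 2 <= N.+1%:R ^+ 2 * n%:R ^+ 2 :> R.
    rewrite -exprMn lerXn2r ?nnegrE ?mulr_ge0 // -natrM ler_nat /L mulSn -addn1 addnC.
    by rewrite leq_add2r.
  have h2 : (m ^ d)%:R <= n%:R ^+ d :> R.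
    rewrite natrX lerXn2r ?nnegrE // ler_nat nE (leq_trans _ far) //.
    by rewrite mulnA leq_pmull // muln_gt0.
  have h3 : beta n <= Bt / n%:R ^+ (2 * d + 2).
    rewrite ler_wpM2l // lef_pV2 ?posrE ?exprn_gt0 // lerXn2r ?nnegrE //.
    by rewrite ler_nat.
  apply: (@le_trans _ _ (N.+1%:R ^+ 2 * n%:R ^+ 2 * (n%:R ^+ d * (Bt / n%:R ^+ (2 * d + 2))))).
    by apply: ler_pM => //; [rewrite mulr_ge0|apply: ler_pM].
  rewrite d2E !exprD; have e1 : 1 <= n%:R ^+ d :> R by rewrite exprn_ege1 // ler1n.
  rewrite [leLHS](_ : _ = N.+1%:R ^+ 2 * Bt * (n%:R ^+ d)^-1); last first.
    move: (n%:R ^+ d) e1 (n%:R ^+ 2) (exprn_gt0 2 nR0) => w1 w11 w2 w20.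
    by field; rewrite !gt_eqF //; lra.
  by rewrite ler_piMr ?mulr_ge0 ?exprn_ge0 // invf_le1 //; lra.
have partC : 2 * ((8 / p0 + 4 * lameta) * b ^+ 2 * Cinf * L%:R / ln (rho ^+ d)) <=
    Cc * (n%:R / ln n%:R).
  rewrite /Cc -[leRHS]mulrA ler_wpM2l //.
  rewrite [leRHS](_ : _ = (8 / p0 + 4 * Ceta) * b ^+ 2 * Cinf * L%:R * (16 / ln n%:R)); last first.
    by rewrite /L natrM; move: (ln n%:R)^-1 => iv; ring.
  apply: ler_pM.
  - rewrite !mulr_ge0 ?sqr_ge0 // addr_ge0 ?divr_ge0 ?(ltW p00) // mulr_ge0 //.
    by rewrite mulr_ge0 ?influence_bound_ge0 // ltW // exprn_gt0.
  - by rewrite invr_ge0 ltW.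
  - by rewrite !ler_wpM2r ?sqr_ge0 // lerD2l ler_wpM2l.
  by rewrite ler_pdivlMr // mulrC ler_pdivrMr.
apply: le_trans (lerD (lerD partA partB) partC) _.
rewrite -!mulrDl -[leRHS]mulrA ler_wpM2r //; first exact: le_trans ratio1.
by rewrite lerDl ltW.
Qed.

End SublinearVariance.

(** * The site and the bond version *)

Section LatticePaths.
Context {d : nat}.
Implicit Types (z u v w : site d) (a : dir d) (c : seq (dir d)).

Lemma is_edge_step u a : is_edge [fset u; (u + dvec a)%R]%fset.
Proof.
apply/asboolP; exists u, (u + dvec a); split => //.
by rewrite /lattice_adj opprD addrA subrr sub0r l1normN l1norm_dvec.
Qed.

Definition edge_step u a : edge d := Edge (is_edge_step u a).

Fixpoint steps_of v c : steps d :=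
  if c is a :: c' then (edge_step v a, v + dvec a) :: steps_of (v + dvec a) c'
  else [::].

Lemma size_steps_of v c : size (steps_of v c) = size c.
Proof. by elim: c v => //= a c IH v; rewrite IH. Qed.

Lemma is_path_steps_of v c w : is_path v (steps_of v c) w = (vend v c == w).
Proof. by elim: c v => //= a c IH v; rewrite eqxx IH. Qed.

Lemma edge_dir (e : edge d) v u : endpoints e = [fset v; u]%fset ->
  exists a, u = v + dvec a.
Proof.
move=> eE; case: e eE => A /= /asboolP[x [y [xy ->]]] xyE.
have vu : lattice_adj v u.
  have xney : x != y.
    by apply: contraTneq xy => ->; rewrite /lattice_adj subrr l1norm0.
  have xin : x \in [fset v; u]%fset by rewrite -xyE !inE eqxx.
  have yin : y \in [fset v; u]%fset by rewrite -xyE !inE eqxx orbT.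
  move: xin yin xy xney; rewrite !inE.
  case/orP => /eqP -> /orP[] /eqP -> //; rewrite ?eqxx //.
  by rewrite /lattice_adj l1normB.
have uv1 : l1norm (u - v) = 1%N by rewrite l1normB; exact/eqP.
have [|a ha] := @unit_step d (u - v); first by rewrite -l1norm_eq0 uv1.
exists a; apply/eqP; rewrite addrC -subr_eq -subr_eq0 -l1norm_eq0.
by move: ha; rewrite uv1 => -[->].
Qed.

Lemma path_code v p w : is_path v p w -> exists2 c, p = steps_of v c & vend v c = w.
Proof.
elim: p v => [|[e u] p IH] v /=; first by move=> /eqP <-; exists [::].
case/andP => /eqP eE; have [a uE] := edge_dir eE.
rewrite uE => /IH[c -> cw]; exists (a :: c) => //=.
by congr ((_, _) :: _); apply: val_inj; rewrite /= eE uE.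
Qed.

End LatticePaths.

Section CodedTimes.
Context {R : realType} {d : nat} {K : eqType} {dist : K -> K -> R}
  {shift : site d -> K -> K} (G : keying dist shift).
Context (x : K -> R) (tm : site d -> steps d -> R).
Hypothesis tmE : forall v c, tm v (steps_of v c) = time G x v c.

Lemma passage_time_inf_time v w : passage_time tm v w = inf_time G x v w.
Proof.
rewrite /passage_time /inf_time; congr inf; apply/seteqP; split => r /=.
  by move=> [p /path_code[c -> cw] <-]; exists c.
by move=> [c cw <-]; exists (steps_of v c); rewrite ?is_path_steps_of ?cw ?tmE.
Qed.

Lemma optimal_path_short c1 v w :
  (exists2 p, optimal_path tm v p w &
     ((nb_vertices p)%:R <= c1 * (l1norm (v - w))%:R)%R) <->
  short_optimal G c1 x v w.
Proof.
split => [[p [/path_code[c -> cw] opt] sz]|[c [cw sz opt]]].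
  exists c; split => //.
    by rewrite /nb_vertices size_steps_of in sz.
  by move=> c' c'w; rewrite -!tmE; apply: opt; rewrite is_path_steps_of c'w.
exists (steps_of v c); last by rewrite /nb_vertices size_steps_of.
split; first by rewrite is_path_steps_of cw.
by move=> q /path_code[c' -> c'w]; rewrite !tmE; exact: opt.
Qed.

End CodedTimes.

Section Representations.
Context {R : realType} {d : nat}.

Lemma site_near_dist (y y' k k' : site d) : k \in [:: y] -> k' \in [:: y'] ->
  (l1norm (y - y'))%:R <= site_dist R k k' + 2.
Proof. by rewrite !inE => /eqP -> /eqP ->; rewrite lerDl. Qed.

Definition site_keying : keying (@site_dist R d) (@shift_site d).
Proof.
refine (@Keying R d (site d) (@site_dist R d) (@shift_site d)
  (fun z => [:: z]) (fun z a => z + dvec a) (fun z => [:: z]) _ _ _ _ _ _ _) => //.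
- by move=> z.
- by move=> z a; rewrite inE.
- by move=> z; rewrite addn1.
- exact: site_near_dist.
- by move=> z w a; rewrite /shift_site addrAC.
Defined.

Definition incident_edges (y : site d) : seq (edge d) :=
  [seq edge_step (y - dvec a) a | a : dir d].

Lemma incident_endpoint y k x : k \in incident_edges y -> x \in endpoints k ->
  (l1norm (x - y) <= 1)%N.
Proof.
move=> /mapP[a _ ->] /=; rewrite !inE subrK => /orP[] /eqP ->.
  by rewrite addrAC subrr sub0r l1normN l1norm_dvec.
by rewrite subrr l1norm0.
Qed.

Lemma edge_near_dist (y y' : site d) k k' :
  k \in incident_edges y -> k' \in incident_edges y' ->
  (l1norm (y - y'))%:R <= edge_dist R k k' + 2.
Proof.
move=> ky ky'; rewrite -lerBlDr; apply: lb_le_inf.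
  have nonempty (e : edge d) : exists x, x \in endpoints e.
    by case: e => A /= /asboolP[x [x' [_ ->]]]; exists x; rewrite !inE eqxx.
  have [x xk] := nonempty k; have [x' xk'] := nonempty k'.
  by exists (site_dist R x x'), x => //; exists x'.
move=> _ [x /= xk [x' /= xk' <-]]; rewrite lerBlDr /site_dist -natrD ler_nat.
have h1 := incident_endpoint ky xk; have h2 := incident_endpoint ky' xk'.
have := l1norm_triangle x y y'; have := l1norm_triangle x' x y'.
by rewrite (l1normB y x); lia.
Qed.

Definition bond_keying : keying (@edge_dist R d) (@shift_edge d).
Proof.
refine (@Keying R d (edge d) (@edge_dist R d) (@shift_edge d)
  (fun=> [::]) (@edge_step d) incident_edges _ _ _ _ _ _ _) => //.
- move=> z a; apply/mapP; exists a; first by rewrite mem_enum.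
  by apply: val_inj; rewrite /= addrK.
- by move=> y; rewrite size_map -cardE card_prod card_ord card_bool mulnC leq_addr.
- exact: edge_near_dist.
- move=> z w a; apply: val_inj; rewrite /= imfset_fset2.
  by rewrite addrAC.
Defined.

Lemma site_time_coded (x : site d -> R) v c :
  site_time x v (steps_of v c) = time site_keying x v c.
Proof.
rewrite /site_time /time /= big_seq1; congr (_ + _).
elim: c v => [|a c IH] v /=; first by rewrite big_nil.
by rewrite big_cons IH.
Qed.

Lemma bond_time_coded (x : edge d -> R) v c :
  bond_time x v (steps_of v c) = time bond_keying x v c.
Proof.
rewrite /bond_time /time /= big_nil add0r.
elim: c v => [|a c IH] v /=; first by rewrite big_nil.
by rewrite big_cons IH.
Qed.

Lemma variance_of_representation (K : eqType) (dist : K -> K -> R)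
    (shift : site d -> K -> K) (G : keying dist shift)
    (tm : (K -> R) -> site d -> steps d -> R)
    (disp : measure_display) (T : measurableType disp) (P : probability T R)
    (t : K -> {RV P >-> R}) (b : R) :
  (forall x v c, tm x v (steps_of v c) = time G x v c) ->
  (2 <= d)%N -> 0 <= b -> (forall k w, 0 <= t k w <= b) ->
  has_representation P dist shift tm (fun k => t k : T -> R) ->
  exists2 C : R, 0 < C & forall v : site d, (2 <= l1norm v)%N ->
    ('V_P[fun om => passage_time (tm (fun k => t k om)) 0%R v]
      <= (C * (l1norm v)%:R / ln (l1norm v)%:R)%:E)%E.
Proof.
move=> tmE d2 b0 tb [S [I [X [g [Iinf iidX rep [[iseq ci cii] ciii civ]]]]]].
have [c1 [c2 [c3 [_ c20 c30 short]]]] := civ.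
have [|||C C0 hC] := @variance_sublinear R d K dist shift G disp T P
  (fun k => t k : T -> R) b S I X g iseq d2 iidX _ tb b0 _ ci cii ciii c1 c2 c3 c20 c30 _ Iinf.
- by move=> k; exact: measurable_funP.
- by move=> k w; have [_ ->] := rep k.
- move=> u w; apply: le_trans (short u w).
  rewrite le_eqVlt; apply/orP; left; apply/eqP; congr (P _).
  apply/seteqP; split => om /= h h'; apply: h.
    exact/(optimal_path_short (tmE _)).
  exact/(optimal_path_short (tmE _)).
exists C => // v v2; apply: le_trans (hC v v2).
rewrite le_eqVlt; apply/orP; left; apply/eqP; congr variance.
by apply/funext => om; exact: passage_time_inf_time.
Qed.

End Representations.

Theorem theorem1p7 (R : realType) (d : nat) (b : R)
    (hd : (2 <= d)%N) (hb : 0 < b) :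
  (forall (disp : measure_display) (T : measurableType disp)
      (P : probability T R) (t : site d -> {RV P >-> R}),
    (forall v omega, 0 <= t v omega <= b) ->
    site_representation P (fun v => t v : T -> R) ->
    exists2 C : R, 0 < C &
      forall v : site d, (2 <= l1norm v)%N ->
        ('V_P[fun omega => passage_time (site_time (fun u => t u omega)) 0%R v]
         <= (C * (l1norm v)%:R / ln (l1norm v)%:R)%:E)%E)
  /\
  (forall (disp : measure_display) (T : measurableType disp)
      (P : probability T R) (t : edge d -> {RV P >-> R}),
    (forall e omega, 0 <= t e omega <= b) ->
    bond_representation P (fun e => t e : T -> R) ->
    exists2 C : R, 0 < C &
      forall v : site d, (2 <= l1norm v)%N ->
        ('V_P[fun omega => passage_time (bond_time (fun e => t e omega)) 0%R v]
         <= (C * (l1norm v)%:R / ln (l1norm v)%:R)%:E)%E).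
Proof.
split => disp T P t tb rep.
  apply: (variance_of_representation (G := site_keying) _ hd (ltW hb) tb rep).
  exact: site_time_coded.
apply: (variance_of_representation (G := bond_keying) _ hd (ltW hb) tb rep).
exact: bond_time_coded.
Qed.
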